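(* Let $\mathbf{k}$ be an algebraically closed field of characteristic zero, let $\pi\colon X\to Y$ be a dominant morphism of irreducible varieties over $\mathbf{k}$, let $K$ be an algebraic closure of the function field $\mathbf{k}(Y)$, and assume that the geometric generic fibre $X_K$ of $\pi$ is an irreducible $K$-variety. Let $\sigma\in\mathrm{Bir}(X/Y)$. Then $\sigma_K\in\mathrm{Bir}_K(X_K)$ is unipotent if and only if $\sigma\in\mathrm{Bir}(X/Y)$ is unipotent.
   Context: Varieties are reduced separated schemes of finite type over the algebraically closed base field. $\mathrm{Bir}(X/Y)\subseteq\mathrm{Bir}(X)$ is the subgroup of birational transformations $\sigma$ of $X$ that induce the identity on $Y$ (i.e. $\pi\circ\sigma=\pi$). $X_K$ is the pull-back of $\pi$ along $\mathrm{Spec}(K)\to Y$; $\mathrm{Bir}_K(X_K)$ is its group of $K$-birational transformations; its function field is $K(X_K)=\mathbf{k}(X)\otimes_{\mathbf{k}(Y)}K$. The map $\mathrm{Bir}(X/Y)\to\mathrm{Bir}_K(X_K)$, $\sigma\mapsto\sigma_K$, is the pull-back homomorphism. For an algebraic group $A$, a rational $A$-action on $X$ is a rational map $\alpha\colon A\times X\dashrightarrow X$ such that $(g,x)\mapsto(g,\alpha(g,x))$ is a dominant rational map $A\times X\dashrightarrow A\times X$ and $\alpha(g_1g_2,x)=\alpha(g_1,\alpha(g_2,x))$ as rational maps on $A\times A\times X$; it induces a group homomorphism $A\to\mathrm{Bir}(X)$. An element of $\mathrm{Bir}(X)$ is unipotent if it lies in the image of the homomorphism $\mathbb{G}_a\to\mathrm{Bir}(X)$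 of some rational $\mathbb{G}_a$-action on $X$; the same definition is used over $K$ for $\mathrm{Bir}_K(X_K)$, with $\mathbb{G}_{a,K}$. *)

(* Defs.v *)
From HB Require Import structures.
From mathcomp Require Import all_boot all_order all_algebra generic_quotient.
From mathcomp Require Import all_classical topology.
Set Implicit Arguments. Unset Strict Implicit. Unset Printing Implicit Defensive.
Import GRing.Theory.
Local Open Scope classical_set_scope.
Local Open Scope ring_scope.
Local Open Scope quotient_scope.

(* Varieties over an algebraically closed field k are set up in the classical *)
(* language of spaces with functions: a topological space of (closed) points  *)
(* with a sheaf of k-valued functions, locally isomorphic to a Zariski closed *)
(* subset of an affine space.                                                 *)

(* [reg U f] reads: f is regular on the open set U. Functions are total, and  *)
(* only the values on U matter.                                               *)
Record funspace (k : fieldType) := FunSpace {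
  pts :> topologicalType;
  reg : set pts -> set (pts -> k);
  reg_ext : forall U f g, open U -> (forall x, U x -> f x = g x) ->
    reg U f -> reg U g;
  reg_res : forall U V f, open U -> open V -> V `<=` U -> reg U f -> reg V f;
  reg_glue : forall U f, open U ->
    (forall x, U x -> exists V, [/\ open V, V x, V `<=` U & reg V f]) ->
    reg U f;
  reg_cst : forall U c, open U -> reg U (fun=> c);
  regD : forall U f g, open U -> reg U f -> reg U g ->
    reg U (fun x => f x + g x);
  regM : forall U f g, open U -> reg U f -> reg U g ->
    reg U (fun x => f x * g x);
  reg_open : forall U f, open U -> reg U f -> open (U `&` [set x | f x != 0]);
  regV : forall U f, open U -> reg U f ->
    reg (U `&` [set x | f x != 0]) (fun x => (f x)^-1) }.

Inductive kalg (k : fieldType) (T : Type) (S : set (T -> k)) : set (T -> k) :=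
| kalg_cst c : kalg S (fun=> c)
| kalg_gen f : S f -> kalg S f
| kalg_add f g : kalg S f -> kalg S g -> kalg S (fun x => f x + g x)
| kalg_mul f g : kalg S f -> kalg S g -> kalg S (fun x => f x * g x).

(* Spaces generated by functions. Each chart D carries functions [gens D] on  *)
(* D. The basic open sets are {x in D | q x != 0} and the regular functions   *)
(* are those that are locally of the form p / q, where p and q are in the     *)
(* k-algebra generated by [gens D].                                           *)
Record gendata (k : fieldType) (T : choiceType) := GenData {
  chart : set (set T);
  gens : set T -> set (T -> k);
  chart_cover : forall x, exists2 D, chart D & D x;
  chart_meet : forall D E, chart D -> chart E -> chart (D `&` E);
  gens_res : forall D E, chart D -> chart E -> gens D `<=` gens (D `&` E) }.

Definition genpt (k : fieldType) (T : choiceType) (d : gendata k T) : Type := T.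
HB.instance Definition _ k T (d : gendata k T) := Choice.on (genpt d).

Section GenSpace.
Context (k : fieldType) (T : choiceType) (d : gendata k T).

Definition genopen : set (set T) := [set O | forall x, O x ->
  exists D q, [/\ chart d D, kalg (gens d D) q, D x, q x != 0 &
    D `&` [set y | q y != 0] `<=` O]].

Definition genreg (U : set T) : set (T -> k) := [set f | forall x, U x ->
  exists D p q, [/\ chart d D, kalg (gens d D) p, kalg (gens d D) q,
    D x /\ q x != 0 &
    forall y, U y -> D y -> q y != 0 -> f y = p y / q y]].

Lemma kalg_resl D E f : chart d D -> chart d E ->
  kalg (gens d D) f -> kalg (gens d (D `&` E)) f.
Proof.
move=> hD hE; elim=> [c|g Sg|g h _ ? _ ?|g h _ ? _ ?].
- exact: kalg_cst.
- by apply: kalg_gen; apply: gens_res.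
- exact: kalg_add.
- exact: kalg_mul.
Qed.

Lemma kalg_resr D E f : chart d D -> chart d E ->
  kalg (gens d E) f -> kalg (gens d (D `&` E)) f.
Proof. by move=> hD hE; rewrite setIC; apply: kalg_resl. Qed.

Lemma genopenT : genopen setT.
Proof.
move=> x _; have [D hD Dx] := chart_cover d x.
by exists D, (fun=> 1); split=> //; [exact: kalg_cst|rewrite oner_neq0].
Qed.

Lemma genopenI : setI_closed genopen.
Proof.
move=> A B hA hB x [Ax Bx].
have [D [p [hD hp Dx px sA]]] := hA _ Ax.
have [E [q [hE hq Ex qx sB]]] := hB _ Bx.
exists (D `&` E), (fun y => p y * q y); split.
- exact: chart_meet.
- by apply: kalg_mul; [exact: kalg_resl|exact: kalg_resr].
- by [].
- by rewrite mulf_neq0.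
- move=> y [[Dy Ey]] /=; rewrite mulf_eq0 negb_or => /andP[py qy].
  by split; [apply: sA|apply: sB].
Qed.

Lemma genopen_bigU (I : Type) (F : I -> set T) :
  (forall i, genopen (F i)) -> genopen (\bigcup_i F i).
Proof.
move=> hF x [i _ Fx]; have [D [q [hD hq Dx qx sF]]] := hF i _ Fx.
by exists D, q; split=> // y /sF Fy; exists i.
Qed.

HB.instance Definition _ := @isOpenTopological.Build (genpt d) genopen
  genopenT genopenI genopen_bigU.

Lemma genopenE (U : set (genpt d)) : open U = genopen U.
Proof. by []. Qed.

Lemma genreg_ext (U : set (genpt d)) f g : open U ->
  (forall x, U x -> f x = g x) -> genreg U f -> genreg U g.
Proof.
move=> _ fg hf x Ux; have [D [p [q [hD hp hq Dx e]]]] := hf _ Ux.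
by exists D, p, q; split=> // y Uy Dy qy; rewrite -fg // e.
Qed.

Lemma genreg_res (U V : set (genpt d)) f : open U -> open V -> V `<=` U ->
  genreg U f -> genreg V f.
Proof.
move=> _ _ sVU hf x Vx; have [D [p [q [hD hp hq Dx e]]]] := hf _ (sVU _ Vx).
by exists D, p, q; split=> // y Vy Dy qy; rewrite e //; apply: sVU.
Qed.

Lemma genreg_glue (U : set (genpt d)) f : open U ->
  (forall x, U x -> exists V, [/\ open V, V x, V `<=` U & genreg V f]) ->
  genreg U f.
Proof.
move=> _ hf x Ux; have [V [oV Vx sVU hV]] := hf _ Ux.
have [D [p [q [hD hp hq [Dx qx] e]]]] := hV _ Vx.
move: oV; rewrite genopenE => /(_ _ Vx)[E [r [hE hr Ex rx sV]]].
exists (D `&` E), (fun y => p y * r y), (fun y => q y * r y); split.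
- exact: chart_meet.
- by apply: kalg_mul; [exact: kalg_resl|exact: kalg_resr].
- by apply: kalg_mul; [exact: kalg_resl|exact: kalg_resr].
- by split=> //; rewrite mulf_neq0.
- move=> y Uy [Dy Ey]; rewrite mulf_eq0 negb_or => /andP[qy ry].
  by rewrite e ?mulf_div ?divff ?mulr1 // -?mulf_div ?divff ?mulr1 //; apply: sV.
Qed.

Lemma genreg_cst (U : set (genpt d)) c : open U -> genreg U (fun=> c).
Proof.
move=> _ x _; have [D hD Dx] := chart_cover d x.
exists D, (fun=> c), (fun=> 1); split=> //; try exact: kalg_cst.
- by rewrite oner_neq0.
- by move=> y _ _ _; rewrite divr1.
Qed.

Lemma genregD (U : set (genpt d)) f g : open U -> genreg U f -> genreg U g ->
  genreg U (fun x => f x + g x).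
Proof.
move=> _ hf hg x Ux.
have [D [p [q [hD hp hq [Dx qx] e]]]] := hf _ Ux.
have [E [r [s [hE hr hs [Ex sx] e']]]] := hg _ Ux.
exists (D `&` E), (fun y => p y * s y + r y * q y), (fun y => q y * s y).
have resl h := @kalg_resl D E h hD hE; have resr h := @kalg_resr D E h hD hE.
split.
- exact: chart_meet.
- by apply: kalg_add; apply: kalg_mul; auto.
- by apply: kalg_mul; auto.
- by split=> //; rewrite mulf_neq0.
- move=> y Uy [Dy Ey]; rewrite mulf_eq0 negb_or => /andP[qy sy].
  by rewrite e // e' // addf_div.
Qed.

Lemma genregM (U : set (genpt d)) f g : open U -> genreg U f -> genreg U g ->
  genreg U (fun x => f x * g x).
Proof.
move=> _ hf hg x Ux.
have [D [p [q [hD hp hq [Dx qx] e]]]] := hf _ Ux.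
have [E [r [s [hE hr hs [Ex sx] e']]]] := hg _ Ux.
exists (D `&` E), (fun y => p y * r y), (fun y => q y * s y).
have resl h := @kalg_resl D E h hD hE; have resr h := @kalg_resr D E h hD hE.
split.
- exact: chart_meet.
- by apply: kalg_mul; auto.
- by apply: kalg_mul; auto.
- by split=> //; rewrite mulf_neq0.
- move=> y Uy [Dy Ey]; rewrite mulf_eq0 negb_or => /andP[qy sy].
  by rewrite e // e' // mulf_div.
Qed.

Lemma genreg_open (U : set (genpt d)) f : open U -> genreg U f ->
  open (U `&` [set x | f x != 0]).
Proof.
rewrite !genopenE => oU hf x [Ux /= fx].
have [D [p [q [hD hp hq [Dx qx] e]]]] := hf _ Ux.
have [E [r [hE hr Ex rx sU]]] := oU _ Ux.
have resl h := @kalg_resl D E h hD hE; have resr h := @kalg_resr D E h hD hE.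
have px : p x != 0.
  by move: fx; rewrite e //; apply: contra_neq => ->; rewrite mul0r.
exists (D `&` E), (fun y => p y * q y * r y); split.
- exact: chart_meet.
- by apply: kalg_mul; [apply: kalg_mul; auto|auto].
- by [].
- by rewrite !mulf_neq0.
- move=> y [[Dy Ey]] /=; rewrite !mulf_eq0 !negb_or => /andP[/andP[py qy] ry].
  have Uy : U y by apply: sU.
  by split=> //=; rewrite e // mulf_neq0 // invr_eq0.
Qed.

Lemma genregV (U : set (genpt d)) f : open U -> genreg U f ->
  genreg (U `&` [set x | f x != 0]) (fun x => (f x)^-1).
Proof.
move=> _ hf x [Ux /= fx].
have [D [p [q [hD hp hq [Dx qx] e]]]] := hf _ Ux.
have px : p x != 0.
  by move: fx; rewrite e //; apply: contra_neq => ->; rewrite mul0r.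
exists D, (fun y => q y * q y), (fun y => p y * q y); split=> //.
- exact: kalg_mul.
- exact: kalg_mul.
- by split=> //; rewrite mulf_neq0.
- move=> y [Uy /= fy] Dy; rewrite mulf_eq0 negb_or => /andP[py qy].
  by rewrite e // invf_div -mulf_div divff // mulr1.
Qed.

Definition genspace : funspace k := @FunSpace k (genpt d) genreg
  genreg_ext genreg_res genreg_glue genreg_cst genregD genregM
  genreg_open genregV.

End GenSpace.

Section AffineSpace.
Context (k : fieldType) (n : nat).

Definition affine_data : gendata k 'rV[k]_n.
Proof.
refine (@GenData k 'rV[k]_n [set setT]
  (fun _ => [set f | exists i, f = fun v : 'rV[k]_n => v ord0 i]) _ _ _).
- by move=> x; exists setT.
- by move=> D E -> ->; rewrite /= setTI.
- by move=> D E _ _ f.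
Defined.

Definition affine_space : funspace k := genspace affine_data.

End AffineSpace.

(* The structure induced on a locally closed subset S of X. *)
Section Induced.
Context (k : fieldType) (X : funspace k) (S : set X).

Definition induced_data : gendata k (set_type S).
Proof.
refine (@GenData k (set_type S)
  [set D | exists2 U : set X, open U & D = [set x | U (val x)]]
  (fun D => [set h | exists U f, [/\ open U, reg U f,
     D = [set x | U (val x)] & h = fun x => f (val x)]]) _ _ _).
- by move=> x; exists setT => //; exists setT => //; apply: openT.
- by move=> D E [U oU ->] [V oV ->]; exists (U `&` V) => //; apply: openI.
- move=> D E _ [V oV ->] h [U [f [oU rf -> ->]]].
  exists (U `&` V), f; split=> //; first exact: openI.
  by apply: reg_res rf => //; apply: openI.
Defined.

Definition induced : funspace k := genspace induced_data.

End Induced.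

Section Product.
Context (k : fieldType) (X Z : funspace k).

Definition prod_data : gendata k (X * Z)%type.
Proof.
refine (@GenData k (X * Z)%type
  [set D | exists U V, [/\ open U, open V & D = U `*` V]]
  (fun D => [set h | exists U V, [/\ open U, open V, D = U `*` V &
     (exists2 f, reg U f & h = fun p => f p.1) \/
     (exists2 g, reg V g & h = fun p => g p.2)]]) _ _ _).
- move=> x; exists setT => //; exists setT, setT.
  by split; [exact: openT|exact: openT|rewrite setXTT].
- move=> D E [U [V [oU oV ->]]] [U' [V' [oU' oV' ->]]].
  by exists (U `&` U'), (V `&` V'); split; [exact: openI|exact: openI|rewrite setXI].
- move=> D E _ [U' [V' [oU' oV' ->]]] h [U [V [oU oV -> H]]].
  exists (U `&` U'), (V `&` V').
  split; [exact: openI|exact: openI|by rewrite setXI|].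
  case: H => [[f rf ->]|[f rf ->]]; [left|right]; exists f => //.
    by apply: reg_res rf => //; apply: openI.
  by apply: reg_res rf => //; apply: openI.
Defined.

Definition prod_space : funspace k := genspace prod_data.

End Product.

Section Varieties.
Context (k : fieldType).

Definition morphism_on (X Z : funspace k) (U : set X) (f : X -> Z) : Prop :=
  forall V : set Z, open V -> open (U `&` f @^-1` V) /\
    forall h, reg V h -> reg (U `&` f @^-1` V) (h \o f).

Definition morphism (X Z : funspace k) (f : X -> Z) : Prop :=
  morphism_on setT f.

Definition isomorphic (X Z : funspace k) : Prop :=
  exists (f : X -> Z) (g : Z -> X),
    [/\ morphism f, morphism g, cancel f g & cancel g f].

Definition affine_subset (X : funspace k) (U : set X) : Prop :=
  exists (n : nat) (Z : set (affine_space k n)),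
    closed Z /\ isomorphic (induced U) (induced Z).

Definition variety (X : funspace k) : Prop :=
  (exists (n : nat) (U : 'I_n -> set X),
     (forall i, open (U i) /\ affine_subset (U i)) /\ \bigcup_i U i = setT) /\
  closed [set p : prod_space X X | p.1 = p.2].

Definition irreducible (X : topologicalType) : Prop :=
  [set: X] !=set0 /\
  forall U V : set X, open U -> open V -> U !=set0 -> V !=set0 ->
    U `&` V !=set0.

Definition dominant (X Z : topologicalType) (f : X -> Z) : Prop :=
  dense (range f).

End Varieties.

Record irrvariety (k : closedFieldType) := IrrVariety {
  irrsp :> funspace k;
  irr_variety : variety irrsp;
  irr_irreducible : irreducible irrsp }.

Section FunctionField.
Context (k : closedFieldType) (Y : irrvariety k).

Record germ := Germ {
  gdom : set Y;
  gfun : Y -> k;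
  gdom_open : open gdom;
  gdom_neq0 : gdom !=set0;
  greg : reg gdom gfun }.

HB.instance Definition _ := gen_eqMixin germ.
HB.instance Definition _ := gen_choiceMixin germ.

Definition germ_eqv (f g : germ) : bool := `[< exists W : set Y,
  [/\ open W, W !=set0, W `<=` gdom f `&` gdom g &
      forall x, W x -> gfun f x = gfun g x] >].

Lemma germ_eqvP f g : reflect (exists W : set Y,
  [/\ open W, W !=set0, W `<=` gdom f `&` gdom g &
      forall x, W x -> gfun f x = gfun g x]) (germ_eqv f g).
Proof. exact: asboolP. Qed.

Lemma germ_eqv_refl : reflexive germ_eqv.
Proof.
move=> f; apply/germ_eqvP; exists (gdom f).
by split=> //; [exact: gdom_open|exact: gdom_neq0].
Qed.

Lemma germ_eqv_sym : symmetric germ_eqv.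
Proof.
move=> f g; apply/germ_eqvP/germ_eqvP => -[W [oW nW sW e]]; exists W;
  by split=> // [x /sW[]|x Wx]; rewrite ?e.
Qed.

Lemma irr_meet (U V : set Y) : open U -> open V -> U !=set0 -> V !=set0 ->
  U `&` V !=set0.
Proof. by have [_] := irr_irreducible Y; apply. Qed.

Lemma irrT : [set: Y] !=set0.
Proof. by have [] := irr_irreducible Y. Qed.

Lemma germ_eqv_trans : transitive germ_eqv.
Proof.
move=> g f h /germ_eqvP[W [oW nW sW e]] /germ_eqvP[W' [oW' nW' sW' e']].
apply/germ_eqvP; exists (W `&` W'); split.
- exact: openI.
- exact: irr_meet.
- by move=> x [/sW[fx _] /sW'[_ hx]].
- by move=> x [Wx W'x]; rewrite e // e'.
Qed.

Canonical germ_equiv := EquivRel germ_eqv germ_eqv_refl germ_eqv_sym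
  germ_eqv_trans.

(* The function field k(Y). *)
Definition funfield := {eq_quot germ_equiv}.
HB.instance Definition _ := Choice.on funfield.
HB.instance Definition _ := EqQuotient.on funfield.

Definition rfun (f : germ) : funfield := \pi_funfield f.

Lemma rfun_eq f g (W : set Y) : open W -> W !=set0 ->
  W `<=` gdom f `&` gdom g -> (forall x, W x -> gfun f x = gfun g x) ->
  rfun f = rfun g.
Proof.
by move=> oW nW sW e; apply/eqmodP/germ_eqvP; exists W.
Qed.

Definition germ_cst (c : k) : germ :=
  Germ openT irrT (@reg_cst _ Y setT c openT).

Definition germ_res2 (op : k -> k -> k)
  (opP : forall U f g, open U -> reg U f -> reg U g ->
     reg U (fun x : Y => op (f x) (g x))) (f g : germ) : germ.
Proof.
refine (@Germ (gdom f `&` gdom g) (fun x => op (gfun f x) (gfun g x)) _ _ _).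
- by apply: openI; apply: gdom_open.
- by apply: irr_meet; [exact: gdom_open|exact: gdom_open|exact: gdom_neq0|
    exact: gdom_neq0].
- have oI : open (gdom f `&` gdom g) by apply: openI; apply: gdom_open.
  apply: opP => //.
    by apply: reg_res (greg f) => //; exact: gdom_open.
  by apply: reg_res (greg g) => //; exact: gdom_open.
Defined.

Definition germ_add := @germ_res2 +%R (@regD _ Y).
Definition germ_mul := @germ_res2 *%R (@regM _ Y).
Definition germ_opp (f : germ) := germ_mul (germ_cst (-1)) f.

Definition germ_inv (f : germ) : germ :=
  match pselect (gdom f `&` [set x | gfun f x != 0] !=set0) with
  | left nz => Germ (reg_open (gdom_open f) (greg f)) nz
                    (regV (gdom_open f) (greg f))
  | right _ => germ_cst 0
  end.

Definition ff_zero : funfield := rfun (germ_cst 0).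
Definition ff_one : funfield := rfun (germ_cst 1).
Definition ff_add (a b : funfield) : funfield := rfun (germ_add (repr a) (repr b)).
Definition ff_mul (a b : funfield) : funfield := rfun (germ_mul (repr a) (repr b)).
Definition ff_opp (a : funfield) : funfield := rfun (germ_opp (repr a)).
Definition ff_inv (a : funfield) : funfield := rfun (germ_inv (repr a)).

Lemma repr_rfun f : germ_eqv (repr (rfun f)) f.
Proof. by have /eqmodP := reprK (rfun f). Qed.

Lemma rfun_repr a : rfun (repr a) = a.
Proof. exact: reprK. Qed.

Lemma ff_addE f g : ff_add (rfun f) (rfun g) = rfun (germ_add f g).
Proof.
have /germ_eqvP[W [oW nW sW e]] := repr_rfun f.
have /germ_eqvP[W' [oW' nW' sW' e']] := repr_rfun g.
apply: (@rfun_eq _ _ (W `&` W')).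
- exact: openI.
- exact: irr_meet.
- by move=> x [/sW[? ?] /sW'[? ?]].
- by move=> x [Wx W'x] /=; rewrite e // e'.
Qed.

Lemma ff_mulE f g : ff_mul (rfun f) (rfun g) = rfun (germ_mul f g).
Proof.
have /germ_eqvP[W [oW nW sW e]] := repr_rfun f.
have /germ_eqvP[W' [oW' nW' sW' e']] := repr_rfun g.
apply: (@rfun_eq _ _ (W `&` W')).
- exact: openI.
- exact: irr_meet.
- by move=> x [/sW[? ?] /sW'[? ?]].
- by move=> x [Wx W'x] /=; rewrite e // e'.
Qed.

Lemma ff_oppE f : ff_opp (rfun f) = rfun (germ_opp f).
Proof.
have /germ_eqvP[W [oW nW sW e]] := repr_rfun f.
apply: (@rfun_eq _ _ W) => //; first by move=> x /sW[].
by move=> x Wx /=; rewrite e.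
Qed.

Lemma rfun_eqT f g : gdom f = gdom g -> gfun f =1 gfun g -> rfun f = rfun g.
Proof.
move=> ed ef; apply: (@rfun_eq _ _ (gdom f)) => //.
- exact: gdom_open.
- exact: gdom_neq0.
- by rewrite -ed setIid.
Qed.

Lemma ff_addA : associative ff_add.
Proof.
move=> a b c; rewrite -(rfun_repr a) -(rfun_repr b) -(rfun_repr c) !ff_addE.
by apply: rfun_eqT => [|x] /=; rewrite ?setIA ?addrA.
Qed.

Lemma ff_addC : commutative ff_add.
Proof.
move=> a b; rewrite -(rfun_repr a) -(rfun_repr b) !ff_addE.
by apply: rfun_eqT => [|x] /=; rewrite 1?setIC // addrC.
Qed.

Lemma ff_add0 : left_id ff_zero ff_add.
Proof.
move=> a; rewrite -(rfun_repr a) ff_addE.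
by apply: rfun_eqT => [|x] /=; rewrite ?setTI ?add0r.
Qed.

Lemma ff_addN : left_inverse ff_zero ff_opp ff_add.
Proof.
move=> a; rewrite -(rfun_repr a) ff_oppE ff_addE.
apply: (@rfun_eq _ _ (gdom (repr a))) => //=.
- exact: gdom_open.
- exact: gdom_neq0.
- by move=> x _; rewrite mulN1r addNr.
Qed.

Lemma ff_mulA : associative ff_mul.
Proof.
move=> a b c; rewrite -(rfun_repr a) -(rfun_repr b) -(rfun_repr c) !ff_mulE.
by apply: rfun_eqT => [|x] /=; rewrite ?setIA ?mulrA.
Qed.

Lemma ff_mulC : commutative ff_mul.
Proof.
move=> a b; rewrite -(rfun_repr a) -(rfun_repr b) !ff_mulE.
by apply: rfun_eqT => [|x] /=; rewrite 1?setIC // mulrC.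
Qed.

Lemma ff_mul1 : left_id ff_one ff_mul.
Proof.
move=> a; rewrite -(rfun_repr a) ff_mulE.
by apply: rfun_eqT => [|x] /=; rewrite ?setTI ?mul1r.
Qed.

Lemma ff_mulDl : left_distributive ff_mul ff_add.
Proof.
move=> a b c; rewrite -(rfun_repr a) -(rfun_repr b) -(rfun_repr c).
rewrite !(ff_addE, ff_mulE).
by apply: rfun_eqT => [|x] /=; rewrite ?mulrDl // -setIIl.
Qed.

Lemma rfun_cst_eq0 f : (rfun f == ff_zero) =
  ~~ `[< gdom f `&` [set x | gfun f x != 0] !=set0 >].
Proof.
apply/eqP/idP => [/eqmodP/germ_eqvP[W [oW nW sW e]]|/asboolPn fz].
  apply/asboolPn => nz.
  have [x [Wx [_ /=]]] := irr_meet oW (reg_open (gdom_open f) (greg f)) nW nz.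
  by rewrite e //= eqxx.
apply: (@rfun_eq _ _ (gdom f)) => /=.
- exact: gdom_open.
- exact: gdom_neq0.
- by rewrite setIT.
- move=> x fx; apply/eqP; apply: contrapT => /negP nz.
  by apply: fz; exists x.
Qed.

Lemma ff_oner_neq0 : ff_one != ff_zero.
Proof.
rewrite rfun_cst_eq0 negbK; apply/asboolP; have [x _] := irrT.
by exists x; split=> //=; rewrite oner_neq0.
Qed.

Lemma ff_mulVf a : a != ff_zero -> ff_mul (ff_inv a) a = ff_one.
Proof.
rewrite -{1}(rfun_repr a) rfun_cst_eq0 negbK => /asboolP nz.
rewrite -{2}(rfun_repr a) ff_mulE /germ_inv; case: pselect => // nz'.
apply: (@rfun_eq _ _ (gdom (repr a) `&` [set x | gfun (repr a) x != 0])) => //=.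
- exact: reg_open (gdom_open _) (greg _).
- by move=> x [? ?].
- by move=> x [_ /= ?]; rewrite mulVf.
Qed.

Lemma ff_inv0 : ff_inv ff_zero = ff_zero.
Proof.
have : rfun (repr ff_zero) == ff_zero by rewrite rfun_repr.
rewrite rfun_cst_eq0 => /asboolPn nz.
by rewrite /ff_inv /germ_inv; case: pselect.
Qed.

HB.instance Definition _ := @GRing.isZmodule.Build funfield
  ff_zero ff_opp ff_add ff_addA ff_addC ff_add0 ff_addN.
HB.instance Definition _ := @GRing.Zmodule_isComNzRing.Build funfield
  ff_one ff_mul ff_mulA ff_mulC ff_mul1 ff_mulDl ff_oner_neq0.
HB.instance Definition _ := @GRing.ComNzRing_isField.Build funfield
  ff_inv ff_mulVf ff_inv0.

End FunctionField.

(* [iota : k(Y) -> K] is an algebraic closure; K itself is algebraically      *)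
(* closed by its type.                                                        *)
Definition algebraic_closure (F : fieldType) (K : closedFieldType)
  (iota : {rmorphism F -> K}) : Prop := forall a : K, algebraicOver iota a.

(* Representatives of rational maps: [fn] is total, with junk values off [dom]. *)
Record ratrep (X Z : Type) := RatRep { dom : set X; fn : X -> Z }.

Section RationalMaps.
Context (k : fieldType).

Definition rational_map (X Z : funspace k) (f : ratrep X Z) : Prop :=
  [/\ open (dom f), dense (dom f) & morphism_on (dom f) (fn f)].

(* Equality of rational maps. *)
Definition rat_eq (X Z : funspace k) (f g : ratrep X Z) : Prop :=
  exists W : set X, [/\ open W, dense W, W `<=` dom f `&` dom g &
    forall x, W x -> fn f x = fn g x].

Definition rat_dominant (X Z : funspace k) (f : ratrep X Z) : Prop :=
  dense (fn f @` dom f).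

Definition pcomp (X Y Z : Type) (g : ratrep Y Z) (f : ratrep X Y) : ratrep X Z :=
  RatRep (dom f `&` fn f @^-1` dom g) (fn g \o fn f).

Definition pid (X : Type) : ratrep X X := RatRep setT id.

Definition ptot (X Z : Type) (f : X -> Z) : ratrep X Z := RatRep setT f.

Definition birational (X : funspace k) (f : ratrep X X) : Prop :=
  rational_map f /\ exists g : ratrep X X,
    [/\ rational_map g, rat_eq (pcomp g f) (pid X) &
        rat_eq (pcomp f g) (pid X)].

(* Bir(X/Y) *)
Definition birational_over (X Y : funspace k) (pi : X -> Y) (f : ratrep X X)
  : Prop :=
  birational f /\ rat_eq (pcomp (ptot pi) f) (ptot pi).

(* The additive group; its group law is addition of 1 x 1 matrices. *)
Definition Ga : funspace k := affine_space k 1.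
Definition Ga_add (s t : Ga) : Ga := (s : 'rV[k]_1) + (t : 'rV[k]_1).

Definition pshear (X : funspace k) (a : ratrep (prod_space Ga X) X)
  : ratrep (prod_space Ga X) (prod_space Ga X) :=
  RatRep (dom a) (fun p => (p.1, fn a p)).

Definition rational_action (X : funspace k) (a : ratrep (prod_space Ga X) X)
  : Prop :=
  [/\ rational_map a,
      rational_map (pshear a) /\ rat_dominant (pshear a) &
      @rat_eq (prod_space Ga (prod_space Ga X)) X
        (RatRep [set p | dom a (Ga_add p.1 p.2.1, p.2.2)]
              (fun p => fn a (Ga_add p.1 p.2.1, p.2.2)))
        (RatRep [set p | dom a p.2 /\ dom a (p.1, fn a p.2)]
              (fun p => fn a (p.1, fn a p.2)))].

Definition slice (X : funspace k) (a : ratrep (prod_space Ga X) X) (g : Ga)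
  : ratrep X X :=
  RatRep [set x | dom a (g, x)] (fun x => fn a (g, x)).

(* Every g in Ga meets the domain of definition of a rational action, but not *)
(* necessarily the domain of a given representative: hence the choice of b.   *)
Definition induced_by (X : funspace k) (a : ratrep (prod_space Ga X) X) (g : Ga)
  (s : ratrep X X) : Prop :=
  exists b : ratrep (prod_space Ga X) X,
    [/\ rational_map b, rat_eq a b & rat_eq (slice b g) s].

Definition unipotent (X : funspace k) (s : ratrep X X) : Prop :=
  exists (a : ratrep (prod_space Ga X) X) (g : Ga),
    rational_action a /\ induced_by a g s.

End RationalMaps.

Section GeometricGenericFibre.
Context (k : closedFieldType) (X : funspace k) (Y : irrvariety k).
Context (pi : X -> Y) (K : closedFieldType).
Context (iota : {rmorphism funfield Y -> K}).

(* The closed points of X_K are the K-points of X over the geometric generic  *)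
(* point Spec K -> Y. A morphism z : Spec K -> X of locally ringed spaces is  *)
(* given by the opens of X through which it factors (the prime filter [nb] of *)
(* neighbourhoods of its image, a possibly non-closed point of the scheme X), *)
(* and by the values f(z) in K of the functions f regular on such opens.      *)
(* [gpt_local] is the locality of the homomorphism from the stalk to K, and   *)
(* the last two fields say that pi o z is Spec K -> Spec k(Y) -> Y.           *)
Record geompt := GeomPt {
  nb : set (set X);
  ev : set X -> (X -> k) -> K;
  nb_open : nb `<=` open;
  nbI : forall U V, nb U -> nb V -> nb (U `&` V);
  nb_up : forall U V, nb U -> open V -> U `<=` V -> nb V;
  nb_prime : forall F : set (set X), F `<=` open ->
    nb (\bigcup_(U in F) U) -> exists2 U, F U & nb U;
  ev_junk : forall U f, ~ (nb U /\ reg U f) -> ev U f = 0;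
  ev_ext : forall U f g, nb U -> reg U f -> (forall x, U x -> f x = g x) ->
    ev U f = ev U g;
  ev_res : forall U V f, nb U -> nb V -> V `<=` U -> reg U f ->
    ev V f = ev U f;
  ev1 : forall U, nb U -> ev U (fun=> 1) = 1;
  evD : forall U f g, nb U -> reg U f -> reg U g ->
    ev U (fun x => f x + g x) = ev U f + ev U g;
  evM : forall U f g, nb U -> reg U f -> reg U g ->
    ev U (fun x => f x * g x) = ev U f * ev U g;
  gpt_local : forall U f, nb U -> reg U f -> ev U f != 0 ->
    nb (U `&` [set x | f x != 0]);
  gpt_generic : forall V : set Y, open V -> nb (pi @^-1` V) <-> V !=set0;
  gpt_over : forall f : germ Y,
    ev (pi @^-1` gdom f) (gfun f \o pi) = iota (rfun f) }.

HB.instance Definition _ := gen_eqMixin geompt.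
HB.instance Definition _ := gen_choiceMixin geompt.

(* Over an affine open U of X lying over an affine open V of Y, the functions *)
(* below generate the image of k[U] (x)_{k[V]} K in the K-valued functions.   *)
Definition fibre_data : gendata K geompt.
Proof.
refine (@GenData K geompt
  [set D | exists2 U, open U & D = [set z | nb z U]]
  (fun D => [set h | exists U f, [/\ open U, reg U f, D = [set z | nb z U] &
     forall z, D z -> h z = ev z U f]]) _ _ _).
- move=> z; exists [set z | nb z setT].
    by exists setT => //; apply: openT.
  have := (gpt_generic z (V := setT) openT).2 (irrT Y).
  by rewrite preimage_setT.
- have nbIE z U V : open U -> open V -> nb z (U `&` V) <-> nb z U /\ nb z V.
    move=> oU oV; split=> [h|[hU hV]]; last exact: nbI.
    by split; apply: nb_up h _ _ => // x [].
  move=> D E [U oU ->] [V oV ->]; exists (U `&` V); first exact: openI.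
  by apply/seteqP; split=> z /= /(nbIE z _ _ oU oV).
- move=> D E _ [V oV ->] h [U [f [oU rf -> e]]].
  have nbIE z : nb z (U `&` V) <-> nb z U /\ nb z V.
    split=> [h'|[hU hV]]; last exact: nbI.
    by split; apply: nb_up h' _ _ => // x [].
  exists (U `&` V), f; split; first exact: openI.
  + by apply: reg_res rf => //; apply: openI.
  + by apply/seteqP; split=> z /= /(nbIE z).
  + move=> z [/= zU zV]; rewrite e //; apply/esym/ev_res => //.
    exact/nbIE.
Defined.

(* X_K *)
Definition geom_generic_fibre : funspace K := genspace fibre_data.

(* w is the composition of z : Spec K -> X with the rational map s : X --> X. *)
Definition gpt_comp (s : ratrep X X) (z w : geompt) : Prop :=
  [/\ nb z (dom s),
      forall U, open U -> nb w U <-> nb z (dom s `&` fn s @^-1` U) &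
      forall U f, nb w U -> reg U f ->
        ev w U f = ev z (dom s `&` fn s @^-1` U) (f \o fn s)].

(* The pull-back s_K. The point w such that [gpt_comp s z w] is unique, and   *)
(* it exists as soon as s is in Bir(X/Y) and z factors through the domain.    *)
Definition base_change (s : ratrep X X)
  : ratrep geom_generic_fibre geom_generic_fibre :=
  RatRep [set z | exists w, gpt_comp s z w]
       (fun z => xget z [set w | gpt_comp s z w]).

End GeometricGenericFibre.

(* Main.v *)
Require Import Defs.
From HB Require Import structures.
From mathcomp Require Import all_boot all_order all_algebra generic_quotient.
From mathcomp Require Import all_classical topology.
Set Implicit Arguments. Unset Strict Implicit. Unset Printing Implicit Defensive.
Import GRing.Theory.
Local Open Scope classical_set_scope.
Local Open Scope ring_scope.

(* In characteristic zero, a dominant rational self-map s of an irreducible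
   variety is unipotent if and only if, for every rational function f, the
   sequence of the pull-backs of f under s^n (n >= 1) is interpolated by a
   fraction p(n) / q(n) with coefficients p, q polynomials over the function
   field. An action gives such fractions by expanding f(g.x) in the coordinate
   of the additive group; conversely, interpolating affine coordinates defines
   the action, and all the identities it must satisfy hold on the pairs (n, x),
   which are dense. The interpolation property goes up from k(X) to K(X_K)
   because k(X) and K generate K(X_K) and the interpolable elements form a
   field; it goes down because the coefficients of p and q are a solution of a
   homogeneous linear system with coefficients in k(X). The passage between
   X and X_K needs K-points of X_K in every nonempty open subset of X: they are
   provided by specialisation of finitely generated algebras, a form of the
   Nullstellensatz. *)

(** * Specialisation of finitely generated algebras *)

(** An action on X_K has no reason to be defined over k(Y), and the parameter in K at which it
    induces the pull-back of sigma need not come from k. So no action is ever descended or extended: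
    only its values at the integer multiples of that parameter are kept, the parameter is normalised
    to 1 by rescaling the variable of p and q, and a new action is built, in which sigma is the
    image of 1. The delicate point is the denominators: q(n) must be nonzero at every positive
    integer, whereas density arguments only control almost all of them. This is why fractions are
    reduced to coprime p and q: then an identity p(n) = q(n) y already forces q(n) to be nonzero.
    Identities are accordingly kept in cross-multiplied form and extended to points where q might
    vanish, and only then divided. *)

Inductive pex (F I : Type) :=
| PCst (c : F) | PVar (i : I) | PAdd (a b : pex F I) | PMul (a b : pex F I).

(** Expressions stand in for multivariate polynomials: the same one is evaluated in several rings
    through different coefficient maps, and only the vanishing of its values matters, never equality
    of expressions. *)
Fixpoint pev (F I : Type) (R : pzRingType) (h : F -> R) (v : I -> R)
    (e : pex F I) : R :=
  match e with
  | PCst c => h c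
  | PVar i => v i
  | PAdd a b => pev h v a + pev h v b
  | PMul a b => pev h v a * pev h v b
  end.

Section Specialisation.
Context (R : comNzRingType).

Definition ext_eval (S : comNzRingType) (h : {rmorphism R -> S}) (y : S) :
  {rmorphism {poly R} -> S} := horner_eval y \o map_poly h.

Lemma ext_evalE (S : comNzRingType) (h : {rmorphism R -> S}) (y : S) Q :
  ext_eval h y Q = (map_poly h Q).[y].
Proof. by []. Qed.

Lemma ext_evalC (S : comNzRingType) (h : {rmorphism R -> S}) (y : S) c :
  ext_eval h y c%:P = h c.
Proof. by rewrite ext_evalE map_polyC hornerC. Qed.

Lemma ext_evalX (S : comNzRingType) (h : {rmorphism R -> S}) (y : S) :
  ext_eval h y 'X = y.
Proof. by rewrite ext_evalE map_polyX hornerX. Qed.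

Lemma ext_evalZ (S : comNzRingType) (h : {rmorphism R -> S}) (y : S) c Q :
  ext_eval h y (c *: Q) = h c * ext_eval h y Q.
Proof. by rewrite -mul_polyC rmorphM ext_evalC. Qed.

Context (L : fieldType) (e : {rmorphism R -> L}).

(** [e] need not be injective, since [R] becomes a polynomial ring in the induction on generators;
    leading coefficients killed by [e] have to be cut off before dividing. *)
Lemma truncate_map (Q : {poly R}) : exists Q' : {poly R},
  map_poly e Q' = map_poly e Q /\ size Q' = size (map_poly e Q).
Proof.
set n := size (map_poly e Q).
pose Q' := \poly_(i < n) Q`_i.
have eQ : map_poly e Q' = map_poly e Q.
  apply/polyP => i; rewrite !coef_map coef_poly; case: ltnP => // le.
  rewrite -coef_map [RHS]nth_default //; exact: rmorph0.
exists Q'; split=> //; apply/eqP; rewrite eqn_leq size_poly /n -eQ.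
exact: size_poly.
Qed.

Context (x : L).

(** [P] plays the role of the minimal polynomial of [x] over the fraction field of the image of [e],
    with coefficients kept in [R]; minimality is therefore tested on images under [e]. *)
Lemma exists_minimal_annihilator (Q : {poly R}) :
  ext_eval e x Q = 0 -> map_poly e Q != 0 ->
  exists P : {poly R}, [/\ ext_eval e x P = 0, e (lead_coef P) != 0,
    (1 < size P)%N & forall S : {poly R}, ext_eval e x S = 0 ->
      (size (map_poly e S) < size P)%N -> map_poly e S = 0].
Proof.
move=> Qx Q0.
pose good n := `[< exists S : {poly R}, [/\ ext_eval e x S = 0,
  map_poly e S != 0 & size (map_poly e S) = n] >].
have ex : exists n, good n by exists (size (map_poly e Q)); apply/asboolP; exists Q.
case: (ex_minnP ex) => n /asboolP[S [Sx S0 sS]] min.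
have [P [eP sP]] := truncate_map S.
have Px : ext_eval e x P = 0 by rewrite ext_evalE eP.
exists P; split=> //.
- rewrite lead_coefE sP -coef_map eP -lead_coefE lead_coef_eq0 //.
- rewrite ltnNge sP; apply/negP => /size1_polyC E; move: Sx S0.
  by rewrite ext_evalE E hornerC => ->; rewrite polyC0 eqxx.
- move=> T Tx lt; apply/eqP/negPn/negP => T0.
  have /min : good (size (map_poly e T)) by apply/asboolP; exists T.
  by rewrite -sS -sP leqNgt lt.
Qed.

(* The element [t] is a norm-like multiple of [b]: a nonzero constant in the
   ideal spanned by [b] and the annihilating polynomial [P]. *)
Lemma exists_constant_multiple (P b : {poly R}) :
  ext_eval e x P = 0 -> e (lead_coef P) != 0 -> (1 < size P)%N ->
  (forall S : {poly R}, ext_eval e x S = 0 ->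
    (size (map_poly e S) < size P)%N -> map_poly e S = 0) ->
  ext_eval e x b != 0 ->
  exists t V, e t != 0 /\ ext_eval e x (V * b) = e t.
Proof.
move=> Px cP sP minP bx.
(* Euclidean descent with pseudo-division: [T] is a shortest polynomial with nonzero value at [x]
   among those congruent, at [x], to a multiple of [b]. The goal is that [T] is a constant. *)
pose good n := `[< exists T V : {poly R}, [/\ ext_eval e x T != 0,
  ext_eval e x (V * b) = ext_eval e x T & size T = n] >].
have ex : exists n, good n.
  by exists (size b); apply/asboolP; exists b, 1; rewrite mul1r.
case: (ex_minnP ex) => n /asboolP[T [V [Tx VT sT]]] min.
have minT R' V' : ext_eval e x R' != 0 ->
    ext_eval e x (V' * b) = ext_eval e x R' -> (size T <= size R')%N.
  by move=> h1 h2; rewrite sT; apply: min; apply/asboolP; exists R', V'.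
have [s1|s2] := leqP (size T) 1.
  have ET := size1_polyC s1.
  exists T`_0, V; rewrite VT; move: Tx; rewrite ET ext_evalC coefC eqxx.
  by [].
have T0 : T != 0 by rewrite -size_poly_gt0 (ltn_trans _ s2).
have P0 : P != 0 by rewrite -size_poly_gt0 (ltn_trans _ sP).
have cT : e (lead_coef T) != 0.
  apply/eqP => cT0; have [T' [eT sT']] := truncate_map T.
  have Tx' : ext_eval e x T' = ext_eval e x T by rewrite !ext_evalE eT.
  have := minT T' V; rewrite Tx' => /(_ Tx VT); apply/negP; rewrite -ltnNge sT'.
  rewrite ltn_neqAle size_poly andbT; apply/eqP => sE.
  have : lead_coef (map_poly e T) = 0 by rewrite lead_coefE sE coef_map.
  move/eqP; rewrite lead_coef_eq0 => /eqP E0.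
  by move: Tx; rewrite ext_evalE E0 horner0 eqxx.
have sTP : (size T < size P)%N.
  rewrite ltnNge; apply/negP => le.
  have := Pdiv.ComRing.rdivp_eq P T.
  set S := Pdiv.Ring.rdivp T P; set U := Pdiv.Ring.rmodp T P; set c := _ ^+ _.
  move=> E.
  have Ux : ext_eval e x U = e c * ext_eval e x T.
    by rewrite -ext_evalZ E rmorphD rmorphM Px mulr0 add0r.
  have ec : e c != 0 by rewrite rmorphXn expf_neq0.
  have := minT U (c *: V); rewrite Ux mulf_neq0 // => /(_ isT).
  rewrite -scalerAl ext_evalZ VT => /(_ erefl).
  rewrite leqNgt; apply/negP/negPn; apply: leq_trans le.
  by rewrite Pdiv.Ring.ltn_rmodp.
(* Here [1 < size T < size P]. In the division of [P] by [T], minimality of [T] makes the remainder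
   vanish at [x]; so does the quotient, as [T] does not. Minimality of [P] then kills the image of
   both, hence that of [P]. *)
exfalso; have := Pdiv.ComRing.rdivp_eq T P.
set S := Pdiv.Ring.rdivp P T; set U := Pdiv.Ring.rmodp P T; set c := _ ^+ _.
move=> E; have sU : (size U < size T)%N by rewrite Pdiv.Ring.ltn_rmodp.
have ec : e c != 0 by rewrite rmorphXn expf_neq0.
have Ux : ext_eval e x U = - (ext_eval e x S * ext_eval e x T).
  apply/eqP; rewrite -addr_eq0 addrC -rmorphM -rmorphD -E.
  by rewrite ext_evalZ Px mulr0.
have U0 : ext_eval e x U = 0.
  apply/eqP/negPn/negP => nz; have := minT U (- S * V) nz.
  rewrite leqNgt sU => H; have // : false; apply: H.
  by rewrite -mulrA rmorphM VT Ux rmorphN mulNr.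
have Sx : ext_eval e x S = 0.
  move/eqP: Ux; rewrite U0 eq_sym oppr_eq0 mulf_eq0 (negPf Tx) orbF.
  by move/eqP.
have eU : map_poly e U = 0.
  apply: minP => //; apply: leq_ltn_trans (ltn_trans sU sTP).
  exact: size_poly.
have sPe : size (map_poly e P) = size P.
  by rewrite size_map_poly_id0.
have sTe : size (map_poly e T) = size T.
  by rewrite size_map_poly_id0.
have Ee : e c *: map_poly e P = map_poly e S * map_poly e T.
  by rewrite -map_polyZ E rmorphD rmorphM /= eU addr0.
have S0 : map_poly e S != 0.
  apply/eqP => S0; move/eqP: Ee; rewrite S0 mul0r scaler_eq0 (negPf ec) /=.
  by rewrite -size_poly_eq0 sPe size_poly_eq0 (negPf P0).
have T0' : map_poly e T != 0 by rewrite -size_poly_eq0 sTe size_poly_eq0.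
move/(congr1 (fun p : {poly L} => size p)): Ee.
rewrite size_scale // size_mul // sPe sTe => sE.
move/negP: S0; apply; apply/eqP/minP => //.
rewrite sE -[in X in (_ < X)%N](prednK (ltnW s2)) addnS /=.
rewrite -[X in (X < _)%N]addn0 ltn_add2l.
by rewrite -(ltn_add2r 1) !addn1 prednK // ltnW.
Qed.

(** If [x] is algebraic, [y] is a root of the image of [P]: a nonzero image of the leading
    coefficient lets every relation pass through pseudo-division by [P], and a nonzero image of [t]
    keeps [b] nonzero, as [V * b - t] is a relation. If [x] is transcendental, relations have zero
    image and any nonroot of the image of [b] will do. *)
Lemma specialisation_adjoin (b : {poly R}) : ext_eval e x b != 0 ->
  exists2 a : R, e a != 0 & forall (K : closedFieldType)
    (psi : {rmorphism R -> K}), (forall r, e r = 0 -> psi r = 0) ->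
    psi a != 0 -> exists y : K,
      (forall Q, ext_eval e x Q = 0 -> ext_eval psi y Q = 0) /\
      ext_eval psi y b != 0.
Proof.
move=> bx.
have [[Q [Qx Q0]]|transc] := pselect (exists Q : {poly R},
  ext_eval e x Q = 0 /\ map_poly e Q != 0).
  have [P [Px cP sP minP]] := exists_minimal_annihilator Qx Q0.
  have [t [V [et VbE]]] := exists_constant_multiple Px cP sP minP bx.
  have P0 : P != 0 by rewrite -size_poly_gt0 (ltn_trans _ sP).
  exists (lead_coef P * t); first by rewrite rmorphM mulf_neq0.
  move=> K psi kpsi; rewrite (rmorphM psi) mulf_eq0 negb_or => /andP[pc pt].
  have sPe : size (map_poly psi P) = size P by rewrite size_map_poly_id0.
  have /closed_rootP[y /rootP ry] : size (map_poly psi P) != 1%N.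
    by rewrite sPe neq_ltn sP orbT.
  exists y.
  have ker S : ext_eval e x S = 0 -> ext_eval psi y S = 0.
    move=> Sx; have := Pdiv.ComRing.rdivp_eq P S.
    set D := Pdiv.Ring.rdivp S P; set U := Pdiv.Ring.rmodp S P; set c := _ ^+ _.
    move=> E; have sU : (size U < size P)%N by rewrite Pdiv.Ring.ltn_rmodp.
    have Ux : ext_eval e x U = 0.
      have := congr1 (ext_eval e x) E.
      by rewrite ext_evalZ Sx mulr0 rmorphD rmorphM Px mulr0 add0r.
    have eU : map_poly e U = 0.
      by apply: minP => //; apply: leq_ltn_trans sU; apply: size_poly.
    have pU : map_poly psi U = 0.
      apply/polyP => i; rewrite coef_map coef0; apply: kpsi.
      by rewrite -coef_map eU coef0.
    have := congr1 (ext_eval psi y) E; rewrite ext_evalZ rmorphD rmorphM.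
    rewrite [ext_eval _ _ P]ext_evalE ry mulr0 add0r [X in _ = X]ext_evalE pU.
    rewrite horner0 => /eqP; rewrite mulf_eq0 rmorphXn expf_eq0 (negPf pc).
    by rewrite andbF => /eqP.
  split=> //; apply/eqP => by0.
  have /ker : ext_eval e x (V * b - t%:P) = 0 by rewrite rmorphB VbE ext_evalC subrr.
  rewrite rmorphB rmorphM by0 mulr0 ext_evalC sub0r => /eqP.
  by rewrite oppr_eq0 (negPf pt).
have b0 : map_poly e b != 0.
  by apply/eqP => b0; move: bx; rewrite ext_evalE b0 horner0 eqxx.
exists (b`_(size (map_poly e b)).-1).
  by rewrite -coef_map -lead_coefE lead_coef_eq0.
move=> K psi kpsi nz.
have /closed_nonrootP[y nr] : map_poly psi b != 0.
  by apply: contra_neq nz => E; rewrite -coef_map E coef0.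
exists y; split; last exact: nr.
move=> Q Qx; have eQ : map_poly e Q = 0.
  by apply/eqP/negPn/negP => nQ; apply: transc; exists Q.
rewrite ext_evalE (_ : map_poly psi Q = 0) ?horner0 //.
apply/polyP => i; rewrite coef_map coef0; apply: kpsi.
by rewrite -coef_map eQ coef0.
Qed.

End Specialisation.

(** Variable 0 becomes the indeterminate of the coefficient ring, so that the induction on the
    number of generators can enlarge [R] to [{poly R}]. *)
Fixpoint pex_abs (R : nzRingType) m (b : pex R 'I_m.+1) : pex {poly R} 'I_m :=
  match b with
  | PCst c => PCst _ c%:P
  | PVar i => if unlift ord0 i is Some j then PVar _ j else PCst _ 'X
  | PAdd a b => PAdd (pex_abs a) (pex_abs b)
  | PMul a b => PMul (pex_abs a) (pex_abs b)
  end.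

Lemma pev_abs (R S : comNzRingType) m (b : pex R 'I_m.+1)
    (h : {rmorphism R -> S}) (v : 'I_m.+1 -> S) :
  pev (ext_eval h (v ord0)) (fun j => v (lift ord0 j)) (pex_abs b) = pev h v b.
Proof.
elim: b => /= [c|i|a -> b -> //|a -> b -> //]; first exact: ext_evalC.
by case: unliftP => [j ->|->] //=; exact: ext_evalX.
Qed.

(** The first generator is absorbed into the coefficients and the induction hypothesis is used over
    [{poly R}]; it returns an element of that ring to be kept nonzero, which adjoining one generator
    achieves. *)
Theorem specialisation (L : fieldType) m (R : comNzRingType)
    (e : {rmorphism R -> L}) (v : 'I_m -> L) (b : pex R 'I_m) :
  pev e v b != 0 ->
  exists2 a : R, e a != 0 & forall (K : closedFieldType)
    (psi : {rmorphism R -> K}), (forall r, e r = 0 -> psi r = 0) ->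
    psi a != 0 -> exists w : 'I_m -> K,
      (forall Q, pev e v Q = 0 -> pev psi w Q = 0) /\ pev psi w b != 0.
Proof.
elim: m R e v b => [|m IH] R e v b.
  have red (Q : pex R 'I_0) : exists r, forall (S : comNzRingType)
      (h : {rmorphism R -> S}) (u : 'I_0 -> S), pev h u Q = h r.
    elim: Q => [c|[]//|p [r hr] q [s hs]|p [r hr] q [s hs]].
    - by exists c.
    - by exists (r + s) => S h u /=; rewrite hr hs rmorphD.
    - by exists (r * s) => S h u /=; rewrite hr hs rmorphM.
  have [a ha] := red b; rewrite ha => ea; exists a => // K psi ker pa.
  exists (fun=> 0); split=> [Q|]; last by rewrite ha.
  by have [r hr] := red Q; rewrite !hr; apply: ker.
rewrite -pev_abs => /IH[a' ea' H'].
have [a ea H] := specialisation_adjoin ea'; exists a => // K psi ker pa.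
have [y [ker' pa']] := H K psi ker pa.
have [w [kw bw]] := H' K (ext_eval psi y) ker' pa'.
pose w' i := if unlift ord0 i is Some j then w j else y.
have E Q : pev psi w' Q = pev (ext_eval psi y) w (pex_abs Q).
  rewrite -pev_abs /w' unlift_none; congr (pev _ _ _).
  by apply/funext => j; rewrite liftK.
exists w'; split=> [Q|]; last by rewrite E.
by rewrite E -pev_abs => /kw.
Qed.

Corollary field_specialisation (F L : fieldType) (K : closedFieldType)
    (e : {rmorphism F -> L}) (psi : {rmorphism F -> K}) m (v : 'I_m -> L)
    (b : pex F 'I_m) : pev e v b != 0 -> exists w : 'I_m -> K,
  (forall Q, pev e v Q = 0 -> pev psi w Q = 0) /\ pev psi w b != 0.
Proof.
move=> /specialisation[a ea H]; apply: H => [r /eqP|].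
  by rewrite fmorph_eq0 => /eqP ->; rewrite rmorph0.
by rewrite fmorph_eq0; apply: contra_neq ea => ->; rewrite rmorph0.
Qed.

(** * Interpolation of iterates by rational functions *)

(** Pull-backs of rational functions are known on representatives only, that is, as relations; this
    turns such a relation into a ring morphism. *)
Lemma rmorphism_of_relation (L M : nzRingType) (Rl : L -> M -> Prop) :
  (forall l, exists m, Rl l m) ->
  (forall l m m', Rl l m -> Rl l m' -> m = m') ->
  Rl 1 1 ->
  (forall l l' m m', Rl l m -> Rl l' m' -> Rl (l + l') (m + m')) ->
  (forall l l' m m', Rl l m -> Rl l' m' -> Rl (l * l') (m * m')) ->
  exists h : {rmorphism L -> M}, forall l, Rl l (h l).
Proof.
move=> tot fn R1 RD RM.
pose h l := sval (cid (tot l)).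
have hP l : Rl l (h l) by rewrite /h; case: cid.
have hD x y : h (x + y) = h x + h y by apply: (fn (x + y)) => //; apply: RD.
have hB : zmod_morphism h.
  by move=> x y; apply/eqP; rewrite eq_sym subr_eq -hD subrK.
have hM : monoid_morphism h.
  split=> [|x y]; first exact: (fn 1).
  by apply: (fn (x * y)) => //; apply: RM.
pose hz := GRing.isZmodMorphism.Build L M h hB.
pose hm := GRing.isMonoidMorphism.Build L M h hM.
pose H : {rmorphism L -> M} := HB.pack h hz hm.
by exists H.
Qed.

Section CharZero.
Context (L : fieldType) (L0 : [pchar L] =i pred0).

Lemma natr_inj_char0 : injective (fun n => n%:R : L).
Proof.
move=> m n; wlog le : m n / (m <= n)%N.
  by move=> H; case/orP: (leq_total m n) => le E; [|symmetry]; apply: H.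
move=> /eqP; rewrite eq_sym -subr_eq0 -natrB // ((pcharf0P L).1 L0).
by rewrite subn_eq0 => le'; apply/eqP; rewrite eqn_leq le.
Qed.

Lemma poly_eq0_natroots (p : {poly L}) N m : (size p <= m)%N ->
  (forall n, (N <= n < N + m)%N -> p.[n%:R] = 0) -> p = 0.
Proof.
move=> sp H; apply: (@roots_geq_poly_eq0 _ _ [seq n%:R | n <- iota N m]).
- apply/allP => _ /mapP[n + ->]; rewrite mem_iota => /H E.
  by apply/rootP.
- by rewrite map_inj_uniq ?iota_uniq //; apply: natr_inj_char0.
- by rewrite size_map size_iota.
Qed.

Lemma poly_eq0_eventually (p : {poly L}) N :
  (forall n, (N <= n)%N -> p.[n%:R] = 0) -> p = 0.
Proof.
by move=> H; apply: (@poly_eq0_natroots p N _ (leqnn _)) => n /andP[/H].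
Qed.

End CharZero.

Lemma coprime_fraction (L : fieldType) (p q : {poly L}) : q != 0 ->
  exists p' q' g, [/\ p = p' * g, q = q' * g, g != 0 & coprimep p' q'].
Proof.
move=> q0; exists (p %/ gcdp p q), (q %/ gcdp p q), (gcdp p q).
have g0 : gcdp p q != 0 by rewrite gcdp_eq0 negb_and q0 orbT.
split=> //; rewrite ?divpK ?dvdp_gcdl ?dvdp_gcdr //.
by apply: coprimep_div_gcd; rewrite q0 orbT.
Qed.

(** A root of [q] would also be a root of [p]. This is the source of all nonvanishing denominators
    at integers. *)
Lemma coprime_nonroot (L : fieldType) (p q : {poly L}) x y :
  coprimep p q -> p.[x] = q.[x] * y -> q.[x] != 0.
Proof.
move=> cp E; apply/negP => /eqP qx; move: E; rewrite qx mul0r => /rootP rp.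
by have := coprimep_root cp rp; rewrite qx eqxx.
Qed.

(** The value at 0 is left out: for an action, the known starting point is the transformation
    itself, at [n = 1], and the positive integers are already dense. *)
Definition interpolable (L : fieldType) (theta : L -> L) (l : L) :=
  exists p q : {poly L}, forall n, (0 < n)%N ->
    q.[n%:R] != 0 /\ p.[n%:R] = q.[n%:R] * iter n theta l.

Section Interpolable.
Context (L : fieldType) (theta : {rmorphism L -> L}).

Let iterD n x y : iter n theta (x + y) = iter n theta x + iter n theta y.
Proof. by elim: n => //= n ->; rewrite rmorphD. Qed.

Let iterM n x y : iter n theta (x * y) = iter n theta x * iter n theta y.
Proof. by elim: n => //= n ->; rewrite rmorphM. Qed.

Let iterV n x : iter n theta x^-1 = (iter n theta x)^-1.
Proof. by elim: n => //= n ->; rewrite fmorphV. Qed.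

Lemma interpolableC c : theta c = c -> interpolable theta c.
Proof.
move=> E; exists c%:P, 1 => n _; rewrite !hornerC mul1r oner_eq0; split=> //.
by elim: n => //= n <-.
Qed.

Lemma interpolableD x y : interpolable theta x -> interpolable theta y ->
  interpolable theta (x + y).
Proof.
move=> [p [q H]] [r [s H']]; exists (p * s + r * q), (q * s) => n n0.
have [q0 E] := H n n0; have [s0 E'] := H' n n0.
rewrite hornerD !hornerM E E' iterD mulf_neq0 //; split=> //.
by rewrite mulrDr; congr (_ + _); rewrite mulrAC // [s.[_] * _]mulrC mulrAC -mulrA.
Qed.

Lemma interpolableM x y : interpolable theta x -> interpolable theta y ->
  interpolable theta (x * y).
Proof.
move=> [p [q H]] [r [s H']]; exists (p * r), (q * s) => n n0.
have [q0 E] := H n n0; have [s0 E'] := H' n n0.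
by rewrite !hornerM E E' iterM mulf_neq0 //; split=> //; rewrite mulrACA.
Qed.

Lemma interpolableV x : interpolable theta x -> interpolable theta x^-1.
Proof.
have [->|x0] := eqVneq x 0; first by rewrite invr0.
move=> [p [q H]]; exists q, p => n n0; have [q0 E] := H n n0.
have i0 : iter n theta x != 0.
  by elim: n {n0 q0 E} => //= n IH; rewrite fmorph_eq0.
by rewrite E mulf_neq0 // iterV mulfK.
Qed.

End Interpolable.

Lemma horner_rVpoly_sum (L : comNzRingType) d (u : 'rV[L]_d) x :
  (rVpoly u).[x] = \sum_(i < d) u ord0 i * x ^+ i.
Proof.
rewrite (@horner_coef_wide _ d) ?size_poly //.
by apply: eq_bigr => i _; rewrite coef_rVpoly_ord.
Qed.

(* The coefficients of an interpolating fraction solve a homogeneous linear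
   system over the small field, whose rank does not depend on the field. *)
Lemma interpolation_descent (L M : fieldType) (j : {rmorphism L -> M})
    (v : nat -> L) (p q : {poly M}) : [pchar M] =i pred0 ->
  (forall n, (0 < n)%N -> q.[n%:R] != 0 /\ p.[n%:R] = q.[n%:R] * j (v n)) ->
  exists p' q' : {poly L}, forall n, (0 < n)%N ->
    q'.[n%:R] != 0 /\ p'.[n%:R] = q'.[n%:R] * v n.
Proof.
(* The unknowns are the coefficients of [p] and [q], at most [d] each. The integers from 1 to
   [N = d + d] are enough, because the cross difference of two solutions is a polynomial of size at
   most [N]. *)
move=> M0 H; set d := maxn (size p) (size q); set N := (d + d)%N.
pose V : 'M[L]_(d, N) := \matrix_(i, k) (k.+1%:R ^+ i).
pose W : 'M[L]_(d, N) := \matrix_(i, k) (- (v k.+1) * k.+1%:R ^+ i).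
pose A := col_mx V W.
have AE (F : comNzRingType) (h : {rmorphism L -> F}) (a b : 'rV[F]_d) k :
    (row_mx a b *m map_mx h A) ord0 k =
    (rVpoly a).[k.+1%:R] - (rVpoly b).[k.+1%:R] * h (v k.+1).
  rewrite map_col_mx mul_row_col !mxE !horner_rVpoly_sum mulr_suml -sumrN.
  congr (_ + _); apply: eq_bigr => i _; rewrite !mxE.
    by rewrite rmorphXn rmorph_nat.
  by rewrite rmorphM rmorphN rmorphXn rmorph_nat mulNr mulrN mulrCA mulrC.
have sp : (size p <= d)%N by rewrite leq_maxl.
have sq : (size q <= d)%N by rewrite leq_maxr.
have [q1 _] := H 1%N isT.
have q0 : q != 0 by apply: contraNneq q1 => ->; rewrite horner0.
have rkA : (\rank A < d + d)%N.
  rewrite -(mxrank_map j A) ltn_neqAle rank_leq_row andbT; apply/negP.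
  rewrite -/(row_free _) => free.
  have /eqP : row_mx (poly_rV p) (poly_rV q) *m map_mx j A = 0.
    apply/rowP => k; rewrite AE !poly_rV_K // mxE.
    by have [_ ->] := H k.+1 isT; rewrite subrr.
  rewrite mulmx_free_eq0 // -row_mx0 => /eqP/eq_row_mx[_ E].
  by move: q0; rewrite -(poly_rV_K sq) E linear0 eqxx.
have : kermx A != 0.
  by rewrite -mxrank_eq0 mxrank_ker subn_eq0 -ltnNge.
rewrite -nz_row_eq0; set u := nz_row _ => u0.
have uA : u *m A = 0 by apply/sub_kermxP; apply: nz_row_sub.
pose p' := rVpoly (lsubmx u); pose q' := rVpoly (rsubmx u).
have E' k : (k < N)%N -> p'.[k.+1%:R] = q'.[k.+1%:R] * v k.+1.
  move=> lt; apply/eqP; rewrite -subr_eq0; apply/eqP.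
  have := AE L idfun (lsubmx u) (rsubmx u) (Ordinal lt).
  by rewrite hsubmxK map_mx_id // uA mxE => <-.
(* The two fractions agree at [N] integers, hence are equal; this is what carries the finitely many
   equations to all integers. *)
have cross : map_poly j p' * q - map_poly j q' * p = 0.
  apply: (@poly_eq0_natroots _ M0 _ 1 N).
    apply: leq_trans (size_polyD _ _) _; rewrite size_polyN geq_max.
    have B (a b : {poly M}) : (size a <= d -> size b <= d -> size (a * b)%R <= N)%N.
      move=> sa sb; apply: leq_trans (size_polyMleq _ _) _.
      by apply: leq_trans (leq_pred _) _; apply: leq_add.
    by rewrite !B // (leq_trans (size_poly _ _)) // size_poly.
  move=> [//|n]; rewrite add1n !ltnS /= => lt.
  have [_ E] := H n.+1 isT; rewrite !hornerE E -![n.+1%:R](rmorph_nat j).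
  by rewrite !horner_map /= E' // rmorphM mulrAC mulrA subrr.
have q'0 : q' != 0.
  apply: contraNneq u0 => q'0; move/eqP: cross.
  rewrite q'0 rmorph0 mul0r subr0 mulf_eq0 (negPf q0) orbF map_poly_eq0 => /eqP p'0.
  rewrite -[u]hsubmxK -[lsubmx u]rVpolyK -[rsubmx u]rVpolyK -/p' -/q'.
  by rewrite p'0 q'0 !linear0 row_mx0.
(* A solution of the system may have a denominator vanishing at some integer; the reduced fraction
   cannot. *)
have [a [b [g [Ep Eq g0 cp]]]] := coprime_fraction p' q'0.
exists a, b => n n0; have [qn E] := H n n0.
have cross' : map_poly j a * q = map_poly j b * p.
  apply/eqP; rewrite -subr_eq0.
  have : map_poly j g != 0 by rewrite map_poly_eq0.
  move=> /mulfI/inj_eq <-; rewrite mulr0 mulrBr !mulrA -!rmorphM.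
  by rewrite ![g * _]mulrC -Ep -Eq cross.
have abn : a.[n%:R] = b.[n%:R] * v n.
  apply: (fmorph_inj j); apply: (mulIf qn); rewrite rmorphM.
  rewrite -!horner_map /= rmorph_nat -mulrA [j _ * _]mulrC -E -!hornerM.
  by rewrite cross'.
by split=> //; apply: coprime_nonroot abn.
Qed.

(** * Regular functions and morphisms *)

Lemma open_local (T : topologicalType) (S : set T) :
  (forall x, S x -> exists V, [/\ open V, V x & V `<=` S]) -> open S.
Proof.
move=> H; rewrite (_ : S = \bigcup_(V in [set V | open V /\ V `<=` S]) V).
  by apply: bigcup_open => V [].
apply/seteqP; split=> [x /H[V [oV Vx sV]]|x [V [_ sV] Vx]]; last exact: sV.
by exists V.
Qed.

Lemma irreducible_dense (T : topologicalType) (U : set T) : irreducible T ->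
  open U -> U !=set0 -> dense U.
Proof. by move=> [_ irr] oU nU O nO oO; apply: irr. Qed.

Lemma dense_nonempty (T : topologicalType) (U : set T) : [set: T] !=set0 ->
  dense U -> U !=set0.
Proof. by move=> nT /(_ setT nT openT)[x [_ Ux]]; exists x. Qed.

Section Regular.
Context (k : fieldType) (X : funspace k).
Implicit Types (U V : set X) (f g : X -> k).

Lemma reg_div U f g : open U -> reg U f -> reg U g ->
  reg (U `&` [set x | g x != 0]) (fun x => f x / g x).
Proof.
move=> oU rf rg; have oV := reg_open oU rg.
apply: regM => //; last exact: regV.
by apply: reg_res rf => // x [].
Qed.

Lemma regN U f : open U -> reg U f -> reg U (fun x => - f x).
Proof.
move=> oU rf; apply: (reg_ext (f := fun x => -1 * f x)) => //.
  by move=> x _; rewrite mulN1r.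
by apply: regM => //; apply: reg_cst.
Qed.

Lemma regB U f g : open U -> reg U f -> reg U g -> reg U (fun x => f x - g x).
Proof. by move=> oU rf rg; apply: regD => //; apply: regN. Qed.

Lemma reg_sum U I (s : seq I) (F : I -> X -> k) : open U ->
  (forall i, reg U (F i)) -> reg U (fun x => \sum_(i <- s) F i x).
Proof.
move=> oU rF; elim: s => [|i s IH].
  by apply: reg_ext (@reg_cst _ X _ 0 oU) => // x _; rewrite big_nil.
apply: reg_ext (regD oU (rF i) IH) => // x _; by rewrite big_cons.
Qed.

Lemma reg_exp U f n : open U -> reg U f -> reg U (fun x => f x ^+ n).
Proof.
move=> oU rf; elim: n => [|n IH]; first exact: reg_cst.
by apply: reg_ext (regM oU rf IH) => // x _; rewrite exprS.
Qed.

Lemma reg_prod U I (s : seq I) (F : I -> X -> k) : open U ->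
  (forall i, reg U (F i)) -> reg U (fun x => \prod_(i <- s) F i x).
Proof.
move=> oU rF; elim: s => [|i s IH].
  by apply: reg_ext (@reg_cst _ X _ 1 oU) => // x _; rewrite big_nil.
apply: reg_ext (regM oU (rF i) IH) => // x _; by rewrite big_cons.
Qed.

Lemma reg_pev U I (e : pex k I) (v : I -> X -> k) : open U ->
  (forall i, reg U (v i)) -> reg U (fun x => pev id (v^~ x) e).
Proof.
move=> oU rv; elim: e => /= [c|i|a ? b ?|a ? b ?].
- exact: reg_cst.
- exact: rv.
- exact: regD.
- exact: regM.
Qed.

(** The locus of [U] where [f - g] is nonzero is open; were it nonempty, it would meet [O]. *)
Lemma reg_eq_irr U O f g : irreducible X -> open U -> open O -> O !=set0 ->
  reg U f -> reg U g -> (forall x, U x -> O x -> f x = g x) ->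
  forall x, U x -> f x = g x.
Proof.
move=> [_ irr] oU oO nO rf rg e x Ux; apply/eqP/negPn/negP => ne.
have [|y [[Uy /= +] Oy]] := irr _ _ (reg_open oU (regB oU rf rg)) oO _ nO.
  by exists x; split=> //=; rewrite subr_eq0.
by rewrite e // subrr eqxx.
Qed.

End Regular.

Section GenspaceMorphisms.
Context (k : fieldType) (T : choiceType) (d : gendata k T).

Lemma open_chart D : chart d D -> open (D : set (genspace d)).
Proof.
move=> hD; rewrite genopenE => x Dx; exists D, (fun=> 1).
by split=> //; [exact: kalg_cst|exact: oner_neq0].
Qed.

Lemma reg_kalg D h : chart d D -> kalg (gens d D) h ->
  reg (D : set (genspace d)) h.
Proof.
move=> hD hh x Dx; exists D, h, (fun=> 1); split=> //; first exact: kalg_cst.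
  by split=> //; rewrite oner_neq0.
by move=> y _ _ _; rewrite divr1.
Qed.

(** Opens and regular functions are locally given by elements of the algebra spanned by the
    generators, so it suffices to pull back charts and generators. *)
Lemma morphism_on_genspace (S : funspace k) (W : set S) (f : S -> genspace d) :
  (forall D, chart d D -> open (W `&` f @^-1` D) /\
     forall h, gens d D h -> reg (W `&` f @^-1` D) (h \o f)) ->
  morphism_on W f.
Proof.
move=> H; have HK D q : chart d D -> kalg (gens d D) q ->
    open (W `&` f @^-1` D) /\ reg (W `&` f @^-1` D) (q \o f).
  move=> hD hq; have [oD rD] := H _ hD; split=> //.
  elim: hq => [c|g /rD //|g h _ ? _ ?|g h _ ? _ ?].
  - exact: reg_cst.
  - exact: regD.
  - exact: regM.
move=> V oV.
have oWV : open (W `&` f @^-1` V).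
  apply: open_local => x [Wx Vx].
  have [D [q [hD hq Dx qx sV]]] : exists D q, [/\ chart d D, kalg (gens d D) q,
      D (f x), q (f x) != 0 & D `&` [set y | q y != 0] `<=` V].
    by move: oV; rewrite genopenE; apply.
  have [oD rq] := HK _ _ hD hq.
  exists (W `&` f @^-1` D `&` [set y | q (f y) != 0]); split=> //.
  - exact: reg_open.
  - by move=> y [[Wy Dy] qy]; split=> //; apply: sV.
split=> // h rh; apply: reg_glue => // x [Wx Vx].
have [D [p [q [hD hp hq [Dx qx] E]]]] := rh _ Vx.
have [oD rq] := HK _ _ hD hq; have [_ rp] := HK _ _ hD hp.
have oDq := reg_open oD rq.
exists (W `&` f @^-1` V `&` (W `&` f @^-1` D `&` [set y | q (f y) != 0])).
have oI := openI oWV oDq.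
split=> //.
apply: (reg_ext (f := fun y => p (f y) / q (f y))) => //.
  by move=> y [[_ Vy] [[_ Dy] qy]] /=; rewrite E.
by apply: reg_res (reg_div oD rp rq) => // y [].
Qed.

End GenspaceMorphisms.

Section Morphisms.
Context (k : fieldType).
Implicit Types (A B C T : funspace k).

Lemma morphism_on_open A B (W : set A) (f : A -> B) : morphism_on W f -> open W.
Proof. by move/(_ setT openT) => [+ _]; rewrite preimage_setT setIT. Qed.

Lemma morphism_on_sub A B (W W' : set A) (f : A -> B) : open W' -> W' `<=` W ->
  morphism_on W f -> morphism_on W' f.
Proof.
move=> oW' sW mf V oV; have [oV' rV] := mf _ oV.
have E : W' `&` f @^-1` V = W' `&` (W `&` f @^-1` V).
  by rewrite setIA (setIidl sW).
rewrite E; have oI := openI oW' oV'; split=> // h /rV rh.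
by apply: reg_res rh => // x [].
Qed.

Lemma morphism_on_comp A B C (U : set A) (V : set B) (f : A -> B) (g : B -> C) :
  morphism_on U f -> morphism_on V g -> morphism_on (U `&` f @^-1` V) (g \o f).
Proof.
move=> mf mg O oO; have [oO' rO] := mg _ oO; have [oO'' rO'] := mf _ oO'.
have -> : U `&` f @^-1` V `&` (g \o f) @^-1` O = U `&` f @^-1` (V `&` g @^-1` O).
  by rewrite preimage_setI setIA.
by split=> // h /rO /rO'.
Qed.

Lemma morphism_on_cst A B (c : B) : morphism_on [set: A] (fun=> c).
Proof.
move=> V oV; rewrite setTI; have [Vc|Vc] := pselect (V c).
  rewrite (_ : _ @^-1` _ = setT); last by apply/seteqP; split.
  by split=> [|h rh]; [exact: openT|apply: (@reg_cst _ A _ (h c)); exact: openT].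
rewrite (_ : _ @^-1` _ = set0); last by apply/seteqP; split.
split=> [|h rh]; first exact: open0.
by apply: reg_ext (@reg_cst _ A _ 0 open0) => //; exact: open0.
Qed.

Lemma morphism_on_id A : morphism_on [set: A] id.
Proof. by move=> V oV; rewrite setTI preimage_id; split. Qed.

Lemma morphism_on_fst A B : morphism_on [set: prod_space A B] fst.
Proof.
move=> V oV; rewrite setTI.
have hV : chart (prod_data A B) (fst @^-1` V).
  exists V, setT; split=> //; first exact: openT.
  by apply/seteqP; split=> p /=; [split|case].
split=> [|h rh]; first exact: open_chart.
apply: reg_kalg => //; apply: kalg_gen; exists V, setT; split=> //.
- exact: openT.
- by apply/seteqP; split=> p /=; [split|case].
- by left; exists h.
Qed.

Lemma morphism_on_snd A B : morphism_on [set: prod_space A B] snd.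
Proof.
move=> V oV; rewrite setTI.
have hV : chart (prod_data A B) (snd @^-1` V).
  exists setT, V; split=> //; first exact: openT.
  by apply/seteqP; split=> p /=; [split|case].
split=> [|h rh]; first exact: open_chart.
apply: reg_kalg => //; apply: kalg_gen; exists setT, V; split=> //.
- exact: openT.
- by apply/seteqP; split=> p /=; [split|case].
- by right; exists h.
Qed.

Lemma morphism_on_pair A B T (W : set T) (f : T -> A) (g : T -> B) :
  morphism_on W f -> morphism_on W g ->
  morphism_on W ((fun x => (f x, g x)) : T -> prod_space A B).
Proof.
move=> mf mg; apply: morphism_on_genspace => D [U [V [oU oV ->]]].
have [oU' rU] := mf _ oU; have [oV' rV] := mg _ oV.
have E U' V' : W `&` (fun x => (f x, g x)) @^-1` (U' `*` V') =
    (W `&` f @^-1` U') `&` (W `&` g @^-1` V').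
  by apply/seteqP; split=> x; [move=> [Wx [/= ? ?]]|move=> [[? ?] [? ?]]].
rewrite E; have oI := openI oU' oV'; split=> // h [U1 [V1 [oU1 oV1 E1 H]]].
have E2 := E U V; rewrite E1 (E U1 V1) in E2; rewrite -E2 in oI *.
have [oU1' rU1] := mf _ oU1; have [oV1' rV1] := mg _ oV1.
case: H => -[h' rh' ->].
  by apply: reg_res (rU1 _ rh') => // x [].
by apply: reg_res (rV1 _ rh') => // x [].
Qed.

Lemma morphism_on_preimage A B (f : A -> B) (V : set B) :
  morphism_on setT f -> open V -> open (f @^-1` V).
Proof. by move=> mf /mf[]; rewrite setTI. Qed.

Lemma morphism_slice_r A B (a : A) :
  morphism_on [set: B] ((fun b => (a, b)) : B -> prod_space A B).
Proof.
by apply: morphism_on_pair; [exact: morphism_on_cst|exact: morphism_on_id].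
Qed.

Lemma morphism_slice_l A B (b : B) :
  morphism_on [set: A] ((fun a => (a, b)) : A -> prod_space A B).
Proof.
by apply: morphism_on_pair; [exact: morphism_on_id|exact: morphism_on_cst].
Qed.

(** The topology is finer than the product topology, but its slices are open. Irreducibility of [B]
    yields a height [c] at which both [U] and [V] have points, and that of [A] a common point on the
    slice at height [c]. *)
Lemma prod_irreducible A B : irreducible A -> irreducible B ->
  irreducible (prod_space A B).
Proof.
move=> [[a _] irA] [[b _] irB]; split; first by exists (a, b).
move=> U V oU oV [[a1 b1] U1] [[a2 b2] V2].
have [||||c [Uc Vc]] := irB ((fun b => (a1, b)) @^-1` U) ((fun b => (a2, b)) @^-1` V).
- exact: (morphism_on_preimage (morphism_slice_r a1)).
- exact: (morphism_on_preimage (morphism_slice_r a2)).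
- by exists b1.
- by exists b2.
have [||||e [Ue Ve]] := irA ((fun a => (a, c)) @^-1` U) ((fun a => (a, c)) @^-1` V).
- exact: (morphism_on_preimage (morphism_slice_l c)).
- exact: (morphism_on_preimage (morphism_slice_l c)).
- by exists a1.
- by exists a2.
by exists (e, c).
Qed.

Definition separated_space A := closed [set p : prod_space A A | p.1 = p.2].

Lemma open_disagree A T (W : set T) (f g : T -> A) : separated_space A ->
  morphism_on W f -> morphism_on W g -> open (W `&` [set x | f x <> g x]).
Proof.
move=> sep mf mg; have [+ _] := morphism_on_pair mf mg (closed_openC sep).
by [].
Qed.

Lemma agree_irr A T (W O : set T) (f g : T -> A) : separated_space A ->
  irreducible T -> morphism_on W f -> morphism_on W g -> open O -> O !=set0 ->
  (forall x, W x -> O x -> f x = g x) -> forall x, W x -> f x = g x.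
Proof.
move=> sep [_ irr] mf mg oO nO e x Wx; apply: contrapT => ne.
have [|y [[Wy ney] Oy]] := irr _ _ (open_disagree sep mf mg) oO _ nO.
  by exists x.
by apply: ney; apply: e.
Qed.

End Morphisms.

(** * The additive group and function fields *)

Lemma poly_eventually_nonroot (k : fieldType) (P : {poly k}) :
  [pchar k] =i pred0 -> P != 0 ->
  exists N, forall n, (N <= n)%N -> P.[n%:R] != 0.
Proof.
move=> k0; have [m] := ubnP (size P); elim: m P => // m IH P; rewrite ltnS => le P0.
have [[n /rootP rn]|nr] := pselect (exists n : nat, P.[n%:R] = 0); last first.
  by exists 0%N => n _; apply/eqP => Pn; apply: nr; exists n.
have /factor_theorem[Q EQ] := rn.
have Q0 : Q != 0 by apply: contraNneq P0 => Q0; rewrite EQ Q0 mul0r.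
have [|N HN] := IH Q _ Q0.
  move: le; rewrite EQ size_Mmonic ?monicXsubC // size_XsubC addn2 /=.
  by [].
exists (maxn N n.+1) => j; rewrite geq_max => /andP[jN jn].
rewrite EQ hornerM hornerXsubC mulf_neq0 ?HN // subr_eq0.
by apply/eqP => /(natr_inj_char0 k0) E; rewrite E ltnn in jn.
Qed.

Section AffineSpaces.
Context (k : fieldType) (n : nat).

Lemma kalg_affineP (q : 'rV[k]_n -> k) :
  kalg (gens (affine_data k n) setT) q ->
  exists e : pex k 'I_n, forall v, q v = pev id (v ord0) e.
Proof.
elim=> [c|_ [i ->]|f g _ [a fa] _ [b gb]|f g _ [a fa] _ [b gb]].
- by exists (PCst _ c).
- by exists (PVar _ i).
- by exists (PAdd a b) => v /=; rewrite fa gb.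
- by exists (PMul a b) => v /=; rewrite fa gb.
Qed.

Lemma affine_openP (U : set (affine_space k n)) (v : affine_space k n) :
  open U -> U v ->
  exists e : pex k 'I_n, pev id ((v : 'rV_n) ord0) e != 0 /\
    forall w : 'rV_n, pev id (w ord0) e != 0 -> U w.
Proof.
rewrite genopenE => oU /oU[D [q [-> /kalg_affineP[e E] _ qv sU]]].
by exists e; rewrite -E; split=> // w; rewrite -E => qw; apply: sU.
Qed.

Lemma affine_regP (U : set (affine_space k n)) f (v : affine_space k n) :
  open U -> reg U f -> U v ->
  exists a e : pex k 'I_n, pev id ((v : 'rV_n) ord0) e != 0 /\
    forall w : 'rV_n, pev id (w ord0) e != 0 -> U w /\
      f w = pev id (w ord0) a / pev id (w ord0) e.
Proof.
move=> oU rf Uv.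
have [D [p [q [hD]]]] := rf _ Uv.
rewrite hD => /kalg_affineP[a Ea] /kalg_affineP[b Eb] [_ qv] E.
have [c [cv sU]] := affine_openP oU Uv.
exists (PMul a c), (PMul b c) => /=; rewrite -Eb mulf_neq0 //; split=> // w.
rewrite mulf_eq0 negb_or => /andP[bw cw]; have Uw := sU _ cw; split=> //.
by rewrite E ?hD // ?Eb // Ea -mulf_div divff // mulr1.
Qed.

Lemma reg_coord i : reg [set: affine_space k n] (fun v : 'rV_n => v ord0 i).
Proof. by apply: reg_kalg => //; apply: kalg_gen; exists i. Qed.

Lemma morphism_on_affine (S : funspace k) (W : set S) (f : S -> affine_space k n) :
  open W -> (forall i, reg W (fun x => (f x : 'rV_n) ord0 i)) -> morphism_on W f.
Proof.
move=> oW rf; apply: morphism_on_genspace => D ->; rewrite preimage_setT setIT.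
by split=> // h [i ->]; apply: rf.
Qed.

End AffineSpaces.

Section AdditiveGroup.
Context (k : fieldType).

Definition ga (c : k) : Ga k := const_mx c : 'rV_1.
Definition ga_val (t : Ga k) : k := (t : 'rV_1) ord0 ord0.

Lemma gaK c : ga_val (ga c) = c.
Proof. by rewrite /ga_val mxE. Qed.

Lemma ga_valK t : ga (ga_val t) = t.
Proof. by apply/rowP => i; rewrite mxE ord1. Qed.

Lemma ga_valD s t : ga_val (Ga_add s t) = ga_val s + ga_val t.
Proof. by rewrite /ga_val /Ga_add mxE. Qed.

Lemma ga_add c d : Ga_add (ga c) (ga d) = ga (c + d).
Proof. by rewrite -[LHS]ga_valK ga_valD !gaK. Qed.

Lemma reg_ga_val : reg [set: Ga k] ga_val.
Proof. exact: reg_coord. Qed.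

Lemma pev_ga (e : pex k 'I_1) :
  exists P : {poly k}, forall t : Ga k, pev id ((t : 'rV_1) ord0) e = P.[ga_val t].
Proof.
elim: e => [c|i|a [P hP] b [Q hQ]|a [P hP] b [Q hQ]].
- by exists c%:P => t; rewrite hornerC.
- by exists 'X => t /=; rewrite hornerX /ga_val (ord1 i).
- by exists (P + Q) => t; rewrite hornerD /= hP hQ.
- by exists (P * Q) => t; rewrite hornerM /= hP hQ.
Qed.

Lemma ga_eventually (U : set (Ga k)) : [pchar k] =i pred0 -> open U ->
  U !=set0 -> exists N, forall n, (N <= n)%N -> U (ga n%:R).
Proof.
move=> k0 oU [t Ut]; have [e [et sU]] := affine_openP oU Ut.
have [P hP] := pev_ga e; move: et; rewrite hP => Pt.
have [|N HN] := @poly_eventually_nonroot k P k0.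
  by apply: contraNneq Pt => ->; rewrite horner0.
by exists N => n /HN Pn; apply: sU; rewrite hP gaK.
Qed.

Lemma Ga_irreducible : [pchar k] =i pred0 -> irreducible (Ga k).
Proof.
move=> k0; split; first by exists (ga 0).
move=> U V oU oV nU nV.
have [N HN] := ga_eventually k0 oU nU; have [M HM] := ga_eventually k0 oV nV.
exists (ga (maxn N M)%:R); split; first by apply: HN; rewrite leq_maxl.
by apply: HM; rewrite leq_maxr.
Qed.

Lemma morphism_Ga_add :
  morphism_on [set: prod_space (Ga k) (Ga k)] (fun p => Ga_add p.1 p.2).
Proof.
apply: morphism_on_affine => [|i]; first exact: openT.
apply: (reg_ext (f := fun p : prod_space (Ga k) (Ga k) =>
    ga_val p.1 + ga_val p.2)) => [||]; first exact: openT.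
  by move=> p _; rewrite -ga_valD /ga_val (ord1 i).
apply: regD; first exact: openT.
  have [_ /(_ _ reg_ga_val)] := @morphism_on_fst _ (Ga k) (Ga k) setT openT.
  by rewrite preimage_setT setIT.
have [_ /(_ _ reg_ga_val)] := @morphism_on_snd _ (Ga k) (Ga k) setT openT.
by rewrite preimage_setT setIT.
Qed.

(** Density of the pairs (n, b) in usable form: an open condition on the product is tested on the
    slice over a large integer. *)
Lemma slice_eventually (B : funspace k) (O : set (prod_space (Ga k) B)) :
  [pchar k] =i pred0 -> open O -> O !=set0 -> exists N, forall n, (N <= n)%N ->
    open [set b : B | O (ga n%:R, b)] /\ [set b : B | O (ga n%:R, b)] !=set0.
Proof.
move=> k0 oO [[t b] Otb].
have [||N HN] := @ga_eventually ((fun t => (t, b)) @^-1` O) k0.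
- exact: (morphism_on_preimage (morphism_slice_l b)).
- by exists t.
exists N => n /HN On; split; last by exists b.
exact: (morphism_on_preimage (morphism_slice_r (ga n%:R))).
Qed.

End AdditiveGroup.

(** * Rational functions, and polynomials over the function field, through representatives *)

Section FunctionFieldRep.
Context (k : closedFieldType) (Z : irrvariety k).
Implicit Types (U V O : set Z) (f g : Z -> k) (l : funfield Z).

(** Computations in the function field are carried out through this relation, as pointwise
    identities between functions on opens, without choosing germs. *)
Definition isrep l U f := exists h : germ Z, [/\ gdom h = U, gfun h = f & rfun h = l].

Lemma isrep_open l U f : isrep l U f -> open U.
Proof. by case=> h [<- _ _]; apply: gdom_open. Qed.

Lemma isrep_neq0 l U f : isrep l U f -> U !=set0.
Proof. by case=> h [<- _ _]; apply: gdom_neq0. Qed.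

Lemma isrep_reg l U f : isrep l U f -> reg U f.
Proof. by case=> h [<- <- _]; apply: greg. Qed.

Lemma isrep_rfun (h : germ Z) : isrep (rfun h) (gdom h) (gfun h).
Proof. by exists h. Qed.

Lemma isrep_repr l : isrep l (gdom (repr l)) (gfun (repr l)).
Proof. by exists (repr l); split=> //; apply: rfun_repr. Qed.

Lemma isrep_intro U f : open U -> U !=set0 -> reg U f -> exists l, isrep l U f.
Proof. by move=> oU nU rf; exists (rfun (Germ oU nU rf)); exists (Germ oU nU rf). Qed.

Lemma irrI U V : open U -> open V -> U !=set0 -> V !=set0 ->
  open (U `&` V) /\ U `&` V !=set0.
Proof. by move=> oU oV nU nV; split; [apply: openI|apply: irr_meet]. Qed.

(** [O] is not tied to [U] and [U']: irreducibility makes it meet them. *)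
Lemma isrep_eq l l' U U' f f' O : isrep l U f -> isrep l' U' f' ->
  open O -> O !=set0 -> (forall x, O x -> U x -> U' x -> f x = f' x) -> l = l'.
Proof.
move=> r r' oO nO E.
have [oI nI] := irrI (isrep_open r) (isrep_open r') (isrep_neq0 r) (isrep_neq0 r').
have [oJ nJ] := irrI oO oI nO nI.
case: r r' E oI nI oJ nJ => h [<- <- <-] [h' [<- <- <-]] E oI nI oJ nJ.
by apply: (rfun_eq oJ nJ) => [x [_ []]|x [Ox [hx h'x]]] //; apply: E.
Qed.

(** Equal germs agree a priori on some smaller open only; irreducibility extends this to every
    common point. *)
Lemma isrep_agree l U U' f f' : isrep l U f -> isrep l U' f' ->
  forall x, U x -> U' x -> f x = f' x.
Proof.
move=> r r' x Ux U'x.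
have oI := openI (isrep_open r) (isrep_open r').
case: (r) (r') => h [Eh Ef E] [h' [Eh' Ef' E']].
have /eqmodP/germ_eqvP[W [oW nW _ e]] : rfun h = rfun h' by rewrite E E'.
rewrite Ef Ef' in e.
apply: (reg_eq_irr (irr_irreducible Z) oI oW nW _ _ _ (x := x)) => //.
- by apply: reg_res (isrep_reg r) => //; exact: isrep_open r.
- by apply: reg_res (isrep_reg r') => //; exact: isrep_open r'.
- by move=> y _; apply: e.
Qed.

Lemma isrep_sub l U V f : open V -> V !=set0 -> V `<=` U -> isrep l U f ->
  isrep l V f.
Proof.
move=> oV nV sV r; have rV := reg_res (isrep_open r) oV sV (isrep_reg r).
have [l' r'] := isrep_intro oV nV rV.
by rewrite (isrep_eq r r' oV nV).
Qed.

Lemma isrep_ext l U f g : (forall x, U x -> f x = g x) -> isrep l U f ->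
  isrep l U g.
Proof.
move=> e r; have oU := isrep_open r; have nU := isrep_neq0 r.
have [l' r'] := isrep_intro oU nU (reg_ext oU e (isrep_reg r)).
by rewrite (isrep_eq r r' oU nU) // => x _ Ux _; apply: e.
Qed.

Lemma isrepD l m U V f g : isrep l U f -> isrep m V g ->
  isrep (l + m) (U `&` V) (fun x => f x + g x).
Proof.
move=> [h [<- <- <-]] [h' [<- <- <-]].
by rewrite [_ + _]ff_addE; apply: (isrep_rfun (germ_add h h')).
Qed.

Lemma isrepM l m U V f g : isrep l U f -> isrep m V g ->
  isrep (l * m) (U `&` V) (fun x => f x * g x).
Proof.
move=> [h [<- <- <-]] [h' [<- <- <-]].
by rewrite [_ * _]ff_mulE; apply: (isrep_rfun (germ_mul h h')).
Qed.

Definition ffcst (c : k) : funfield Z := rfun (germ_cst Z c).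

Lemma isrep_cst c : isrep (ffcst c) setT (fun=> c).
Proof. exact: isrep_rfun. Qed.

Lemma isrep1 : isrep 1 setT (fun=> 1).
Proof. exact: isrep_cst. Qed.

Lemma isrep0 : isrep 0 setT (fun=> 0).
Proof. exact: isrep_cst. Qed.

Lemma isrep_eq0 l U f O : isrep l U f -> open O -> O !=set0 ->
  (forall x, O x -> U x -> f x = 0) -> l = 0.
Proof.
by move=> r oO nO E; apply: (isrep_eq r isrep0 oO nO) => x Ox Ux _; apply: E.
Qed.

Lemma isrep_nonzero l U f : isrep l U f -> l != 0 ->
  U `&` [set x | f x != 0] !=set0.
Proof.
move=> r l0; apply: contrapT => H; move/eqP: l0; apply.
apply: (isrep_eq0 r (isrep_open r) (isrep_neq0 r)) => x _ Ux.
by apply/eqP/negPn/negP => fx; apply: H; exists x.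
Qed.

Lemma ffcstD : {morph ffcst : c d / c + d}.
Proof.
move=> c d; apply: (isrep_eq (isrep_cst _) (isrepD (isrep_cst c) (isrep_cst d))
  openT (irrT Z)) => //.
Qed.

Lemma ffcstM : {morph ffcst : c d / c * d}.
Proof.
move=> c d; apply: (isrep_eq (isrep_cst _) (isrepM (isrep_cst c) (isrep_cst d))
  openT (irrT Z)) => //.
Qed.

Lemma ffcstB : zmod_morphism ffcst.
Proof. by move=> c d; apply/eqP; rewrite eq_sym subr_eq -ffcstD subrK. Qed.

Lemma ffcst_monoid : monoid_morphism ffcst.
Proof. by split=> [//|c d]; apply: ffcstM. Qed.

HB.instance Definition _ := GRing.isZmodMorphism.Build k (funfield Z) ffcst ffcstB.
HB.instance Definition _ :=
  GRing.isMonoidMorphism.Build k (funfield Z) ffcst ffcst_monoid.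

Lemma funfield_char0 : [pchar k] =i pred0 -> [pchar (funfield Z)] =i pred0.
Proof. by move=> k0 p; rewrite (fmorph_pchar ffcst). Qed.

Lemma isrep_common n (l : nat -> funfield Z) : exists V (f : nat -> Z -> k),
  [/\ open V, V !=set0 & forall i, (i < n)%N -> isrep (l i) V (f i)].
Proof.
elim: n => [|n [V [f [oV nV H]]]].
  by exists setT, (fun=> fun=> 0); split=> //; [exact: openT|exact: irrT].
have r := isrep_repr (l n).
have [oI nI] := irrI oV (isrep_open r) nV (isrep_neq0 r).
exists (V `&` gdom (repr (l n))), (fun i => if i == n then gfun (repr (l n)) else f i).
split=> // i; rewrite ltnS leq_eqVlt; have [->|ne] /= := eqVneq i n => [_|/H ri].
  by apply: isrep_sub r => // x [].
by apply: isrep_sub ri => // x [].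
Qed.

Lemma isrep_sum n (l : nat -> funfield Z) V (f : nat -> Z -> k) : open V -> V !=set0 ->
  (forall i, (i < n)%N -> isrep (l i) V (f i)) ->
  isrep (\sum_(i < n) l i) V (fun x => \sum_(i < n) f i x).
Proof.
move=> oV nV; elim: n => [|n IH] H.
  rewrite big_ord0; apply: (isrep_ext (f := fun=> 0)) => [x _|].
    by rewrite big_ord0.
  by apply: isrep_sub isrep0.
rewrite big_ord_recr /=.
apply: (isrep_ext (f := fun x => \sum_(i < n) f i x + f n x)) => [x _|].
  by rewrite big_ord_recr.
have := isrepD (IH _) (H n _); rewrite setIid; apply=> // i lt.
by apply: H; rewrite ltnS ltnW.
Qed.

(** A polynomial over the function field is a family of polynomials over [k] indexed by the points
    of [V], hence also a function on the product of the additive group with [V]. *)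
Definition isprep (p : {poly funfield Z}) V (P : Z -> {poly k}) :=
  [/\ open V, V !=set0 & forall i, isrep p`_i V (fun x => (P x)`_i)].

Lemma isprep_size p V P x : isprep p V P -> V x -> (size (P x) <= size p)%N.
Proof.
move=> [_ _ H] Vx; apply/leq_sizeP => i le.
have := H i; rewrite nth_default // => r.
exact: (isrep_agree r isrep0).
Qed.

Lemma isprep_agree p V P V' P' x : isprep p V P -> isprep p V' P' ->
  V x -> V' x -> P x = P' x.
Proof.
move=> [_ _ H] [_ _ H'] Vx Vx'; apply/polyP => i.
exact: (isrep_agree (H i) (H' i)).
Qed.

Lemma isprep_exists p : exists V P, isprep p V P.
Proof.
have [V [f [oV nV H]]] := isrep_common (size p) (fun i => p`_i).
exists V, (fun x => \poly_(i < size p) f i x).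
split=> // i.
apply: (isrep_ext (f := if (i < size p)%N then f i else fun=> 0)).
  by move=> x _; rewrite coef_poly; case: ifP.
case: ltnP => [/H //|le]; rewrite nth_default //.
by apply: isrep_sub isrep0.
Qed.

Lemma isprep_sub p U V P : open V -> V !=set0 -> V `<=` U -> isprep p U P ->
  isprep p V P.
Proof. by move=> oV nV sV [oU nU H]; split=> // i; apply: isrep_sub (H i). Qed.

Lemma isprep_horner p V P t : isprep p V P ->
  isrep p.[ffcst t] V (fun x => (P x).[t]).
Proof.
move=> r; have [oV nV H] := r.
apply: (isrep_ext (f := fun x => \sum_(i < size p) (P x)`_i * t ^+ i)).
  by move=> x Vx; rewrite (horner_coef_wide _ (isprep_size r Vx)).
rewrite horner_coef.
apply: (isrep_sum (f := fun i x => (P x)`_i * t ^+ i) (l := fun i => p`_i * _ ^+ i)) => // i _.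
by have := isrepM (H i) (isrep_cst (t ^+ i)); rewrite setIT rmorphXn.
Qed.

Lemma isprep_reg p V P : isprep p V P ->
  reg (snd @^-1` V : set (prod_space (Ga k) Z))
  (fun z : prod_space (Ga k) Z => (P z.2).[ga_val z.1]).
Proof.
move=> r; have [oV nV H] := r.
have oV' : open (snd @^-1` V : set (prod_space (Ga k) Z)).
  exact: morphism_on_preimage (@morphism_on_snd _ _ _) oV.
apply: (reg_ext (f := fun z : prod_space (Ga k) Z =>
    \sum_(i < size p) (P z.2)`_i * ga_val z.1 ^+ i)) => //.
  by move=> z Vz; rewrite (horner_coef_wide _ (isprep_size r Vz)).
apply: reg_sum => // i; apply: regM => //; last first.
  apply: reg_exp => //.
  have [_ /(_ _ (@reg_ga_val k))] := @morphism_on_fst _ (Ga k) Z setT openT.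
  by rewrite preimage_setT setIT; apply: reg_res => //; exact: openT.
have [_ /(_ _ (isrep_reg (H i)))] := @morphism_on_snd _ (Ga k) Z V oV.
by rewrite setTI.
Qed.

Lemma isprepD p q U V P Q : isprep p U P -> isprep q V Q ->
  isprep (p + q) (U `&` V) (fun x => P x + Q x).
Proof.
move=> [oU nU H] [oV nV H']; have [oI nI] := irrI oU oV nU nV; split=> // i.
rewrite coefD; apply: isrep_ext (isrepD (H i) (H' i)) => x _.
by rewrite coefD.
Qed.

Lemma isprepM p q U V P Q : isprep p U P -> isprep q V Q ->
  isprep (p * q) (U `&` V) (fun x => P x * Q x).
Proof.
move=> [oU nU H] [oV nV H']; have [oI nI] := irrI oU oV nU nV; split=> // i.
rewrite coefM; apply: (isrep_ext (f := fun x => \sum_(j < i.+1) (P x)`_j * (Q x)`_(i - j))).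
  by move=> x _; rewrite coefM.
apply: (isrep_sum (f := fun j x => (P x)`_j * (Q x)`_(i - j))
  (l := fun j => p`_j * q`_(i - j))) => // j _.
exact: isrepM.
Qed.

Lemma isprepC l V f : isrep l V f -> isprep l%:P V (fun x => (f x)%:P).
Proof.
move=> r; have oV := isrep_open r; have nV := isrep_neq0 r; split=> // i.
apply: (isrep_ext (f := if i == 0%N then f else fun=> 0)).
  by move=> x _; rewrite coefC; case: ifP.
by rewrite coefC; case: ifP => // _; apply: isrep_sub isrep0.
Qed.

Lemma isprep_cst (r : {poly k}) : isprep (map_poly ffcst r) setT (fun=> r).
Proof.
split=> [||i]; [exact: openT|exact: irrT|].
by rewrite coef_map; apply: isrep_cst.
Qed.

(** Over each large integer n the slice of [O] is a nonempty open of [Z], so p(n) is zero in the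
    function field; a polynomial vanishing at all large integers is zero in characteristic zero. *)
Lemma isprep_eq0 p V P (O : set (prod_space (Ga k) Z)) : [pchar k] =i pred0 ->
  isprep p V P -> open O -> O !=set0 ->
  (forall z, O z -> V z.2 -> (P z.2).[ga_val z.1] = 0) -> p = 0.
Proof.
move=> k0 r oO nO E; have [N HN] := slice_eventually k0 oO nO.
apply: (@poly_eq0_eventually _ (funfield_char0 k0) _ N) => n /HN[oS nS].
rewrite -(rmorph_nat ffcst); apply: (isrep_eq0 (isprep_horner _ r) oS nS).
by move=> x Ox Vx; rewrite -(E _ Ox Vx) gaK.
Qed.

End FunctionFieldRep.

(** Dominance is phrased with preimages: it then passes directly to composites, and gives nonempty
    domains to pulled-back functions. *)
Definition dominant_rational (k : fieldType) (T Z : funspace k) (f : ratrep T Z) :=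
  morphism_on (dom f) (fn f) /\
  forall O : set Z, open O -> O !=set0 -> dom f `&` fn f @^-1` O !=set0.

(** Dominance keeps the pulled-back domain nonempty, and two representatives of [l] agree at all
    common points, so their pull-backs define the same element. *)
Lemma pullback_exists (k : closedFieldType) (T Z : irrvariety k) (f : ratrep T Z) :
  dominant_rational f -> exists theta : {rmorphism funfield Z -> funfield T},
    forall l U g, isrep l U g ->
      isrep (theta l) (dom f `&` fn f @^-1` U) (g \o fn f).
Proof.
move=> [mf df].
have pull l U g : isrep l U g -> exists m,
    isrep m (dom f `&` fn f @^-1` U) (g \o fn f).
  move=> r; have [oV rV] := mf _ (isrep_open r).
  apply: isrep_intro => //; first exact: df (isrep_open r) (isrep_neq0 r).
  exact: rV (isrep_reg r).
have fn_ l U g m U' g' m' : isrep l U g -> isrep l U' g' ->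
    isrep m (dom f `&` fn f @^-1` U) (g \o fn f) ->
    isrep m' (dom f `&` fn f @^-1` U') (g' \o fn f) -> m = m'.
  move=> r r' rm rm'; apply: (isrep_eq rm rm' openT (irrT T)).
  by move=> x _ [_ Ux] [_ Ux'] /=; apply: (isrep_agree r r').
have [theta H] : exists theta : {rmorphism funfield Z -> funfield T},
    forall l, exists U g, isrep l U g /\
      isrep (theta l) (dom f `&` fn f @^-1` U) (g \o fn f).
  apply: (rmorphism_of_relation (Rl := fun l m => exists U g, isrep l U g /\
      isrep m (dom f `&` fn f @^-1` U) (g \o fn f))).
  - move=> l; have r := isrep_repr l; have [m rm] := pull _ _ _ r.
    by exists m, (gdom (repr l)), (gfun (repr l)).
  - by move=> l m m' [U [g [r rm]]] [U' [g' [r' rm']]]; apply: fn_ r r' rm rm'.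
  - have [m rm] := pull _ _ _ (isrep1 Z).
    exists setT, (fun=> 1); split; first exact: isrep1.
    by rewrite (_ : 1 = m) //; apply: (isrep_eq (isrep1 T) rm openT (irrT T)).
  - move=> l l' m m' [U [g [r rm]]] [U' [g' [r' rm']]].
    have [w rw] := pull _ _ _ (isrepD r r').
    exists (U `&` U'), (fun x => g x + g' x); split; first exact: isrepD.
    rewrite (_ : m + m' = w) //.
    by apply: (isrep_eq (isrepD rm rm') rw openT (irrT T)).
  - move=> l l' m m' [U [g [r rm]]] [U' [g' [r' rm']]].
    have [w rw] := pull _ _ _ (isrepM r r').
    exists (U `&` U'), (fun x => g x * g' x); split; first exact: isrepM.
    rewrite (_ : m * m' = w) //.
    by apply: (isrep_eq (isrepM rm rm') rw openT (irrT T)).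
exists theta => l U g r; have [U' [g' [r' rt]]] := H l.
have [m rm] := pull _ _ _ r.
by rewrite (fn_ _ _ _ _ _ _ _ r' r rt rm).
Qed.

(** * Affine coordinates *)

Section InducedSpace.
Context (k : fieldType) (X : funspace k) (S : set X).

Lemma induced_kalgP D (q : set_type S -> k) : chart (induced_data S) D ->
  kalg (gens (induced_data S) D) q ->
  exists V Q, [/\ open V, reg V Q, D = [set w | V (val w)] &
    forall w, D w -> q w = Q (val w)].
Proof.
move=> [V0 oV0 ED]; elim=> [c|g [U [f [oU rf E ->]]]|f g _ + _|f g _ + _].
- by exists V0, (fun=> c); split=> //; apply: reg_cst.
- by exists U, f.
- move=> [U [F [oU rF EU HF]]] [V [G [oV rG EV HG]]].
  exists (U `&` V), (fun x => F x + G x); have oI := openI oU oV; split=> //.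
  + by apply: regD => //; [apply: reg_res rF|apply: reg_res rG].
  + rewrite (_ : [set w | (U `&` V) (val w)] =
      [set w | U (val w)] `&` [set w | V (val w)]) // -EU -EV setIid.
    by [].
  + by move=> w Dw; rewrite HF // HG.
- move=> [U [F [oU rF EU HF]]] [V [G [oV rG EV HG]]].
  exists (U `&` V), (fun x => F x * G x); have oI := openI oU oV; split=> //.
  + by apply: regM => //; [apply: reg_res rF|apply: reg_res rG].
  + rewrite (_ : [set w | (U `&` V) (val w)] =
      [set w | U (val w)] `&` [set w | V (val w)]) // -EU -EV setIid.
    by [].
  + by move=> w Dw; rewrite HF // HG.
Qed.

Lemma morphism_val : morphism_on [set: induced S] (val : set_type S -> X).
Proof.
move=> V oV; rewrite setTI.
have hV : chart (induced_data S) (val @^-1` V) by exists V.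
split=> [|h rh]; first exact: open_chart.
by apply: reg_kalg => //; apply: kalg_gen; exists V, h.
Qed.

Lemma induced_reg_extend (W : set (induced S)) (h : induced S -> k) (H : X -> k) :
  open S -> open W -> reg W h -> (forall w, W w -> H (val (w : set_type S)) = h w) ->
  open (val @` W : set X) /\ reg (val @` W : set X) H.
Proof.
move=> oS oW rh HE.
have oVW : open (val @` W : set X).
  apply: open_local => _ [w Ww <-].
  move: oW; rewrite genopenE => /(_ _ Ww)[D [q [hD hq Dw qw sW]]].
  have [V [Q [oV rQ ED EQ]]] := induced_kalgP hD hq.
  exists (S `&` (V `&` [set x | Q x != 0])).
  have oVQ := reg_open oV rQ.
  split; first exact: openI.
    split; first exact: set_valP.
    by split; [rewrite ED in Dw|rewrite /= -EQ].
  move=> x [Sx [Vx /= Qx]].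
  pose w' : set_type S := exist _ x (mem_set Sx).
  have Dw' : D w' by rewrite ED.
  by exists w' => //; apply: sW; split=> //=; rewrite EQ.
split=> //; apply: reg_glue => // _ [w Ww <-].
have [D [p [q [hD hp hq [Dw qw] E]]]] := rh _ Ww.
have [V [Q [oV rQ ED EQ]]] := induced_kalgP hD hq.
have [V' [P [oV' rP ED' EP]]] := induced_kalgP hD hp.
have oI := openI oV' oV.
have rP' : reg (V' `&` V) P by apply: reg_res rP.
have rQ' : reg (V' `&` V) Q by apply: reg_res rQ.
have oVQ := reg_open oI rQ'; have oJ := openI oVW oVQ.
exists ((val @` W) `&` (V' `&` V `&` [set x | Q x != 0])); split=> //.
  split; first by exists w.
  by split=> /=; [split; [rewrite ED' in Dw|rewrite ED in Dw]|rewrite -EQ].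
apply: (reg_ext (f := fun x => P x / Q x)) => //.
  move=> _ [[w' Ww' <-] [[V'w Vw] /= Qw]].
  have Dw' : D w' by rewrite ED.
  by rewrite HE // E // ?EQ // EP.
by apply: reg_res (reg_div oI rP' rQ').
Qed.

End InducedSpace.

Section Coordinates.
Context (k : fieldType) (X : funspace k).

(* [x] identifies the open set [U] with a Zariski closed subset of affine space. *)
Record affine_coords (U : set X) m (x : 'I_m -> X -> k) : Prop := AffineCoords {
  coords_open : open U;
  coords_reg : forall i, reg U (x i);
  coords_inj : forall u v, U u -> U v -> (forall i, x i u = x i v) -> u = v;
  coords_complete : forall c : 'I_m -> k,
    (forall e, (forall u, U u -> pev id (x^~ u) e = 0) -> pev id c e = 0) ->
    exists u, U u /\ forall i, x i u = c i;
  coords_nbhs : forall W u, open W -> U u -> W u ->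
    exists e, pev id (x^~ u) e != 0 /\
      forall v, U v -> pev id (x^~ v) e != 0 -> W v;
  coords_frac : forall W f u, open W -> reg W f -> U u -> W u ->
    exists a e, pev id (x^~ u) e != 0 /\
      forall v, U v -> pev id (x^~ v) e != 0 ->
        W v /\ f v = pev id (x^~ v) a / pev id (x^~ v) e }.

Lemma affine_coords_exists U : open U -> affine_subset U ->
  exists m (x : 'I_m -> X -> k), affine_coords U x.
Proof.
move=> oU [m [Z [cZ [f [g [mf mg fK gK]]]]]].
pose F (w : set_type U) : 'rV[k]_m := val (f w : set_type Z).
pose x (i : 'I_m) (u : X) : k := match pselect (U u) with
  | left p => F (exist _ u (mem_set p)) ord0 i | right _ => 0 end.
have xE (w : set_type U) i : x i (val w) = F w ord0 i.
  rewrite /x; case: pselect => [p|[]]; last exact: set_valP.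
  by congr (F _ _ _); apply: val_inj.
have xEf (w : set_type U) : x^~ (val w) = F w ord0 by apply/funext => i; apply: xE.
have xEu u (Uu : U u) : x^~ u = F (exist _ u (mem_set Uu)) ord0 by rewrite -xEf.
have mF : morphism_on [set: induced U] (F : induced U -> affine_space k m).
  have := morphism_on_comp mf (@morphism_val _ _ Z).
  by rewrite preimage_setT setIT.
have nbhs_ W u : open W -> U u -> W u ->
    exists e, pev id (x^~ u) e != 0 /\ forall v, U v -> pev id (x^~ v) e != 0 -> W v.
  move=> oW Uu Wu; pose w : set_type U := exist _ u (mem_set Uu).
  have oW1 := morphism_on_preimage (@morphism_val _ _ U) oW.
  have oW2 := morphism_on_preimage mg oW1.
  have W2 : (g @^-1` (val @^-1` W)) (f w) by rewrite /= fK.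
  move: oW2; rewrite genopenE => /(_ _ W2)[D [q [hD hq Dw qw sW]]].
  have [V [Q [oV rQ ED EQ]]] := induced_kalgP hD hq.
  have VF : V (F w) by rewrite ED in Dw.
  have [a [e [ew H]]] := affine_regP oV rQ VF.
  exists (PMul a e); have [_ EQw] := H _ ew; rewrite (xEu _ Uu) /=; split.
    rewrite mulf_neq0 //; move: qw; rewrite EQ // EQw mulf_eq0 negb_or.
    by case/andP.
  move=> v Uv; rewrite (xEu _ Uv) /= mulf_eq0 negb_or => /andP[av ev].
  have [VFv EQv] := H _ ev; set w' := exist _ _ _ in VFv EQv av ev.
  have Dw' : D (f w') by rewrite ED.
  suff : (g @^-1` (val @^-1` W)) (f w') by rewrite /= fK.
  by apply: sW; split=> //=; rewrite EQ // EQv mulf_neq0 // invr_eq0.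
exists m, x; split=> //.
- move=> i.
  have [_ rF] := mF setT openT; have := rF _ (@reg_coord k m i).
  rewrite preimage_setT setIT => rF'.
  have [oI rI] := @induced_reg_extend _ _ U setT _ (x i) oU openT rF' (fun w _ => xE w i).
  apply: reg_res rI => // u Uu.
  by exists (exist _ u (mem_set Uu)).
- move=> u v Uu Uv E.
  suff : f (exist _ u (mem_set Uu)) = f (exist _ v (mem_set Uv)).
    by move/(can_inj fK)/(congr1 val).
  apply: val_inj; apply/rowP => i.
  by have := E i; rewrite (xE (exist _ u (mem_set Uu))) (xE (exist _ v (mem_set Uv))).
- move=> c cP; pose c' : 'rV[k]_m := \row_i c i.
  have cE : c = c' ord0 by apply/funext => i; rewrite mxE.
  have Zc : Z c'.
    (* The complement of [Z] is open, so some polynomial is nonzero at [c'] and vanishes on [Z]: a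
       relation among the coordinates that [c] violates. *)
    apply: contrapT => nZ.
    have [e [ec sZ]] := affine_openP (closed_openC cZ) (nZ : (~` Z) c').
    move/eqP: ec; apply; rewrite -cE; apply: cP => u Uu.
    apply/eqP/negPn/negP; rewrite (xEu _ Uu) => /sZ; apply.
    exact: set_valP.
  pose w := g (exist _ c' (mem_set Zc)); exists (val (w : set_type U)).
  split=> [|i]; first exact: set_valP.
  by rewrite xE /F /w gK /= mxE.
- move=> W h u oW rh Uu Wu; pose w : set_type U := exist _ u (mem_set Uu).
  have [c [cu sW]] := nbhs_ _ _ oW Uu Wu.
  have [oW1 rW1] := @morphism_val _ _ U _ oW.
  rewrite setTI in oW1 rW1; have [oW2 rW2] := mg _ oW1.
  rewrite setTI in oW2 rW2; have rh' := rW2 _ (rW1 _ rh).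
  have W2 : (g @^-1` (val @^-1` W)) (f w) by rewrite /= fK.
  have [D [p [q [hD hp hq [Dw qw] E]]]] := rh' _ W2.
  have [V [Q [oV rQ ED EQ]]] := induced_kalgP hD hq.
  have [V' [P [oV' rP ED' EP]]] := induced_kalgP hD hp.
  have VF : V (F w) by rewrite ED in Dw.
  have VF' : V' (F w) by rewrite ED' in Dw.
  have [b [d [dw H]]] := affine_regP oV rQ VF.
  have [a [e [ew H']]] := affine_regP oV' rP VF'.
  have [_ EQw] := H _ dw.
  (* The function is (a / e) / (b / d). The additional factors [d] and [c], put above and below,
     keep the nonvanishing locus inside the domains of these expressions and inside [W]. *)
  exists (PMul (PMul (PMul a d) d) c), (PMul (PMul (PMul e b) d) c).
  split=> /=.
    rewrite (xEu _ Uu) in cu *.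
    rewrite !mulf_neq0 //; move: qw; rewrite EQ // EQw mulf_eq0 negb_or.
    by case/andP.
  move=> v Uv; rewrite !mulf_eq0 !negb_or => /andP[/andP[/andP[ev bv] dv] cv].
  have Wv := sW _ Uv cv; split=> //.
  rewrite (xEu _ Uv) in ev bv dv cv *; set w' := exist _ _ _ in ev bv dv cv *.
  have [VFv EQv] := H _ dv; have [VFv' EPv] := H' _ ev.
  have Dw' : D (f w') by rewrite ED.
  have q0 : q (f w') != 0 by rewrite EQ // EQv mulf_neq0 // invr_eq0.
  have W2' : (g @^-1` (val @^-1` W)) (f w') by rewrite /= fK.
  have := E (f w') W2' Dw' q0; rewrite /= fK /= => ->.
  rewrite EQ // EP // EPv EQv -[RHS]mulf_div divff // mulr1 -[RHS]mulf_div divff // mulr1.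
  by rewrite invf_div mulf_div.
Qed.

End Coordinates.

Lemma irr_affine_coords (k : closedFieldType) (Z : irrvariety k) (z : Z) :
  exists (U : set Z) m (x : 'I_m -> Z -> k), U z /\ affine_coords U x.
Proof.
have [[n [U [aff cov]]] _] := irr_variety Z.
have : [set: Z] z by []; rewrite -cov => -[i _ Uz].
have [oU aU] := aff i; have [m [x cx]] := affine_coords_exists oU aU.
by exists (U i), m, x.
Qed.

Lemma irr_separated (k : closedFieldType) (Z : irrvariety k) : separated_space Z.
Proof. by have [] := irr_variety Z. Qed.

(** On the chart, opens and regular functions are locally given by polynomials in the coordinates,
    and these pull back to regular functions. *)
Lemma morphism_on_coords (k : fieldType) (X T : funspace k) (U : set X) m
    (x : 'I_m -> X -> k) (W : set T) (f : T -> X) : affine_coords U x ->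
  open W -> (forall t, W t -> U (f t)) -> (forall i, reg W (x i \o f)) ->
  morphism_on W f.
Proof.
move=> cx oW sW rf V oV.
have rp e : reg W (fun t => pev id (x^~ (f t)) e).
  exact: (@reg_pev _ _ _ _ e (fun i => x i \o f) oW).
have oWV : open (W `&` f @^-1` V).
  apply: open_local => t [Wt Vt].
  have [e [et sV]] := coords_nbhs cx oV (sW _ Wt) Vt.
  exists (W `&` [set s | pev id (x^~ (f s)) e != 0]); split=> //.
    exact: reg_open.
  by move=> s [Ws es]; split=> //; apply: sV => //; apply: sW.
split=> // h rh; apply: reg_glue => // t [Wt Vt].
have [a [e [et sV]]] := coords_frac cx oV rh (sW _ Wt) Vt.
have oWe := reg_open oW (rp e); have oI := openI oWV oWe.
exists (W `&` f @^-1` V `&` (W `&` [set s | pev id (x^~ (f s)) e != 0])).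
split=> //.
apply: (reg_ext (f := fun s => pev id (x^~ (f s)) a / pev id (x^~ (f s)) e)) => //.
  by move=> s [_ [Ws es]] /=; have [_ ->] := sV _ (sW _ Ws) es.
by apply: reg_res (reg_div oW (rp a) (rp e)).
Qed.

(** * From interpolation to unipotence *)

Lemma rat_eq_refl (k : fieldType) (X Z : funspace k) (f : ratrep X Z) :
  rational_map f -> Defs.rat_eq f f.
Proof. by move=> [oD dD _]; exists (dom f); split. Qed.

Lemma finite_meet (k : closedFieldType) (Z : irrvariety k) (I : finType)
    (V : I -> set Z) : (forall i, open (V i) /\ V i !=set0) ->
  exists W, [/\ open W, W !=set0 & forall i, W `<=` V i].
Proof.
move=> H; have [W [oW nW sW]] : exists W : set Z,
    [/\ open W, W !=set0 & forall i, i \in enum I -> W `<=` V i].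
  elim: (enum I) => [|i s [W [oW nW sW]]].
    by exists setT; split=> //; [exact: openT|exact: irrT].
  have [oV nV] := H i; have [oI nI] := irrI oW oV nW nV.
  exists (W `&` V i); split=> // j; rewrite inE => /orP[/eqP -> x []//|/sW h].
  by move=> x [/h].
by exists W; split=> // i; apply: sW; rewrite mem_enum.
Qed.

Section Iterates.
Context (k : fieldType) (Z : funspace k).

Lemma dominant_rational_comp (A B C : funspace k) (g : ratrep B C) (f : ratrep A B) :
  dominant_rational f -> dominant_rational g -> dominant_rational (Defs.pcomp g f).
Proof.
move=> [mf df] [mg dg]; split; first exact: morphism_on_comp.
move=> O oO nO; have [oO' _] := mg _ oO.
have [x [fx [gx Ox]]] := df _ oO' (dg _ oO nO).
by exists x.
Qed.

Lemma dominant_rational_id : dominant_rational (pid Z).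
Proof.
split; first exact: morphism_on_id.
by move=> O oO [x Ox]; exists x.
Qed.

Definition ratpow (s : ratrep Z Z) n := iter n (Defs.pcomp s) (pid Z).

Lemma ratpow_dominant (s : ratrep Z Z) n : dominant_rational s ->
  dominant_rational (ratpow s n).
Proof.
move=> ds; elim: n => [|n IH]; first exact: dominant_rational_id.
exact: dominant_rational_comp.
Qed.

Lemma fn_ratpow (s : ratrep Z Z) n x : fn (ratpow s n) x = iter n (fn s) x.
Proof. by elim: n => //= n <-. Qed.

End Iterates.

Lemma isrep_iter (k : closedFieldType) (Z : irrvariety k) (s : ratrep Z Z)
    (theta : {rmorphism funfield Z -> funfield Z}) l U g n :
  (forall l U g, isrep l U g ->
      isrep (theta l) (dom s `&` fn s @^-1` U) (g \o fn s)) ->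
  isrep l U g ->
  isrep (iter n theta l) (dom (ratpow s n) `&` fn (ratpow s n) @^-1` U)
    (g \o fn (ratpow s n)).
Proof.
move=> H; elim: n l U g => [|n IH] l U g r /=.
  by rewrite setTI.
by rewrite -/(iter n.+1 theta l) iterSr -setIA; apply: (IH _ _ _ (H _ _ _ r)).
Qed.

(** * The two sides of the action law, as morphisms on a common open domain *)

Section ActionLaw.
Context (k : closedFieldType) (Z : irrvariety k).
Local Notation GZ := (prod_space (Ga k) Z).
Local Notation T := (prod_space (Ga k) GZ).

Lemma morphism_compT (A B C : funspace k) (f : A -> B) (g : B -> C) :
  morphism_on setT f -> morphism_on setT g -> morphism_on setT (g \o f).
Proof.
by move=> mf mg; have := morphism_on_comp mf mg; rewrite preimage_setT setIT.
Qed.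

Definition add_first (p : T) : GZ := (Ga_add p.1 p.2.1, p.2.2).

Lemma morphism_add_first : morphism_on [set: T] add_first.
Proof.
have m1 : morphism_on [set: T] fst := @morphism_on_fst _ _ _.
have m2 : morphism_on [set: T] snd := @morphism_on_snd _ _ _.
apply: morphism_on_pair; last exact: (morphism_compT m2 (@morphism_on_snd _ _ _)).
have m21 := morphism_compT m2 (@morphism_on_fst _ _ _).
exact: (morphism_compT (morphism_on_pair m1 m21) (@morphism_Ga_add k)).
Qed.

Section Law.
Context (a : ratrep GZ Z) (ma : morphism_on (dom a) (fn a)).

Definition act_second (p : T) : GZ := (p.1, fn a p.2).

Definition law_dom : set T :=
  add_first @^-1` dom a `&` (snd @^-1` dom a `&` act_second @^-1` dom a).

Lemma morphism_act_second : morphism_on (snd @^-1` dom a : set T) act_second.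
Proof.
have ma2 : morphism_on (snd @^-1` dom a : set T) (fun p => fn a p.2).
  by have := morphism_on_comp (@morphism_on_snd _ (Ga k) GZ) ma; rewrite setTI.
apply: (morphism_on_pair _ ma2).
apply: (morphism_on_sub _ _ (@morphism_on_fst _ _ _)) => //.
exact: (morphism_on_open ma2).
Qed.

Lemma law_morphisms : morphism_on law_dom (fn a \o add_first) /\
  morphism_on law_dom (fn a \o act_second).
Proof.
have m1 : morphism_on (add_first @^-1` dom a) (fn a \o add_first).
  by have := morphism_on_comp morphism_add_first ma; rewrite setTI.
have m2 := morphism_on_comp morphism_act_second ma.
have oE := openI (morphism_on_open m1) (morphism_on_open m2).
by split; [apply: (morphism_on_sub oE _ m1)|apply: (morphism_on_sub oE _ m2)] => z [].
Qed.

Lemma law_dom_open : open law_dom.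
Proof. exact: morphism_on_open law_morphisms.1. Qed.

Lemma law_disagree_open : open (law_dom `&`
  [set p | fn a (add_first p) <> fn a (act_second p)]).
Proof.
by have [m1 m2] := law_morphisms; apply: open_disagree m1 m2; apply: irr_separated.
Qed.

End Law.
End ActionLaw.

(** * A rational action determined by the iterates of a transformation *)

Section ActionFromIterates.
Context (k : closedFieldType) (k0 : [pchar k] =i pred0) (Z : irrvariety k).
Context (s : ratrep Z Z) (ds : dominant_rational s).
Context (a : ratrep (prod_space (Ga k) Z) Z).
Hypothesis ma : morphism_on (dom a) (fn a).
Hypothesis aP : forall n, (0 < n)%N -> exists A : set Z, [/\ open A, A !=set0 &
  forall y, A y -> [/\ dom a (ga n%:R, y), dom (ratpow s n) y &
    fn a (ga n%:R, y) = fn (ratpow s n) y]].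

Let irrZ := irr_irreducible Z.
Let irrGZ := prod_irreducible (Ga_irreducible k0) irrZ.
Let irrGGZ := prod_irreducible (Ga_irreducible k0) irrGZ.

Lemma slice_meet (B : funspace k) (O : set (prod_space (Ga k) B)) :
  open O -> O !=set0 -> exists n, [/\ (0 < n)%N,
    open [set b : B | O (ga n%:R, b)] & [set b : B | O (ga n%:R, b)] !=set0].
Proof.
move=> oO nO; have [N HN] := slice_eventually k0 oO nO.
by exists (maxn N 1); rewrite leq_maxr; have [] := HN _ (leq_maxl N 1).
Qed.

(** At integer parameters the action law is the addition of exponents of iterates; what remains is
    to find an open set where all the terms are defined. *)
Lemma iterate_meet n m : (0 < n)%N -> (0 < m)%N -> exists A : set Z,
  [/\ open A, A !=set0 & forall y, A y ->
    [/\ dom a (ga m%:R, y), dom a (ga (n + m)%:R, y),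
        dom a (ga n%:R, fn a (ga m%:R, y)) &
        fn a (ga n%:R, fn a (ga m%:R, y)) = fn a (ga (n + m)%:R, y)]].
Proof.
move=> n0 m0; have nm0 : (0 < n + m)%N by rewrite addn_gt0 n0.
have [A [oA nA HA]] := aP n0; have [B [oB nB HB]] := aP m0.
have [C [oC nC HC]] := aP nm0.
have [mm dm] := ratpow_dominant m ds.
have [oD _] := mm _ oA; have nD := dm _ oA nA.
have [oI nI] := irrI oB oC nB nC; have [oJ nJ] := irrI oI oD nI nD.
exists (B `&` C `&` (dom (ratpow s m) `&` fn (ratpow s m) @^-1` A)).
split=> // y [[By Cy] [_ Ay]].
have [bd _ bE] := HB _ By; have [cd _ cE] := HC _ Cy.
have [ad _ aE] := HA _ Ay.
by rewrite bE; split=> //; rewrite aE cE !fn_ratpow iterD.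
Qed.

Lemma action_dom_neq0 : dom a !=set0.
Proof. by have [A [_ [y Ay] H]] := aP (ltn0Sn 0); have [] := H _ Ay; exists (ga 1, y). Qed.

Lemma action_rational : rational_map a.
Proof.
have oD := morphism_on_open ma; split=> //.
exact: irreducible_dense irrGZ oD action_dom_neq0.
Qed.

Lemma morphism_pshear : morphism_on (dom a) (fn (pshear a)).
Proof.
apply: morphism_on_pair => //.
apply: morphism_on_sub (morphism_on_open ma) _ (@morphism_on_fst _ _ _).
by [].
Qed.

(** On the slice over a positive integer n the shear is the n-th iterate, which is dominant. *)
Lemma pshear_dominant : rat_dominant (pshear a).
Proof.
move=> O nO oO; have [n [n0 oOn nOn]] := slice_meet oO nO.
have [A [oA nA HA]] := aP n0.
have [mn dn] := ratpow_dominant n ds.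
have [oD _] := mn _ oOn; have nD := dn _ oOn nOn.
have [_ [y [Ay [_ Oy]]]] := irrI oA oD nA nD.
have [ad _ aE] := HA _ Ay.
by exists (ga n%:R, fn a (ga n%:R, y)); split; [rewrite aE|exists (ga n%:R, y)].
Qed.

(** By separatedness the law fails on an open set. If that set were nonempty, two successive
    slicings would give positive integers n and m at which it fails on a nonempty open of [Z], where
    the iterates satisfy it. *)
Lemma action_law : @Defs.rat_eq k (prod_space (Ga k) (prod_space (Ga k) Z)) Z
        (RatRep [set p | dom a (Ga_add p.1 p.2.1, p.2.2)]
              (fun p => fn a (Ga_add p.1 p.2.1, p.2.2)))
        (RatRep [set p | dom a p.2 /\ dom a (p.1, fn a p.2)]
              (fun p => fn a (p.1, fn a p.2))).
Proof.
have oE := law_dom_open ma.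
have nE : law_dom a !=set0.
  have [A [_ [y Ay] H]] := iterate_meet (ltn0Sn 0) (ltn0Sn 0).
  have [d1 d2 d3 _] := H _ Ay.
  exists (ga 1, (ga 1, y)); split; last by split.
  by rewrite /add_first /= ga_add; move: d2; rewrite natrD.
exists (law_dom a); split=> //.
  exact: irreducible_dense irrGGZ oE nE.
move=> p Ep /=; apply: contrapT => ne.
have oD := law_disagree_open ma.
have nD : law_dom a `&` [set p | fn a (add_first p) <> fn a (act_second a p)] !=set0.
  by exists p.
have [n [n0 oDn nDn]] := slice_meet oD nD.
have [m [m0 oDm nDm]] := slice_meet oDn nDn.
have [A [oA nA HA]] := iterate_meet n0 m0.
have [_ [y [[_ /= ney] /HA[d1 d2 d3 eq]]]] := irrI oDm oA nDm nA.
by apply: ney; rewrite /add_first /act_second /= eq ga_add -natrD.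
Qed.

Lemma action_from_iterates : rational_action a /\ induced_by a (ga 1) s.
Proof.
have ra := action_rational; split.
  split=> //; last exact: action_law.
  split; last exact: pshear_dominant.
  by case: ra => oD dD _; split=> //; apply: morphism_pshear.
exists a; split=> //; first exact: rat_eq_refl.
have [A [oA nA HA]] := aP (ltn0Sn 0); exists A; split=> //.
- exact: irreducible_dense irrZ oA nA.
- by move=> y /HA[d1 [_ d2] _].
- by move=> y /HA[_ _ ].
Qed.

End ActionFromIterates.

Section InterpolableUnipotent.
Context (k : closedFieldType) (k0 : [pchar k] =i pred0) (Z : irrvariety k).
Context (s : ratrep Z Z) (ds : dominant_rational s).
Context (theta : {rmorphism funfield Z -> funfield Z}).
Hypothesis thetaP : forall l U g, isrep l U g ->
  isrep (theta l) (dom s `&` fn s @^-1` U) (g \o fn s).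

(** The interpolating fractions of the coordinates of one affine chart are read as the coordinates
    of the action map, with the parameter of the additive group in place of n. The transformation is
    then the image of 1. *)
Lemma interpolable_unipotent : (forall l, interpolable theta l) -> unipotent s.
Proof.
move=> interp; have [z0 _] := irrT Z.
have [U [m [x [Uz0 cx]]]] := irr_affine_coords z0.
have oU := coords_open cx; have nU : U !=set0 by exists z0.
have /choice[xi xiP] : forall i, exists l, isrep l U (x i).
  by move=> i; exact: isrep_intro oU nU (coords_reg cx i).
have /choice[p /choice[q pqP]] := fun i => interp (xi i).
have /choice[VP /choice[P HP]] := fun i => isprep_exists (p i).
have /choice[VQ /choice[Q HQ]] := fun i => isprep_exists (q i).
have [V1 [oV1 nV1 sV1]] : exists W, [/\ open W, W !=set0 & forall i, W `<=` VP i].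
  by apply: finite_meet => i; have [] := HP i.
have [V2 [oV2 nV2 sV2]] : exists W, [/\ open W, W !=set0 & forall i, W `<=` VQ i].
  by apply: finite_meet => i; have [] := HQ i.
have [oV nV] := irrI oV1 oV2 nV1 nV2; set V := V1 `&` V2 in oV nV.
have {}HP i : isprep (p i) V (P i) by apply: isprep_sub (HP i) => // y [/sV1].
have {}HQ i : isprep (q i) V (Q i) by apply: isprep_sub (HQ i) => // y [_ /sV2].
pose GZ := prod_space (Ga k) Z.
pose c i (z : GZ) := (P i z.2).[ga_val z.1] / (Q i z.2).[ga_val z.1].
(* The product of all denominators: [D] is where every coordinate fraction is defined. *)
pose R (z : GZ) := \prod_(i <- enum 'I_m) (Q i z.2).[ga_val z.1].
pose D : set GZ := snd @^-1` V `&` [set z | R z != 0].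
have oV' : open (snd @^-1` V : set GZ).
  exact: morphism_on_preimage (@morphism_on_snd _ _ _) oV.
have rQ i := isprep_reg (HQ i); have rP i := isprep_reg (HP i).
have rR : reg (snd @^-1` V : set GZ) R.
  by apply: reg_prod => // i; apply: rQ.
have oD : open D by apply: reg_open.
have DQ z i : D z -> (Q i z.2).[ga_val z.1] != 0.
  by case=> _; rewrite /= /R prodf_seq_neq0 => /allP /(_ i); rewrite mem_enum => /(_ isT).
have rc i : reg D (c i).
  apply: reg_res (reg_div oV' (rP i) (rQ i)) => //; first exact: reg_open.
  by move=> z Dz; split; [case: Dz|apply: DQ].
have AP n : (0 < n)%N -> exists A : set Z, [/\ open A, A !=set0 &
    forall y, A y -> [/\ D (ga n%:R, y), dom (ratpow s n) y,
      U (fn (ratpow s n) y) &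
      forall i, c i (ga n%:R, y) = x i (fn (ratpow s n) y)]].
  move=> n0; have nE : n%:R = ffcst Z n%:R by rewrite rmorph_nat.
  have rQn i : isrep (q i).[n%:R] V (fun y => (Q i y).[n%:R]).
    by rewrite nE; apply: isprep_horner.
  have rPn i : isrep (p i).[n%:R] V (fun y => (P i y).[n%:R]).
    by rewrite nE; apply: isprep_horner.
  have [B [oB nB sB]] : exists W, [/\ open W, W !=set0 &
      forall i, W `<=` V `&` [set y | (Q i y).[n%:R] != 0]].
    apply: finite_meet => i; have [q0 _] := pqP i n n0.
    split; last exact: isrep_nonzero (rQn i) q0.
    exact: reg_open (isrep_reg (rQn i)).
  have [mn dn] := ratpow_dominant n ds.
  have [oC _] := mn _ oU; have nC := dn _ oU nU.
  have [oI nI] := irrI oB oC nB nC; have [oJ nJ] := irrI oV oI nV nI.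
  exists (V `&` (B `&` (dom (ratpow s n) `&` fn (ratpow s n) @^-1` U))).
  split=> // y [Vy [By [dy Uy]]].
  have Qy i : (Q i y).[n%:R] != 0 by have [] := sB i _ By.
  split=> //.
    split=> //=; rewrite /R prodf_seq_neq0; apply/allP => i _ /=.
    by rewrite gaK Qy.
  move=> i; rewrite /c /= gaK; apply: (canLR (mulfK (Qy i))).
  have := isrepM (rQn i) (isrep_iter n thetaP (xiP i)).
  have [_ <-] := pqP i n n0 => r'.
  by rewrite (isrep_agree (rPn i) r') // mulrC.
pose a : ratrep GZ Z := RatRep D (fun z => xget z0 [set u | U u /\ forall i, x i u = c i z]).
have aD z : D z -> U (fn a z) /\ forall i, x i (fn a z) = c i z.
  move=> Dz; have [] // := @xgetPex _ z0 [set u | U u /\ forall i, x i u = c i z].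
  (* The fractions must satisfy every relation [e] of the chart. If [e] were nonzero somewhere on
     [D], it would be so on a slice over a positive integer, where the fractions are coordinates of
     an actual point of [U]. *)
  apply: (coords_complete cx) => e He; apply/eqP/negPn/negP => nz.
  have re : reg D (fun z => pev id (c^~ z) e) by apply: reg_pev.
  have oe := reg_open oD re.
  have [n [n0 oO nO]] := slice_meet k0 oe (ex_intro _ z (conj Dz nz)).
  have [A [oA nA HA]] := AP n n0.
  have [_ [y [[_ /= ny] /HA[_ _ Uy cy]]]] := irrI oO oA nO nA.
  move/eqP: ny; apply; rewrite -[RHS](He _ Uy); congr (pev _ _ _).
  by apply/funext => i; apply: cy.
have ma : morphism_on (dom a) (fn a).
  apply: (morphism_on_coords cx oD) => [z /aD[]//|i].
  by apply: reg_ext (rc i) => // z /aD[_ /(_ i) <-].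
have aP n : (0 < n)%N -> exists A : set Z, [/\ open A, A !=set0 &
    forall y, A y -> [/\ dom a (ga n%:R, y), dom (ratpow s n) y &
    fn a (ga n%:R, y) = fn (ratpow s n) y]].
  move=> n0; have [A [oA nA HA]] := AP n n0; exists A; split=> // y /HA[Dy dy Uy cy].
  split=> //; have [Ua xa] := aD _ Dy.
  by apply: (coords_inj cx Ua Uy) => i; rewrite xa cy.
by exists a, (ga 1); apply: action_from_iterates.
Qed.

End InterpolableUnipotent.

(** * From unipotence to interpolation *)

Section Fractions.
Context (k : closedFieldType) (k0 : [pchar k] =i pred0) (Z : irrvariety k).
Local Notation GZ := (prod_space (Ga k) Z).

Let irrGZ := prod_irreducible (Ga_irreducible k0) (irr_irreducible Z).

Let meet (A B : set GZ) : open A -> open B -> A !=set0 -> B !=set0 ->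
  open (A `&` B) /\ A `&` B !=set0.
Proof. by move=> oA oB nA nB; split; [apply: openI|apply: irrGZ.2]. Qed.

Let open2 (V : set Z) : open V -> open (snd @^-1` V : set GZ).
Proof. exact: morphism_on_preimage (@morphism_on_snd _ _ _). Qed.

(* On a dense open set, [h] is the quotient of [p] by [q], seen as rational
   functions on the product of the additive group and [Z]. *)
Definition hasfrac (h : GZ -> k) (p q : {poly funfield Z}) : Prop :=
  exists (V : set Z) (P Q : Z -> {poly k}) (O : set GZ), [/\ @isprep k Z p V P, @isprep k Z q V Q,
    open O /\ O !=set0 & forall z, O z -> V z.2 /\
      h z * (Q z.2).[ga_val z.1] = (P z.2).[ga_val z.1]].

Lemma isprep_pair (p q : {poly funfield Z}) V P V' Q :
  @isprep k Z p V P -> @isprep k Z q V' Q ->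
  @isprep k Z p (V `&` V') P /\ @isprep k Z q (V `&` V') Q.
Proof.
move=> r r'; have [oV nV _] := r; have [oV' nV' _] := r'.
have [oI nI] := irrI oV oV' nV nV'.
by split; [apply: isprep_sub r|apply: isprep_sub r'].
Qed.

Lemma hasfrac_add f g p q p' q' : hasfrac f p q -> hasfrac g p' q' ->
  hasfrac (fun z => f z + g z) (p * q' + p' * q) (q * q').
Proof.
move=> [V [P [Q [O [rP rQ [oO nO] E]]]]] [V' [P' [Q' [O' [rP' rQ' [oO' nO'] E']]]]].
have rn := isprepD (isprepM rP rQ') (isprepM rP' rQ).
have rd := isprepM rQ rQ'; have [rn' rd'] := isprep_pair rn rd.
have [oI nI] := meet oO oO' nO nO'.
eexists _, _, _, (O `&` O'); split; [exact: rn'|exact: rd'|by []|].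
move=> z [/E[Vz Ez] /E'[Vz' Ez']]; split; first by [].
rewrite hornerD !hornerM -Ez -Ez' mulrDl; congr (_ + _); first by rewrite mulrA.
by rewrite mulrA mulrAC.
Qed.

Lemma hasfrac_mul f g p q p' q' : hasfrac f p q -> hasfrac g p' q' ->
  hasfrac (fun z => f z * g z) (p * p') (q * q').
Proof.
move=> [V [P [Q [O [rP rQ [oO nO] E]]]]] [V' [P' [Q' [O' [rP' rQ' [oO' nO'] E']]]]].
have rn := isprepM rP rP'.
have rd := isprepM rQ rQ'; have [rn' rd'] := isprep_pair rn rd.
have [oI nI] := meet oO oO' nO nO'.
eexists _, _, _, (O `&` O'); split; [exact: rn'|exact: rd'|by []|].
move=> z [/E[Vz Ez] /E'[Vz' Ez']]; split; first by [].
by rewrite !hornerM -Ez -Ez' mulrACA.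
Qed.

(** A function of the parameter is a quotient of polynomials with constant coefficients; a function
    on [Z] is a constant polynomial over 1. *)
Lemma hasfrac_gen D h z0 : chart (prod_data (Ga k) Z) D -> D z0 ->
  gens (prod_data (Ga k) Z) D h -> exists p q, q != 0 /\ hasfrac h p q.
Proof.
move=> hD Dz0 [U [V [oU oV ED H]]].
have oD : open (D : set GZ) by apply: open_chart.
have nD : (D : set GZ) !=set0 by exists z0.
have [Uz Vz] : U z0.1 /\ V z0.2 by rewrite ED in Dz0.
have nV : V !=set0 by exists z0.2.
case: H => -[f rf ->].
  have [a [e [ez H]]] := affine_regP oU rf Uz.
  have [A HA] := pev_ga a; have [E HE] := pev_ga e.
  exists (map_poly (ffcst Z) A), (map_poly (ffcst Z) E); split.
    rewrite map_poly_eq0; apply: contraNneq ez => E0.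
    by rewrite HE E0 horner0.
  have oU' : open (D `&` (fst @^-1` [set t : Ga k | E.[ga_val t] != 0]) : set GZ).
    apply: openI => //; apply: (morphism_on_preimage (@morphism_on_fst _ _ _)).
    have := reg_open openT (@reg_pev _ (Ga k) setT _ e (fun i v => (v : 'rV_1) ord0 i)
      openT (fun i => @reg_coord k 1 i)).
    by rewrite setTI; under [in X in open X]eq_fun do rewrite HE.
  eexists setT, _, _, _; split; [exact: isprep_cst|exact: isprep_cst|split|].
  - exact: oU'.
  - by exists z0; split=> //=; rewrite -HE.
  - move=> z [_ /= Ez]; split=> //.
    have [|_ ->] := H z.1; first by rewrite HE.
    by rewrite HE HA divfK.
have [l rl] := isrep_intro oV nV rf.
exists l%:P, 1; split; first exact: oner_neq0.
have r1 : isprep (1 : {poly funfield Z}) V (fun=> 1).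
  have := isprepC (isrep1 Z) => /(isprep_sub oV nV (@subsetT _ _)).
  by rewrite !polyC1.
exists V, (fun x => (f x)%:P), (fun=> 1), (D : set GZ); split=> //; first exact: isprepC.
by move=> z Dz; rewrite ED in Dz; case: Dz => _ Vz'; rewrite !hornerC mulr1.
Qed.

Lemma hasfrac_kalg D h z0 : chart (prod_data (Ga k) Z) D -> D z0 ->
  kalg (gens (prod_data (Ga k) Z) D) h -> exists p q, q != 0 /\ hasfrac h p q.
Proof.
move=> hD Dz0; elim=> [c|g hg|f g _ [p [q [q0 H]]] _ [p' [q' [q'0 H']]]
    |f g _ [p [q [q0 H]]] _ [p' [q' [q'0 H']]]].
- exists (ffcst Z c)%:P, 1; split; first exact: oner_neq0.
  exists setT, (fun=> c%:P), (fun=> 1), setT; split.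
  + exact: isprepC (isrep_cst _ _).
  + by have := isprepC (isrep1 Z); rewrite !polyC1.
  + by split; [exact: openT|exists z0].
  + by move=> z _; rewrite !hornerC mulr1.
- exact: hasfrac_gen hD Dz0 hg.
- exists (p * q' + p' * q), (q * q'); rewrite mulf_neq0 //.
  by split=> //; apply: hasfrac_add.
- exists (p * p'), (q * q'); rewrite mulf_neq0 //.
  by split=> //; apply: hasfrac_mul.
Qed.

(** A local expression of [h] as a quotient gives the fraction. The cross-multiplied identity then
    spreads by density to all of [O] above [V], including points where the denominator vanishes,
    which is what allows evaluation at a prescribed parameter. *)
Lemma coprime_fraction_of_reg (O : set GZ) h : open O -> O !=set0 -> reg O h ->
  exists (p q : {poly funfield Z}) (V : set Z) (P Q : Z -> {poly k}),
    [/\ @isprep k Z p V P, @isprep k Z q V Q, coprimep p q, q != 0 &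
    forall z, O z -> V z.2 -> h z * (Q z.2).[ga_val z.1] = (P z.2).[ga_val z.1]].
Proof.
move=> oO nO rh; have [z0 Oz0] := nO.
have [D [f1 [f2 [hD h1 h2 [Dz0 fz0] E]]]] := rh _ Oz0.
have [p1 [q1 [q1n [V1 [P1 [Q1 [O1 [rP1 rQ1 [oO1 nO1] E1]]]]]]]] := hasfrac_kalg hD Dz0 h1.
have [p2 [q2 [q2n [V2 [P2 [Q2 [O2 [rP2 rQ2 [oO2 nO2] E2]]]]]]]] := hasfrac_kalg hD Dz0 h2.
have oD := reg_open (open_chart hD) (reg_kalg hD h2).
have nD : (D `&` [set z | f2 z != 0] : set GZ) !=set0 by exists z0.
have p2n : p2 != 0.
  have [oI nI] := meet oD oO2 nD nO2.
  apply: contraNneq q2n => p20; apply/eqP.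
  apply: (isprep_eq0 k0 rQ2 oI nI) => z [[_ /= f2z] /E2[Vz Ez]] _.
  apply/eqP; rewrite -(mulrI_eq0 _ (mulfI f2z)) Ez.
  have r0 : isprep p2 V2 (fun=> 0).
    have [oV nV _] := rP2; rewrite p20; split=> // i; rewrite !coef0.
    exact: isrep_sub (isrep0 Z).
  by rewrite (isprep_agree rP2 r0 Vz Vz) horner0.
have [p [q [d [Ep Eq dn cp]]]] := coprime_fraction (p1 * q2) (mulf_neq0 p2n q1n).
have qn : q != 0.
  by apply: contraTneq (mulf_neq0 p2n q1n) => q0; rewrite Eq q0 mul0r eqxx.
have [Vp [P rP]] := isprep_exists p; have [Vq [Q rQ]] := isprep_exists q.
have [Vd [W rW]] := isprep_exists d.
have [rP' rQ'] := isprep_pair rP rQ; set V := Vp `&` Vq in rP' rQ'.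
have [oV nV _] := rP'; have [oVd nVd _] := rW.
exists p, q, V, P, Q; split=> //.
have oOV : open (O `&` (snd @^-1` V : set GZ)) by apply: openI => //; apply: open2.
have rhQ : reg (O `&` (snd @^-1` V : set GZ)) (fun z => h z * (Q z.2).[ga_val z.1]).
  apply: regM => //; first exact: reg_res rh.
  by apply: reg_res (isprep_reg rQ') => //; apply: open2.
have rPP : reg (O `&` (snd @^-1` V : set GZ)) (fun z => (P z.2).[ga_val z.1]).
  by apply: reg_res (isprep_reg rP') => //; apply: open2.
(* [W] represents the common factor removed from the fraction; the identity is checked where it is
   nonzero, so that it can be cancelled. *)
have oW := reg_open (open2 oVd) (isprep_reg rW).
have nW : (snd @^-1` Vd : set GZ) `&` [set z | (W z.2).[ga_val z.1] != 0] !=set0.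
  apply: contrapT => H; move/eqP: dn; apply.
  have [x Vdx] := nVd.
  apply: (isprep_eq0 k0 rW (open2 oVd)); first by exists (ga 0, x).
  move=> z Vz _; apply/eqP/negPn/negP => nz; apply: H; by exists z.
have [oI1 nI1] := meet oO1 oO2 nO1 nO2.
have [oI2 nI2] := meet oI1 oD nI1 nD.
have [oI3 nI3] := meet oI2 oW nI2 nW.
move=> z Oz Vz.
apply: (reg_eq_irr irrGZ oOV oI3 nI3 rhQ rPP _ (conj Oz Vz)) => y [Oy Vy].
move=> [[[/E1[V1y E1y] /E2[V2y E2y]] [Dy /= f2y]] [Vdy /= Wy]].
apply: (mulIf Wy); rewrite -mulrA -!hornerM.
have rEP := isprepM rP' rW; rewrite -Ep in rEP.
have rEQ := isprepM rQ' rW; rewrite -Eq in rEQ.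
have eP := isprep_agree (isprepM rP1 rQ2) rEP (conj V1y V2y) (conj Vy Vdy).
have eQ := isprep_agree (isprepM rP2 rQ1) rEQ (conj V2y V1y) (conj Vy Vdy).
rewrite -eP -eQ !hornerM -E1y -E2y E // mulrA mulrA divfK //.
by rewrite mulrAC.
Qed.

End Fractions.

Section LawTransfer.
Context (k : closedFieldType) (k0 : [pchar k] =i pred0) (Z : irrvariety k).
Local Notation GZ := (prod_space (Ga k) Z).
Local Notation T := (prod_space (Ga k) GZ).

Let irrGZ := prod_irreducible (Ga_irreducible k0) (irr_irreducible Z).
Let irrT3 := prod_irreducible (Ga_irreducible k0) irrGZ.

(* The action law is an identity between rational maps, hence it holds for every
   representative, at all points where both sides are defined. *)
Lemma law_everywhere (a b : ratrep GZ Z) : rational_action a -> rational_map b ->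
  Defs.rat_eq a b ->
  forall p, law_dom b p -> fn b (add_first p) = fn b (act_second b p).
Proof.
move=> [[oda dda ma] [_ dsh] [W [oW dW sW eW]]] [odb ddb mb] [A [oA dA sA eA]] p Dp.
apply: contrapT => ne.
have nT : [set: T] !=set0 by exists p.
have nGZ : [set: GZ] !=set0 by exists p.2.
have nA := dense_nonempty nGZ dA; have nW := dense_nonempty nT dW.
have oD := law_disagree_open mb.
have nD : law_dom b `&` [set p | fn b (add_first p) <> fn b (act_second b p)] !=set0.
  by exists p.
have oA1 : open (@add_first k Z @^-1` A).
  exact: morphism_on_preimage (@morphism_add_first k Z) oA.
have nA1 : (@add_first k Z @^-1` A) !=set0.
  have [[t y] Aty] := nA; exists (ga 0, (t, y)); rewrite /add_first /=.
  by rewrite (_ : Ga_add (ga 0) t = t) // -[LHS]ga_valK ga_valD gaK add0r ga_valK.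
have oA2 : open (snd @^-1` A : set T).
  exact: morphism_on_preimage (@morphism_on_snd _ _ _) oA.
have nA2 : (snd @^-1` A : set T) !=set0.
  by have [z Az] := nA; exists (ga 0, z).
have [oA3 _] := morphism_act_second ma oA.
(* Here dominance of the shear is used: it provides [z] with [fn a z] in the slice of [A] at [t],
   and the outer parameter can then be chosen equal to [t]. *)
have nA3 : (snd @^-1` dom a `&` act_second a @^-1` A : set T) !=set0.
  have [[t y] Aty] := nA.
  pose Y : set Z := [set y | A (t, y)].
  have oY : open Y by apply: (morphism_on_preimage (morphism_slice_r t)).
  have oY' : open (snd @^-1` Y : set GZ).
    exact: morphism_on_preimage (@morphism_on_snd _ _ _) oY.
  have [|w [Yw [z az E]]] := dsh (snd @^-1` Y : set GZ) _ oY'.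
    by exists (t, y).
  by rewrite -E in Yw; exists (t, z).
have irr (U V : set T) : open U -> open V -> U !=set0 -> V !=set0 ->
    open (U `&` V) /\ U `&` V !=set0.
  by move=> oU oV nU nV; split; [apply: openI|apply: irrT3.2].
have [o1 n1] := irr _ _ oD oW nD nW.
have [o2 n2] := irr _ _ o1 oA1 n1 nA1.
have [o3 n3] := irr _ _ o2 oA2 n2 nA2.
have [_ [q [[[[[_ ney] Wq] A1q] A2q] [_ A3q]]]] := irr _ _ o3 oA3 n3 nA3.
apply: ney; have E2 : fn a q.2 = fn b q.2 by apply: eA.
have E3 : act_second a q = act_second b q by rewrite /act_second E2.
rewrite -(eA _ A1q) -E3 -(eA _ A3q).
exact: eW.
Qed.

End LawTransfer.

Section UnipotentInterpolable.
Context (k : closedFieldType) (k0 : [pchar k] =i pred0) (Z : irrvariety k).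
Context (s : ratrep Z Z) (ds : dominant_rational s).
Context (theta : {rmorphism funfield Z -> funfield Z}).
Hypothesis thetaP : forall l U g, isrep l U g ->
  isrep (theta l) (dom s `&` fn s @^-1` U) (g \o fn s).
Local Notation GZ := (prod_space (Ga k) Z).

Let irrGZ := prod_irreducible (Ga_irreducible k0) (irr_irreducible Z).

Lemma theta_cst c : theta (ffcst Z c) = ffcst Z c.
Proof.
by apply: (isrep_eq (thetaP (isrep_cst Z c)) (isrep_cst Z c) openT (irrT Z)).
Qed.

(** The function sending (t, x) to the value of [l] at t.x is a coprime fraction p / q in t over the
    function field. If s is the action of g, then (t + g).x = t.(s x) becomes a functional equation
    relating p and q to their conjugates by [theta]. It propagates the value [theta l] at g to the
    values [iter n theta l] at n g. *)
Lemma unipotent_interpolable l : unipotent s -> interpolable theta l.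
Proof.
move=> [a [g [ra [b [rb eab [Ws [oWs dWs sWs eWs]]]]]]].
have [odb ddb mb] := rb.
have law := law_everywhere k0 ra rb eab.
have nWs := dense_nonempty (irrT Z) dWs.
have [ms dsO] := ds; have ods := morphism_on_open ms.
have [V0 [f0 rl]] : exists V0 f0, isrep l V0 f0.
  by exists (gdom (repr l)), (gfun (repr l)); apply: isrep_repr.
have oV0 := isrep_open rl; have nV0 := isrep_neq0 rl.
pose O : set GZ := dom b `&` fn b @^-1` V0.
have [oO rO] := mb _ oV0; have rf := rO _ (isrep_reg rl).
have oVs : open (dom s `&` fn s @^-1` V0) by have [] := ms _ oV0.
have nVs := dsO _ oV0 nV0.
have nO : O !=set0.
  have [_ [x [Wx [sx Vx]]]] := irrI oWs oVs nWs nVs.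
  have [/= bx _] := sWs _ Wx; exists (g, x); split=> //=.
  by have := eWs _ Wx => /= ->.
have [p [q [V [P [Q [rP rQ cpq q0 rel]]]]]] := coprime_fraction_of_reg k0 oO nO rf.
have [oV nV _] := rP.
set g0 := ga_val g; set G := ffcst Z g0.
have atg : p.[G] = q.[G] * theta l.
  have [oI nI] := irrI oWs oVs nWs nVs.
  apply: (isrep_eq (isprep_horner g0 rP) (isrepM (isprep_horner g0 rQ) (thetaP rl)) oI nI).
  move=> x [Wx [sx Vsx]] Vx _ /=.
  have [/= bx _] := sWs _ Wx; have /= Ex := eWs _ Wx.
  have Ogx : O (g, x) by split=> //=; rewrite Ex.
  by have /= := rel _ Ogx Vx; rewrite Ex mulrC => <-.
pose addg (z : GZ) : GZ := (Ga_add z.1 g, z.2).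
have maddg : morphism_on setT addg.
  apply: morphism_on_pair; last exact: morphism_on_snd.
  have m1 : morphism_on [set: GZ] fst := @morphism_on_fst _ _ _.
  exact: (morphism_compT (morphism_on_pair m1 (morphism_on_cst _ g)) (@morphism_Ga_add k)).
pose shs (z : GZ) : GZ := (z.1, fn s z.2).
have mshs : morphism_on (snd @^-1` dom s : set GZ) shs.
  have m2 : morphism_on (snd @^-1` dom s : set GZ) (fun z => fn s z.2).
    by have := morphism_on_comp (@morphism_on_snd _ (Ga k) Z) ms; rewrite setTI.
  apply: (morphism_on_pair _ m2).
  apply: (morphism_on_sub _ _ (@morphism_on_fst _ _ _)) => //.
  exact: (morphism_on_open m2).
have oB1 : open (addg @^-1` O) by apply: (morphism_on_preimage maddg).
have nB1 : addg @^-1` O !=set0.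
  have [[t x] Otx] := nO; exists (ga (ga_val t - g0), x); rewrite /addg /=.
  rewrite (_ : Ga_add _ g = t) //.
  by rewrite -[LHS]ga_valK ga_valD gaK subrK ga_valK.
have [oB2 _] := mshs _ oO.
have nB2 : (snd @^-1` dom s `&` shs @^-1` O : set GZ) !=set0.
  have [[t y] Oty] := nO.
  have oY : open [set y | O (t, y)] by apply: (morphism_on_preimage (morphism_slice_r t)).
  have [|x [dx Ox]] := dsO _ oY; first by exists y.
  by exists (t, x).
have [oV' _] := ms _ oV; have nV' := dsO _ oV nV.
have [oI1 nI1] := irrI oWs oV nWs nV; have [oI nI] := irrI oI1 oV' nI1 nV'.
set I := Ws `&` V `&` _ in oI nI.
have oB3 : open (snd @^-1` I : set GZ).
  exact: morphism_on_preimage (@morphism_on_snd _ _ _) oI.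
have nB3 : (snd @^-1` I : set GZ) !=set0 by have [x Ix] := nI; exists (g, x).
have oB12 := openI oB1 oB2; have nB12 := irrGZ.2 _ _ oB1 oB2 nB1 nB2.
have oB := openI oB12 oB3; have nB := irrGZ.2 _ _ oB12 oB3 nB12 nB3.
have [N HN] := slice_eventually k0 oB nB.
pose shift := 'X + G%:P : {poly funfield Z}.
(* [theta] acts on coefficients only, replacing x by s x. Both sides are compared at large integers
   t = n, where the relation [rel] is available at (n + g, x) and at (n, s x). *)
have identity : (p \Po shift) * map_poly theta q = map_poly theta p * (q \Po shift).
  apply/eqP; rewrite -subr_eq0; apply/eqP.
  apply: (@poly_eq0_eventually _ (funfield_char0 Z k0) _ N) => n /HN[oS nS].
  have nE : n%:R = ffcst Z n%:R by rewrite rmorph_nat.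
  have mapE r : (map_poly theta r).[n%:R] = theta r.[n%:R].
    by rewrite -{1}(rmorph_nat theta n) horner_map.
  have shiftE r : (r \Po shift).[n%:R] = r.[ffcst Z (n%:R + g0)].
    by rewrite horner_comp hornerD hornerX hornerC rmorphD /= -nE.
  rewrite hornerD hornerN !hornerM !mapE !shiftE; apply/eqP; rewrite subr_eq0; apply/eqP.
  rewrite nE.
  apply: (isrep_eq (isrepM (isprep_horner _ rP) (thetaP (isprep_horner n%:R rQ)))
    (isrepM (thetaP (isprep_horner n%:R rP)) (isprep_horner _ rQ)) oS nS).
  move=> x [[O1 [_ O2]] [[Wx Vx] [sx Vsx]]] _ _ /=.
  have [/= bx _] := sWs _ Wx; have /= Ex := eWs _ Wx.
  have R1 := rel _ O1 Vx; have R2 := rel _ O2 Vsx.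
  have := law (ga n%:R, (g, x)); rewrite /add_first /act_second /= Ex => L.
  have {}L : fn b (Ga_add (ga n%:R) g, x) = fn b (ga n%:R, fn s x).
    apply: L; split; first by case: O1.
    by split=> //=; rewrite /act_second /= Ex; case: O2.
  move: R1 R2; rewrite /addg /shs /= L ga_valD gaK -/g0 => <- <-.
  by rewrite mulrAC.
(* The functional equation is evaluated at n G, a constant fixed by [theta]. Coprimality makes q(n
   G) nonzero, so its image by [theta] cancels. *)
have step n : p.[n%:R * G] = q.[n%:R * G] * iter n theta l ->
    p.[n.+1%:R * G] = q.[n.+1%:R * G] * iter n.+1 theta l.
  move=> IH; have qn := coprime_nonroot cpq IH.
  have thn : theta (n%:R * G) = n%:R * G by rewrite rmorphM rmorph_nat /= theta_cst.
  have mapE r : (map_poly theta r).[n%:R * G] = theta r.[n%:R * G].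
    by rewrite -{1}thn horner_map.
  have shiftE r : (r \Po shift).[n%:R * G] = r.[n.+1%:R * G].
    by rewrite horner_comp hornerD hornerX hornerC mulrSr mulrDl mul1r.
  have := congr1 (horner^~ (n%:R * G)) identity.
  rewrite !hornerM !mapE !shiftE IH rmorphM => E.
  have tq : theta q.[n%:R * G] != 0 by rewrite fmorph_eq0.
  apply: (mulIf tq); rewrite E /= [RHS]mulrC -mulrA; congr (_ * _).
  exact: mulrC.
have all n : p.[n.+1%:R * G] = q.[n.+1%:R * G] * iter n.+1 theta l.
  by elim: n => [|n IH]; [rewrite mul1r|apply: step].
(* Rescaling the variable by G turns the multiples of g into the integers; g = 0 is covered as
   well. *)
exists (p \Po ('X * G%:P)), (q \Po ('X * G%:P)) => -[//|n] _.
rewrite !horner_comp !hornerM !hornerX !hornerC.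
by split; [apply: coprime_nonroot cpq (all n)|apply: all].
Qed.

End UnipotentInterpolable.

(** * Points of the geometric generic fibre *)

Fixpoint pex_map (A B I : Type) (h : A -> B) (e : pex A I) : pex B I :=
  match e with
  | PCst c => PCst _ (h c)
  | PVar i => PVar _ i
  | PAdd a b => PAdd (pex_map h a) (pex_map h b)
  | PMul a b => PMul (pex_map h a) (pex_map h b)
  end.

Lemma pev_map (A B I : Type) (R : pzRingType) (h : A -> B) (g : B -> R)
    (v : I -> R) e : pev g v (pex_map h e) = pev (g \o h) v e.
Proof. by elim: e => //= a -> b ->. Qed.

Section PointOfChart.
Context (k K : closedFieldType) (kappa : {rmorphism k -> K}) (X : funspace k).
Context (U0 : set X) (m : nat) (x : 'I_m -> X -> k) (cx : affine_coords U0 x).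
Context (w : 'I_m -> K).
Hypothesis w_kill : forall P, (forall u, U0 u -> pev id (x^~ u) P = 0) ->
  pev kappa w P = 0.
Implicit Types (P Q R a b : pex k 'I_m).

(* By the Nullstellensatz, [w] specialises to closed points of the chart
   outside any given hypersurface not containing [w]. *)
Lemma closed_specialisation P : pev kappa w P != 0 ->
  exists u, [/\ U0 u, pev id (x^~ u) P != 0 &
    forall R, pev id (x^~ u) R != 0 -> pev kappa w R != 0].
Proof.
move=> /(field_specialisation (idfun : {rmorphism k -> k}))[c [kc Pc]].
have [u [Uu xu]] : exists u, U0 u /\ forall i, x i u = c i.
  by apply: (coords_complete cx) => e He; apply: kc; apply: w_kill.
have E : x^~ u = c by apply/funext.
exists u; rewrite E; split=> // R; apply: contra_neq => /kc.
by [].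
Qed.

(** The image of [w] in the scheme may be a non-closed point, so membership is replaced by
    containing a basic open of the chart whose equation is nonzero at [w]. *)
Definition pt_nb : set (set X) := [set W | open W /\ exists P,
  pev kappa w P != 0 /\ forall u, U0 u -> pev id (x^~ u) P != 0 -> W u].

(** The value at [w] of a function is that of any quotient expressing it on a basic open around
    [w]. *)
Definition pt_value (W : set X) (f : X -> k) : set K := [set c | exists a b,
  [/\ pev kappa w b != 0,
      forall u, U0 u -> pev id (x^~ u) b != 0 ->
        W u /\ f u = pev id (x^~ u) a / pev id (x^~ u) b &
      c = pev kappa w a / pev kappa w b]].

Lemma pt_value_exists W f : pt_nb W -> reg W f -> exists c, pt_value W f c.
Proof.
move=> [oW [P [wP sW]]] rf; have [u [Uu Pu spec]] := closed_specialisation wP.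
have [a [b [bu H]]] := coords_frac cx oW rf Uu (sW _ Uu Pu).
by exists (pev kappa w a / pev kappa w b), a, b; split=> //; apply: spec.
Qed.

Lemma pt_value_uniq W V f c d :
  pt_value W f c -> pt_value V f d -> c = d.
Proof.
move=> [a [b [wb Hb ->]]] [a' [b' [wb' Hb' ->]]].
(* The factor b b' makes the cross difference of the two expressions vanish on the whole chart, also
   where one of the quotients is undefined. *)
have := @w_kill (PMul (PAdd (PMul a b') (PMul (PCst _ (-1)) (PMul a' b))) (PMul b b')).
move=> /= H; have {}H : (pev kappa w a * pev kappa w b' -
    pev kappa w a' * pev kappa w b) * (pev kappa w b * pev kappa w b') = 0.
  rewrite -[RHS]H ?rmorphN ?rmorph1 ?mulN1r // => u Uu.
  have [->|bu] := eqVneq (pev id (x^~ u) b) 0; first by rewrite mul0r mulr0.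
  have [->|bu'] := eqVneq (pev id (x^~ u) b') 0; first by rewrite !mulr0.
  have [_ E] := Hb _ Uu bu; have [_ E'] := Hb' _ Uu bu'.
  rewrite (_ : pev id (x^~ u) a = f u * pev id (x^~ u) b); last by rewrite E divfK.
  rewrite (_ : pev id (x^~ u) a' = f u * pev id (x^~ u) b'); last by rewrite E' divfK.
  by rewrite mulN1r mulrAC subrr mul0r.
move/eqP: H; rewrite mulf_eq0 [X in _ || X]mulf_eq0 (negPf wb) (negPf wb') !orbF.
by rewrite subr_eq0 => /eqP E; apply/eqP; rewrite eqr_div // E.
Qed.

Definition pt_ev (W : set X) (f : X -> k) : K :=
  if pselect (pt_nb W /\ reg W f) then xget 0 (pt_value W f) else 0.

Lemma pt_evP W f : pt_nb W -> reg W f -> pt_value W f (pt_ev W f).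
Proof.
move=> nW rf; rewrite /pt_ev; case: pselect => [_|[]//] /=.
by have [c vc] := pt_value_exists nW rf; apply: (xgetPex 0); exists c.
Qed.

Lemma pt_ev_eq W f c : pt_nb W -> reg W f -> pt_value W f c -> pt_ev W f = c.
Proof.
by move=> nW rf vc; apply: (pt_value_uniq (pt_evP nW rf) vc).
Qed.

Lemma pt_nb_open : pt_nb `<=` open.
Proof. by move=> W []. Qed.

Lemma pt_nbI U V : pt_nb U -> pt_nb V -> pt_nb (U `&` V).
Proof.
move=> [oU [P [wP sP]]] [oV [Q [wQ sQ]]]; split; first exact: openI.
exists (PMul P Q) => /=; rewrite mulf_neq0 //; split=> // u Uu.
by rewrite mulf_eq0 negb_or => /andP[/(sP _ Uu) ? /(sQ _ Uu)].
Qed.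

Lemma pt_nb_up U V : pt_nb U -> open V -> U `<=` V -> pt_nb V.
Proof.
by move=> [oU [P [wP sP]]] oV sV; split=> //; exists P; split=> // u /sP H /H /sV.
Qed.

(** A closed point specialising [w] lies in some member of the family, and a basic neighbourhood of
    it in that member is also one of [w]. *)
Lemma pt_nb_prime (F : set (set X)) : F `<=` open ->
  pt_nb (\bigcup_(U in F) U) -> exists2 U, F U & pt_nb U.
Proof.
move=> oF [_ [P [wP sP]]]; have [u [Uu Pu spec]] := closed_specialisation wP.
have [W FW Wu] := sP _ Uu Pu; exists W => //; split; first exact: oF.
have [R [Ru sR]] := coords_nbhs cx (oF _ FW) Uu Wu.
by exists R; split=> //; apply: spec.
Qed.

Lemma pt_ev_junk U f : ~ (pt_nb U /\ reg U f) -> pt_ev U f = 0.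
Proof. by rewrite /pt_ev; case: pselect. Qed.

Lemma pt_ev_ext U f g : pt_nb U -> reg U f -> (forall x, U x -> f x = g x) ->
  pt_ev U f = pt_ev U g.
Proof.
move=> nU rf e; have rg := reg_ext (pt_nb_open nU) e rf.
apply: pt_ev_eq => //; have [a [b [wb H ->]]] := pt_evP nU rg.
by exists a, b; split=> // u Uu bu; have [Wu <-] := H _ Uu bu; rewrite e.
Qed.

Lemma pt_ev_res U V f : pt_nb U -> pt_nb V -> V `<=` U -> reg U f ->
  pt_ev V f = pt_ev U f.
Proof.
move=> nU nV sV rf; have rV := reg_res (pt_nb_open nU) (pt_nb_open nV) sV rf.
symmetry; apply: pt_ev_eq => //; have [a [b [wb H ->]]] := pt_evP nV rV.
by exists a, b; split=> // u Uu bu; have [/sV Wu ->] := H _ Uu bu.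
Qed.

Lemma pt_ev1 U : pt_nb U -> pt_ev U (fun=> 1) = 1.
Proof.
move=> nU; have oU := pt_nb_open nU; apply: pt_ev_eq => //; first exact: reg_cst.
have [_ [P [wP sP]]] := nU; exists P, P; rewrite divff //; split=> // u Uu Pu.
by split; [apply: sP|rewrite divff].
Qed.

Lemma pt_evD U f g : pt_nb U -> reg U f -> reg U g ->
  pt_ev U (fun x => f x + g x) = pt_ev U f + pt_ev U g.
Proof.
move=> nU rf rg; have oU := pt_nb_open nU; apply: pt_ev_eq => //; first exact: regD.
have [a [b [wb H ->]]] := pt_evP nU rf; have [a' [b' [wb' H' ->]]] := pt_evP nU rg.
exists (PAdd (PMul a b') (PMul a' b)), (PMul b b') => /=.
rewrite mulf_neq0 // addf_div //; split=> // u Uu.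
rewrite mulf_eq0 negb_or => /andP[bu bu'].
have [Wu ->] := H _ Uu bu; have [_ ->] := H' _ Uu bu'.
by rewrite addf_div.
Qed.

Lemma pt_evM U f g : pt_nb U -> reg U f -> reg U g ->
  pt_ev U (fun x => f x * g x) = pt_ev U f * pt_ev U g.
Proof.
move=> nU rf rg; have oU := pt_nb_open nU; apply: pt_ev_eq => //; first exact: regM.
have [a [b [wb H ->]]] := pt_evP nU rf; have [a' [b' [wb' H' ->]]] := pt_evP nU rg.
exists (PMul a a'), (PMul b b') => /=.
rewrite mulf_neq0 // mulf_div; split=> // u Uu.
rewrite mulf_eq0 negb_or => /andP[bu bu'].
have [Wu ->] := H _ Uu bu; have [_ ->] := H' _ Uu bu'.
by rewrite mulf_div.
Qed.

Lemma pt_local U f : pt_nb U -> reg U f -> pt_ev U f != 0 ->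
  pt_nb (U `&` [set x | f x != 0]).
Proof.
move=> nU rf; have oU := pt_nb_open nU.
have [a [b [wb H ->]]] := pt_evP nU rf => nz.
split; first exact: reg_open.
exists (PMul a b) => /=; split.
  by rewrite mulf_neq0 //; apply: contraNneq nz => ->; rewrite mul0r.
move=> u Uu; rewrite mulf_eq0 negb_or => /andP[au bu].
have [Wu E] := H _ Uu bu; split=> //=.
by rewrite E mulf_neq0 // invr_eq0.
Qed.

End PointOfChart.

Lemma dominant_rational_ptot (k : fieldType) (X Y : funspace k) (pi : X -> Y) :
  morphism pi -> dominant pi -> dominant_rational (ptot pi).
Proof.
move=> mpi dpi; split=> // O oO nO.
by have [y [Oy [x _ E]]] := dpi _ nO oO; rewrite -E in Oy; exists x.
Qed.

Lemma isrep_pev (k : closedFieldType) (X : irrvariety k) (U : set X) m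
    (x : 'I_m -> X -> k) (xi : 'I_m -> funfield X) (P : pex k 'I_m) :
  open U -> U !=set0 -> (forall i, isrep (xi i) U (x i)) ->
  isrep (pev (ffcst X) xi P) U (fun u => pev id (x^~ u) P).
Proof.
move=> oU nU H; elim: P => /= [c|i|a Ha b Hb|a Ha b Hb].
- exact: isrep_sub (isrep_cst X c).
- exact: H.
- by have := isrepD Ha Hb; rewrite setIid.
- by have := isrepM Ha Hb; rewrite setIid.
Qed.

(** The coordinates of a chart are elements of k(X), an extension of k(Y) through [e]; specialising
    them to K over k(Y), while keeping nonzero an equation [b] of a basic open inside [U], produces
    the point. *)
Lemma geompt_exists (k : closedFieldType) (X Y : irrvariety k) (pi : X -> Y)
    (K : closedFieldType) (iota : {rmorphism funfield Y -> K}) (U : set X) :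
  morphism pi -> dominant pi -> open U -> U !=set0 ->
  exists z : geompt pi iota, nb z U.
Proof.
move=> mpi dpi oU [u0 Uu0].
have [e He] := pullback_exists (dominant_rational_ptot mpi dpi).
have ecst c : e (ffcst Y c) = ffcst X c.
  by apply: (isrep_eq (He _ _ _ (isrep_cst Y c)) (isrep_cst X c) openT (irrT X)).
have [U0 [m [x [U0u cx]]]] := irr_affine_coords u0.
have [V0 [m' [y [V0u cy]]]] := irr_affine_coords (pi u0).
have oU0 := coords_open cx; have nU0 : U0 !=set0 by exists u0.
have oV0 := coords_open cy.
have oW0 : open (U `&` pi @^-1` V0).
  by apply: openI => //; apply: morphism_on_preimage mpi oV0.
have [b [bu sb]] := coords_nbhs cx oW0 U0u (conj Uu0 V0u).
have /choice[xi xiP] : forall i, exists l, isrep l U0 (x i).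
  by move=> i; apply: isrep_intro oU0 nU0 (coords_reg cx i).
have rep P := isrep_pev P oU0 nU0 xiP.
have evF P : pev e xi (pex_map (ffcst Y) P) = pev (ffcst X) xi P.
  by rewrite pev_map; congr (pev _ _ _); apply/funext => c; apply: ecst.
have b0 : pev e xi (pex_map (ffcst Y) b) != 0.
  rewrite evF; apply: contraNneq bu => E; apply/eqP.
  by have := rep b; rewrite E => r; apply: (isrep_agree r (isrep0 X)).
(* Specialising over k(Y), and not merely over k, preserves all relations with coefficients in k(Y);
   this places the point over the generic point of [Y]. *)
have [w [kw bw]] := field_specialisation iota b0.
pose kappa : {rmorphism k -> K} := iota \o ffcst Y.
have evK P : pev iota w (pex_map (ffcst Y) P) = pev kappa w P by rewrite pev_map.
rewrite evK in bw.
have w_kill P : (forall u, U0 u -> pev id (x^~ u) P = 0) -> pev kappa w P = 0.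
  move=> P0; rewrite -evK; apply: kw; rewrite evF.
  by apply: (isrep_eq0 (rep P) oU0 nU0) => u _ /P0.
(* If the pull-back of [f] is a / d on the chart, then f d = a is a relation over k(Y), so it holds
   at [w]. *)
have over (f : germ Y) : pt_nb kappa U0 x w (pi @^-1` gdom f) ->
    pt_ev kappa U0 x w (pi @^-1` gdom f) (gfun f \o pi) = iota (rfun f).
  move=> nf; have [_ rf] := mpi _ (gdom_open f); rewrite setTI in rf.
  have rfp := rf _ (greg f).
  have [a [d [wd H ->]]] := pt_evP cx w_kill nf rfp.
  have := kw (PAdd (PMul (PCst _ (rfun f)) (pex_map (ffcst Y) d))
    (PMul (PCst _ (-1)) (pex_map (ffcst Y) a))).
  rewrite /= !evF !evK !rmorphN !rmorph1 !mulN1r => E.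
  apply: (canLR (mulfK wd)); apply/eqP; rewrite eq_sym -subr_eq0.
  apply/eqP/E/eqP; rewrite subr_eq0; apply/eqP.
  apply: (isrep_eq (isrepM (He _ _ _ (isrep_rfun f)) (rep d)) (rep a)
    (reg_open oU0 (isrep_reg (rep d)))).
    by apply: isrep_nonzero (rep d) _; apply: contra_neq wd => d0; rewrite -evK kw // evF.
  move=> u [U0u' /= du] _ _; have [_ /= ->] := H _ U0u' du.
  by rewrite divfK.
have nb0 : pt_nb kappa U0 x w (U `&` pi @^-1` V0) by split=> //; exists b.
(* For a nonempty [V], take a basic open of the chart of [Y] inside [V]: its equation is a nonzero
   element of k(Y), so its value at the point is nonzero and locality applies. *)
have generic (V : set Y) : open V ->
    pt_nb kappa U0 x w (pi @^-1` V) <-> V !=set0.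
  move=> oV; split.
    move=> [_ [P [wP sP]]]; have [u [Uu Pu _]] := closed_specialisation cx w_kill wP.
    by exists (pi u); apply: sP.
  move=> nV; have [v [Vv V0v]] := irr_meet oV oV0 nV (ex_intro _ _ V0u).
  have [h [hv sh]] := coords_nbhs cy oV V0v Vv.
  have rh : reg V0 (fun v => pev id (y^~ v) h).
    by apply: reg_pev => // i; apply: (coords_reg cy i).
  pose g := Germ oV0 (ex_intro _ _ V0u) rh.
  have nbg : pt_nb kappa U0 x w (pi @^-1` gdom g).
    apply: pt_nb_up nb0 _ _; first exact: morphism_on_preimage mpi oV0.
    by move=> u [].
  have [_ rgp] := mpi _ oV0; rewrite setTI in rgp.
  have := pt_local cx w_kill nbg (rgp _ rh); rewrite (over g nbg) (fmorph_eq0 iota) => H.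
  apply: pt_nb_up (H _) _ _.
  - apply: contraNneq hv => E; apply/eqP; have := isrep_rfun g; rewrite E => r.
    exact: (isrep_agree r (isrep0 Y)).
  - exact: morphism_on_preimage mpi oV.
  - by move=> u [/= V0pu hu]; apply: sh.
exists (@GeomPt k X Y pi K iota (pt_nb kappa U0 x w) (pt_ev kappa U0 x w)
  (@pt_nb_open _ _ kappa X U0 m x w) (@pt_nbI _ _ kappa X U0 m x w)
  (@pt_nb_up _ _ kappa X U0 m x w) (pt_nb_prime cx w_kill)
  (@pt_ev_junk _ _ kappa X U0 m x w) (pt_ev_ext cx w_kill) (pt_ev_res cx w_kill)
  (pt_ev1 cx w_kill) (pt_evD cx w_kill) (pt_evM cx w_kill) (pt_local cx w_kill)
  generic (fun f => over f ((generic _ (gdom_open f)).2 (gdom_neq0 f)))).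
by apply: pt_nb_up nb0 oU _ => u [].
Qed.

(** * Base change *)

Section GeneralPoints.
Context (k : closedFieldType) (X Y : irrvariety k) (pi : X -> Y).
Context (K : closedFieldType) (iota : {rmorphism funfield Y -> K}).
Local Notation pt := (geompt pi iota).
Implicit Types (z w : pt) (U V : set X).

Lemma nbIE z U V : open U -> open V -> nb z (U `&` V) <-> nb z U /\ nb z V.
Proof.
move=> oU oV; split=> [h|[hU hV]]; last exact: nbI.
by split; apply: nb_up h _ _ => // x [].
Qed.

(** The empty set is an empty union, and primeness of the filter would single out one of its
    members. *)
Lemma nb_nonempty z U : nb z U -> U !=set0.
Proof.
move=> nU; apply: contrapT => H.
have [||V []] := @nb_prime _ _ _ _ _ _ z set0; first by [].
by rewrite bigcup_set0; move: nU; congr (nb z); apply/seteqP; split=> x // Ux; case: H; exists x.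
Qed.

Lemma geompt_eq z w : nb z = nb w -> ev z = ev w -> z = w.
Proof.
case: z w => [nz ez ? ? ? ? ? ? ? ? ? ? ? ? ?] [nw ew ? ? ? ? ? ? ? ? ? ? ? ? ?] /=.
by move=> E E'; subst nw ew; f_equal; apply: Prop_irrelevance.
Qed.

Lemma gpt_comp_uniq s z w w' : gpt_comp s z w -> gpt_comp s z w' -> w = w'.
Proof.
move=> [_ nE eE] [_ nE' eE'].
have E : nb w = nb w'.
  apply/seteqP; split=> U nU.
    by apply/(nE' _ (nb_open nU))/(nE _ (nb_open nU)).
  by apply/(nE _ (nb_open nU))/(nE' _ (nb_open nU)).
apply: geompt_eq => //; apply/funext => U; apply/funext => f.
have [[nU rf]|H] := pselect (nb w U /\ reg U f).
  by rewrite eE // eE' // -E.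
by rewrite !ev_junk // -E.
Qed.

Section Composite.
Context (s : ratrep X X) (ms : morphism_on (dom s) (fn s)).
Hypothesis s_over : forall x, dom s x -> pi (fn s x) = pi x.
Context (mpi : morphism pi) (z : pt) (zs : nb z (dom s)).
Local Notation "s^* U" := (dom s `&` fn s @^-1` U) (at level 10).

Let ods : open (dom s). Proof. exact: nb_open zs. Qed.

Let pull_open U : open U -> open (s^* U).
Proof. by move=> oU; have [] := ms oU. Qed.

Let pull_reg U f : open U -> reg U f -> reg (s^* U) (f \o fn s).
Proof. by move=> oU; have [_] := ms oU; apply. Qed.

Definition comp_nb : set (set X) := [set U | open U /\ nb z (s^* U)].

Definition comp_ev U f : K :=
  if pselect (comp_nb U /\ reg U f) then ev z (s^* U) (f \o fn s) else 0.

Lemma comp_evE U f : comp_nb U -> reg U f ->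
  comp_ev U f = ev z (s^* U) (f \o fn s).
Proof. by move=> nU rf; rewrite /comp_ev; case: pselect => // -[]. Qed.

Lemma gpt_comp_exists : exists w, gpt_comp s z w.
Proof.
have nb_o : comp_nb `<=` open by move=> U [].
have nb_I U V : comp_nb U -> comp_nb V -> comp_nb (U `&` V).
  move=> [oU nU] [oV nV]; split; first exact: openI.
  rewrite preimage_setI -{1}[dom s]setIid setIACA; exact: nbI.
have nb_u U V : comp_nb U -> open V -> U `<=` V -> comp_nb V.
  move=> [oU nU] oV sV; split=> //; apply: nb_up nU _ _; first exact: pull_open.
  by move=> x [? /sV].
have nb_p (F : set (set X)) : F `<=` open ->
    comp_nb (\bigcup_(U in F) U) -> exists2 U, F U & comp_nb U.
  move=> oF [_ nF].
  have [||_ [U FU <-] nU] := @nb_prime _ _ _ _ _ _ z [set s^* U | U in F].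
  - by move=> _ [U FU <-]; apply/pull_open/oF.
  - move: nF; congr (nb z); apply/seteqP; split=> x.
      by move=> [sx [U FU Ux]]; exists (s^* U) => //; exists U.
    by move=> [_ [U FU <-] [sx Ux]]; split=> //; exists U.
  by exists U => //; split=> //; apply: oF.
have junk U f : ~ (comp_nb U /\ reg U f) -> comp_ev U f = 0.
  by rewrite /comp_ev; case: pselect.
have ext U f g : comp_nb U -> reg U f -> (forall x, U x -> f x = g x) ->
    comp_ev U f = comp_ev U g.
  move=> nU rf e; have [oU nU'] := nU; have rg := reg_ext oU e rf.
  rewrite !comp_evE //; apply: ev_ext => //; first exact: pull_reg.
  by move=> x [_ Ux] /=; apply: e.
have res U V f : comp_nb U -> comp_nb V -> V `<=` U -> reg U f ->
    comp_ev V f = comp_ev U f.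
  move=> nU nV sV rf; have [oU nU'] := nU; have [oV nV'] := nV.
  rewrite !comp_evE //; last exact: reg_res rf.
  apply: ev_res => //; first by move=> x [? /sV].
  exact: pull_reg.
have one U : comp_nb U -> comp_ev U (fun=> 1) = 1.
  move=> nU; have [oU nU'] := nU; rewrite comp_evE //; last exact: reg_cst.
  exact: (ev1 nU').
have add U f g : comp_nb U -> reg U f -> reg U g ->
    comp_ev U (fun x => f x + g x) = comp_ev U f + comp_ev U g.
  move=> nU rf rg; have [oU nU'] := nU; rewrite !comp_evE //; last exact: regD.
  exact: (evD nU' (pull_reg oU rf) (pull_reg oU rg)).
have mul U f g : comp_nb U -> reg U f -> reg U g ->
    comp_ev U (fun x => f x * g x) = comp_ev U f * comp_ev U g.
  move=> nU rf rg; have [oU nU'] := nU; rewrite !comp_evE //; last exact: regM.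
  exact: (evM nU' (pull_reg oU rf) (pull_reg oU rg)).
have local U f : comp_nb U -> reg U f -> comp_ev U f != 0 ->
    comp_nb (U `&` [set x | f x != 0]).
  move=> nU rf; have [oU nU'] := nU; rewrite comp_evE // => nz.
  split; first exact: reg_open.
  by have := gpt_local nU' (pull_reg oU rf) nz; rewrite -setIA.
have pullpi (V : set Y) : s^* (pi @^-1` V) = dom s `&` pi @^-1` V.
  by apply/seteqP; split=> x [sx] /=; rewrite s_over.
have opi (V : set Y) : open V -> open (pi @^-1` V).
  exact: morphism_on_preimage mpi.
have generic (V : set Y) : open V -> comp_nb (pi @^-1` V) <-> V !=set0.
  move=> oV; rewrite -(gpt_generic z oV); split=> [[_]|nV].
    by rewrite pullpi => /(nbIE _ ods (opi _ oV))[].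
  by split; [exact: opi|rewrite pullpi; apply: nbI].
have over (f : germ Y) : comp_ev (pi @^-1` gdom f) (gfun f \o pi) = iota (rfun f).
  have nV := (generic _ (gdom_open f)).2 (gdom_neq0 f).
  have [_ rf] := mpi (gdom_open f); rewrite setTI in rf; have rfp := rf _ (greg f).
  have zV := (gpt_generic z (gdom_open f)).2 (gdom_neq0 f).
  rewrite comp_evE // -(gpt_over z).
  rewrite -(ev_res zV (V := dom s `&` pi @^-1` gdom f)) //; last exact: nbI.
  have nV2 := nV.2; rewrite pullpi in nV2 *; apply: ev_ext => //.
    by have := pull_reg (opi _ (gdom_open f)) rfp; rewrite pullpi.
  by move=> x [sx _] /=; rewrite s_over.
exists (@GeomPt k X Y pi K iota comp_nb comp_ev nb_o nb_I nb_u nb_p junk ext res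
  one add mul local generic over).
split=> //= U; first by move=> oU; split=> [[]|].
by move=> f nU rf; rewrite comp_evE.
Qed.

End Composite.
End GeneralPoints.

(** * The function field of the generic fibre and the pull-back of a birational transformation *)

Section BaseChange.
Context (k : closedFieldType) (X Y : irrvariety k) (pi : X -> Y).
Context (mpi : morphism pi) (dpi : dominant pi).
Context (K : closedFieldType) (iota : {rmorphism funfield Y -> K}).
Context (XKv : variety (geom_generic_fibre pi iota)).
Context (XKi : irreducible (geom_generic_fibre pi iota)).
Let XK : irrvariety K := IrrVariety XKv XKi.

Definition hat (U : set X) : set XK := [set z : geompt pi iota | nb z U].

Definition hat_ev (U : set X) (f : X -> k) : XK -> K :=
  fun z : geompt pi iota => ev z U f.

Lemma hat_open U : open U -> open (hat U).
Proof. by move=> oU; apply: open_chart; exists U. Qed.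

Lemma hat_neq0 U : open U -> U !=set0 -> hat U !=set0.
Proof. exact: geompt_exists. Qed.

Lemma hat_reg U f : open U -> reg U f -> reg (hat U) (hat_ev U f).
Proof.
move=> oU rf; apply: reg_kalg; first by exists U.
by apply: kalg_gen; exists U, f; split.
Qed.

(** This is the embedding of k(X) into K(X_K): a function regular on [U] is evaluated at the points
    of X_K lying over [U], which exist by specialisation. *)
Lemma embedding_exists : exists j : {rmorphism funfield X -> funfield XK},
  forall l U f, isrep l U f -> isrep (j l) (hat U) (hat_ev U f).
Proof.
have pull l U f : isrep l U f -> exists m : funfield XK,
    isrep m (hat U) (hat_ev U f).
  move=> r; have oU := isrep_open r.
  apply: isrep_intro; first exact: hat_open.
    exact: hat_neq0 (isrep_neq0 r).
  exact: hat_reg (isrep_reg r).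
have fn_ l U f (m : funfield XK) U' f' (m' : funfield XK) :
    isrep l U f -> isrep l U' f' ->
    isrep m (hat U) (hat_ev U f) -> isrep m' (hat U') (hat_ev U' f') -> m = m'.
  move=> r r' rm rm'; apply: (isrep_eq rm rm' openT (irrT XK)) => z _ zU zU'.
  rewrite /hat_ev; have zI := nbI zU zU'.
  have rI : reg (U `&` U') f.
    by apply: reg_res (isrep_reg r) => //; [exact: isrep_open r|exact: nb_open zI].
  have s1 : U `&` U' `<=` U by move=> x [].
  have s2 : U `&` U' `<=` U' by move=> x [].
  rewrite -(ev_res zU zI s1 (isrep_reg r)) -(ev_res zU' zI s2 (isrep_reg r')).
  by apply: ev_ext => // x [Ux Ux']; apply: (isrep_agree r r').
(* Sums and products are treated together; [op] ranges over fields because it is applied both in k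
   and in K. *)
have sumprod (op : forall F : fieldType, F -> F -> F) l l' U f U' f'
    (m m' w : funfield XK) :
  (forall z : geompt pi iota, forall U f g, nb z U -> reg U f -> reg U g ->
    ev z U (fun x => op k (f x) (g x)) = op K (ev z U f) (ev z U g)) ->
  isrep l U f -> isrep l' U' f' ->
  isrep m (hat U `&` hat U') (fun z => op K (hat_ev U f z) (hat_ev U' f' z)) ->
  isrep w (hat (U `&` U')) (hat_ev (U `&` U') (fun x => op k (f x) (f' x))) ->
  m = w.
  move=> H r r' rm rw; apply: (isrep_eq rm rw openT (irrT XK)) => z _ [zU zU'] zI.
  have oI := nb_open zI; rewrite /hat_ev H //.
  - have s1 : U `&` U' `<=` U by move=> x [].
    have s2 : U `&` U' `<=` U' by move=> x [].
    by rewrite (ev_res zU zI s1 (isrep_reg r)) (ev_res zU' zI s2 (isrep_reg r')).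
  - by apply: reg_res (isrep_reg r) => //; exact: isrep_open r.
  - by apply: reg_res (isrep_reg r') => //; exact: isrep_open r'.
have [j H] : exists j : {rmorphism funfield X -> funfield XK},
    forall l, exists U f, isrep l U f /\ isrep (j l) (hat U) (hat_ev U f).
  apply: (rmorphism_of_relation (Rl := fun l (m : funfield XK) =>
    exists U f, isrep l U f /\ isrep m (hat U) (hat_ev U f))).
  - move=> l; have r := isrep_repr l; have [m rm] := pull _ _ _ r.
    by exists m, (gdom (repr l)), (gfun (repr l)).
  - by move=> l m m' [U [g [r rm]]] [U' [g' [r' rm']]]; apply: fn_ r r' rm rm'.
  - have [m rm] := pull _ _ _ (isrep1 X).
    exists setT, (fun=> 1); split; first exact: isrep1.
    rewrite (_ : 1 = m) //; apply: (isrep_eq (isrep1 XK) rm openT (irrT XK)).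
    by move=> z _ _ zT; rewrite /hat_ev ev1.
  - move=> l l' m m' [U [g [r rm]]] [U' [g' [r' rm']]].
    have [w rw] := pull _ _ _ (isrepD r r').
    exists (U `&` U'), (fun x => g x + g' x); split; first exact: isrepD.
    rewrite (_ : m + m' = w) //.
    apply: (sumprod (fun F => +%R) _ _ _ _ _ _ _ _ _ _ r r' (isrepD rm rm') rw).
      exact: m.
    exact: evD.
  - move=> l l' m m' [U [g [r rm]]] [U' [g' [r' rm']]].
    have [w rw] := pull _ _ _ (isrepM r r').
    exists (U `&` U'), (fun x => g x * g' x); split; first exact: isrepM.
    rewrite (_ : m * m' = w) //.
    apply: (sumprod (fun F => *%R) _ _ _ _ _ _ _ _ _ _ r r' (isrepM rm rm') rw).
      exact: m.
    exact: evM.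
exists j => l U g r; have [U' [g' [r' rt]]] := H l.
have [m rm] := pull _ _ _ r.
by rewrite (fn_ _ _ _ _ _ _ _ r' r rt rm).
Qed.

Context (j : {rmorphism funfield X -> funfield XK}).
Hypothesis jP : forall l U f, isrep l U f -> isrep (j l) (hat U) (hat_ev U f).

(** A rational function on X_K is locally a quotient of elements of the K-algebra generated by
    evaluations of regular functions of X; hence K and k(X) generate K(X_K) as a field. *)
Lemma fibre_funfield_ind (S : set (funfield XK)) : (forall c, S (ffcst XK c)) ->
  (forall l, S (j l)) -> (forall x y, S x -> S y -> S (x + y)) ->
  (forall x y, S x -> S y -> S (x * y)) -> (forall x, S x -> S x^-1) ->
  forall h, S h.
Proof.
move=> Sc Sj SD SM SV h; have r := isrep_repr h.
have oO := isrep_open r; have [z0 Oz0] := isrep_neq0 r; have rf := isrep_reg r.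
have [D [p [q [hD hp hq [Dz0 qz0] E]]]] := rf _ Oz0.
have oD : open (D : set XK) by apply: open_chart.
have nD : (D : set XK) !=set0 by exists z0.
have repD g : kalg (gens (fibre_data pi iota) D) g ->
    exists2 m : funfield XK, S m & isrep m (D : set XK) g.
  elim=> [c|f [U [g' [oU rg ED Ef]]]|f1 f2 _ [m1 S1 r1] _ [m2 S2 r2]
      |f1 f2 _ [m1 S1 r1] _ [m2 S2 r2]].
  - by exists (ffcst XK c) => //; apply: isrep_sub (isrep_cst XK c).
  - have nU : U !=set0 by apply: (@nb_nonempty _ _ _ _ _ _ z0); rewrite ED in Dz0.
    have [l rl] := isrep_intro oU nU rg.
    exists (j l) => //; have := jP rl; rewrite (_ : hat U = D) //.
    by apply: isrep_ext => z Dz; rewrite Ef.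
  - by exists (m1 + m2); [exact: SD|have := isrepD r1 r2; rewrite setIid].
  - by exists (m1 * m2); [exact: SM|have := isrepM r1 r2; rewrite setIid].
have [mp Sp rp] := repD _ hp; have [mq Sq rq] := repD _ hq.
have q0 : mq != 0.
  apply: contraNneq qz0 => E0; apply/eqP; rewrite E0 in rq.
  exact: (isrep_agree rq (isrep0 XK)).
suff -> : h = mp * mq^-1 by apply: SM => //; apply: SV.
apply: (canRL (mulfK q0)).
have oq := reg_open (isrep_open rq) (isrep_reg rq).
apply: (isrep_eq (isrepM r rq) rp oq); first exact: isrep_nonzero rq q0.
by move=> z [Dz /= qz] [Oz _] _; rewrite E // divfK.
Qed.

Section RationalMap.
Context (s : ratrep X X) (ms : morphism_on (dom s) (fn s)).
Hypothesis s_over : forall x, dom s x -> pi (fn s x) = pi x.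
Let sK : ratrep XK XK := base_change pi iota s.

Lemma base_changeP (z : geompt pi iota) : nb z (dom s) -> gpt_comp s z (fn sK z).
Proof.
move=> zs; have [w cw] := gpt_comp_exists ms s_over mpi zs.
by apply: (@xgetPex _ z [set w | gpt_comp s z w]); exists w.
Qed.

Lemma base_change_dom : dom sK = hat (dom s).
Proof.
apply/seteqP; split=> z; first by case=> w [].
by move/base_changeP => c; exists (fn sK z).
Qed.

Lemma base_change_preimage U : open U ->
  dom sK `&` fn sK @^-1` (hat U) = hat (dom s `&` fn s @^-1` U).
Proof.
move=> oU; have [oU' _] := ms oU; have ods := morphism_on_open ms.
rewrite base_change_dom; apply/seteqP; split=> z.
  by move=> [/base_changeP[_ H _] /= zU]; apply/H.
move=> zU; have zs : nb z (dom s) by apply: nb_up zU ods _ => x [].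
by split=> //; have [_ H _] := base_changeP zs; apply/H.
Qed.

Lemma base_change_ev U f z : open U -> reg U f ->
  (dom sK `&` fn sK @^-1` (hat U)) z ->
  hat_ev U f (fn sK z) = hat_ev (dom s `&` fn s @^-1` U) (f \o fn s) z.
Proof.
rewrite base_change_dom => oU rf [/base_changeP[_ _ H] zU].
exact: H.
Qed.

Lemma morphism_base_change : morphism_on (dom sK) (fn sK).
Proof.
apply: morphism_on_genspace => D [U oU ED].
have {}ED : D = hat U := ED.
have [oU' rU'] := ms oU.
split; first by rewrite ED base_change_preimage //; apply: hat_open.
move=> h [U1 [f [oU1 rf ED1 Eh]]]; have {}ED1 : D = hat U1 := ED1.
have [oU1' rU1'] := ms oU1.
rewrite ED1 base_change_preimage //.
apply: reg_ext (hat_reg oU1' (rU1' _ rf)); first exact: hat_open.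
move=> z; rewrite -base_change_preimage // => zU /=.
by rewrite -base_change_ev // Eh //; case: zU; rewrite ED1.
Qed.

End RationalMap.

Section Birational.
Context (sigma : ratrep X X) (bir : birational_over pi sigma).
Let sK : ratrep XK XK := base_change pi iota sigma.

(** Compatibility with [pi] is given on a dense open only, whereas composing with a point requires
    it on the whole domain; separatedness of [Y] bridges the gap. *)
Lemma extend_over (s : ratrep X X) (W : set X) : morphism_on (dom s) (fn s) ->
  open W -> W !=set0 -> (forall x, W x -> pi (fn s x) = pi x) ->
  forall x, dom s x -> pi (fn s x) = pi x.
Proof.
move=> ms oW nW e; have ods := morphism_on_open ms.
have m1 : morphism_on (dom s) (pi \o fn s).
  by have := morphism_on_comp ms mpi; rewrite preimage_setT setIT.
have m2 : morphism_on (dom s) pi by apply: (morphism_on_sub ods _ mpi).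
apply: (agree_irr (@irr_separated _ Y) (irr_irreducible X) m1 m2 oW nW).
by move=> x _; apply: e.
Qed.

Lemma sigma_morphism : morphism_on (dom sigma) (fn sigma).
Proof. by case: bir => -[[]]. Qed.

Lemma sigma_over x : dom sigma x -> pi (fn sigma x) = pi x.
Proof.
have [_ [W [oW dW _ e]]] := bir.
by apply: (extend_over sigma_morphism oW (dense_nonempty (irrT X) dW)).
Qed.

Lemma sigma_inverse : exists (g : ratrep X X) (W : set X),
  [/\ morphism_on (dom g) (fn g), forall x, dom g x -> pi (fn g x) = pi x,
      open W, W !=set0 & forall x, W x ->
        [/\ dom g x, dom sigma (fn g x) & fn sigma (fn g x) = x]].
Proof.
have [[_ [g [[_ _ mg] _ [W [oW dW sW e]]]]] _] := bir.
have nW := dense_nonempty (irrT X) dW.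
have H x : W x -> [/\ dom g x, dom sigma (fn g x) & fn sigma (fn g x) = x].
  by move=> Wx; have [[gx sgx] _] := sW _ Wx; split=> //; apply: e.
exists g, W; split=> //; apply: (extend_over mg oW nW) => x /H[_ d E].
by rewrite -[in RHS]E sigma_over.
Qed.

Lemma sigma_dominant : dominant_rational sigma.
Proof.
split; first exact: sigma_morphism.
move=> O oO nO; have [g [W [_ _ oW nW H]]] := sigma_inverse.
have [_ [x [Ox /H[gx sgx E]]]] := irrI oO oW nO nW.
by exists (fn g x); split=> //=; rewrite E.
Qed.

(** The argument is pointwise: a point z of the given open that lies over [W] is composed with the
    inverse [g], and the resulting w is sent back to z. *)
Lemma base_change_dominant : dominant_rational sK.
Proof.
split; first exact: morphism_base_change sigma_morphism sigma_over.
move=> O oO nO; have [g [W [mg g_over oW nW H]]] := sigma_inverse.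
have [_ [z [Oz zW]]] := irrI oO (hat_open oW) nO (hat_neq0 oW nW).
have {}zW : nb z W := zW.
have ms := sigma_morphism; have ods := morphism_on_open ms.
have odg := morphism_on_open mg.
have zg : nb z (dom g) by apply: nb_up zW odg _ => x /H[].
have [w [_ nE eE]] := gpt_comp_exists mg g_over mpi zg.
have [ogs _] := mg _ ods.
have ws : nb w (dom sigma).
  by apply/(nE _ ods); apply: nb_up zW ogs _ => x /H[].
(* Neighbourhoods and values at z are compared after intersecting with [W], where applying [g] and
   then [sigma] is the identity. *)
have cz : gpt_comp sigma w z.
  split=> // U.
    move=> oU; have [oU1 _] := ms _ oU; have [oU2 _] := mg _ oU1.
    rewrite (nE _ oU1); split=> zU.
      apply: nb_up (nbI zU zW) oU2 _ => x [Ux /H[gx sgx E]].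
      by split=> //=; split=> //=; rewrite E.
    apply: nb_up (nbI zU zW) oU _ => x [[_ [_ Ux]] /H[_ _ E]].
    by move: Ux => /=; rewrite E.
  move=> f zU rf; have oU := nb_open zU; have [oU1 rU1] := ms _ oU.
  have [oU2 rU2] := mg _ oU1.
  have zUW := nbI zU zW.
  have sub : U `&` W `<=` dom g `&` fn g @^-1` (dom sigma `&` fn sigma @^-1` U).
    move=> x [Ux /H[gx sgx E]].
    by split=> //=; split=> //=; rewrite E.
  have zU2 := nb_up zUW oU2 sub.
  have wU1 : nb w (dom sigma `&` fn sigma @^-1` U) by apply/(nE _ oU1).
  rewrite (eE _ _ wU1 (rU1 _ rf)).
  have sub1 : U `&` W `<=` U by move=> x [].
  rewrite -(ev_res zU zUW sub1 rf) -(ev_res zU2 zUW sub (rU2 _ (rU1 _ rf))).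
  apply: (ev_ext zUW (reg_res oU (nb_open zUW) sub1 rf)).
  by move=> x [_ /H[_ _ E]] /=; rewrite E.
exists w; split; first by exists z.
have E : fn sK w = z.
  exact: (gpt_comp_uniq (base_changeP sigma_morphism sigma_over ws) cz).
by change (O (fn sK w)); rewrite E.
Qed.

Context (theta : {rmorphism funfield X -> funfield X}).
Hypothesis thetaP : forall l U g, isrep l U g ->
  isrep (theta l) (dom sigma `&` fn sigma @^-1` U) (g \o fn sigma).
Context (thetaK : {rmorphism funfield XK -> funfield XK}).
Hypothesis thetaKP : forall l U g, isrep l U g ->
  isrep (thetaK l) (dom sK `&` fn sK @^-1` U) (g \o fn sK).

(** Hence the iterates of an element of k(X) form one sequence, whether computed in k(X) or in
    K(X_K): only the field of coefficients of the interpolating fraction changes. *)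
Lemma thetaK_embedding l : thetaK (j l) = j (theta l).
Proof.
have r := isrep_repr l; have oU := isrep_open r.
apply: (isrep_eq (thetaKP (jP r)) (jP (thetaP r)) openT (irrT XK)).
move=> z _ zU _ /=.
exact: (base_change_ev sigma_morphism sigma_over oU (isrep_reg r) zU).
Qed.

Lemma iter_thetaK_embedding n l : iter n thetaK (j l) = j (iter n theta l).
Proof. by elim: n => //= n ->; rewrite thetaK_embedding. Qed.

End Birational.
End BaseChange.

Theorem proposition4p2 (k : closedFieldType) (k_char0 : [pchar k] =i pred0)
  (X Y : irrvariety k) (pi : X -> Y) (pi_mor : morphism pi)
  (pi_dom : dominant pi)
  (K : closedFieldType) (iota : {rmorphism funfield Y -> K})
  (K_closure : algebraic_closure iota)
  (XK_variety : variety (geom_generic_fibre pi iota))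
  (XK_irr : irreducible (geom_generic_fibre pi iota))
  (sigma : ratrep X X) (sigma_bir : birational_over pi sigma) :
  unipotent (base_change pi iota sigma) <-> unipotent sigma.
Proof.
have K0 : [pchar K] =i pred0.
  by move=> p; rewrite -(k_char0 p) (fmorph_pchar (iota \o ffcst Y)).
pose XK := IrrVariety XK_variety XK_irr.
have ds := sigma_dominant pi_mor sigma_bir.
have dsK := base_change_dominant pi_mor pi_dom XK_variety XK_irr sigma_bir.
have [theta thetaP] := pullback_exists ds.
have [thetaK thetaKP] := @pullback_exists _ XK XK _ dsK.
have [j jP] := embedding_exists pi_mor pi_dom XK_variety XK_irr.
have iterj := iter_thetaK_embedding pi_mor jP sigma_bir thetaP thetaKP.
split=> [uK|u].
  apply: (interpolable_unipotent k_char0 ds thetaP) => l.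
  have [p [q H]] := unipotent_interpolable K0 dsK thetaKP (j l) uK.
  apply: (interpolation_descent (funfield_char0 XK K0) (j := j) (p := p) (q := q)).
  by move=> n /H; rewrite iterj.
apply: (interpolable_unipotent K0 dsK thetaKP).
apply: (fibre_funfield_ind jP).
- by move=> c; apply: interpolableC; exact: (theta_cst thetaKP c).
- move=> l; have [p [q H]] := unipotent_interpolable k_char0 ds thetaP l u.
  exists (map_poly j p), (map_poly j q) => n /H[q0 E].
  by rewrite iterj -(rmorph_nat j) !horner_map /= E rmorphM fmorph_eq0.
- exact: interpolableD.
- exact: interpolableM.
- exact: interpolableV.
Qed.
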